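(* Let $X$ be a Mumford curve of genus $g(X)>0$ over $\mathbb{Q}_p$, let $F\subset\mathbb{Q}_p$ be a good fundamental domain for $X$, let $\mathscr{H}$ be the set of inner holes of $F$, and let $N=|\mathscr{H}|$. Let $G$ be the complete graph on the vertex set $\mathscr{H}$, including all loop-edges, with $U_H=H\subset\mathbb{Q}_p$ for $H\in\mathscr{H}$. Let $\alpha>0$, and let $d^\alpha_G=d^\alpha$, $D^\alpha$, $\Delta^\alpha_\rho$, their heat kernels and the index be those attached to $G$ as in the context. Then $$\operatorname{ind}(d_G^\alpha)=\lim_{t\to\infty}\left(\operatorname{tr}(p_{D^\alpha,t})-\operatorname{tr}(p_{\Delta_\rho^\alpha,t})\right)=-\tfrac12N^2+\tfrac32N.$$
   Context: Mumford curve data. $X$ is the quotient of the ordinary points of a Schottky group $\Gamma\subset\mathrm{PGL}_2(\mathbb{Q}_p)$, free of rank $g=g(X)>0$. A good fundamental domain $F$ for $\Gamma$ (Gerritzen–van der Put) is the complement in the projective line of $2g$ open discs $B_1,\dots,B_g,C_1,\dots,C_g$, whose associated closed discs $B_i^+,C_i^+$ are pairwise disjoint, such that $\Gamma$ has free generators $\gamma_1,\dots,\gamma_g$ with $\gamma_i(\mathbb{P}^1\setminus B_i)=C_i^+$ and $\gamma_i(\mathbb{P}^1\setminus B_i^+)=C_i$. It is taken in $\mathbb{Q}_p$ (the point $\infty$ lies in one of the removed discs); the other removed discs are the inner holes of $F$, which are pairwise disjoint discs $H\subset\mathbb{Q}_p$. Operators. $p$ is a prime, $dx$ the Haar measure on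 $\mathbb{Q}_p$ with $\int_{\mathbb{Z}_p}dx=1$, functions are complex-valued. $\Omega_V=\bigsqcup_{H\in\mathscr{H}}H\subset\mathbb{Q}_p$ and $\Omega_E=\Omega_V\times\Omega_V$. $L^2(\Omega_E)_\sigma=\{h\in L^2(\Omega_E): h(x,y)=-h(y,x)\}$. For $\alpha>0$: $d^\alpha: L^2(\Omega_V)\to L^2(\Omega_E)_\sigma$, $(d^\alpha f)(x,y)=\dfrac{f(x)-f(y)}{2|x-y|_p^\alpha}$; $\delta^\alpha: L^2(\Omega_E)_\sigma\to L^2(\Omega_V)$, $(\delta^\alpha h)(x)=\int_{\Omega_V}h(x,y)|x-y|_p^{-\alpha}dy$; both are possibly unbounded, given by these formulas on locally constant functions and extended by closure. $D^\alpha=\delta^\alpha d^\alpha$ is the closed, non-negative self-adjoint operator on $L^2(\Omega_V)$ determined by its action on locally constant functions. $L^2(\Omega_E)_\rho$ is the finite-dimensional space of $h\in L^2(\Omega_E)_\sigma$ which are constant on $H\times H'$ for all $H,H'\in\mathscr{H}$; $\delta^\alpha_\rho$ is the restriction of $\delta^\alpha$ to it, and $\Delta_\rho^\alpha=d^\alpha\delta_\rho^\alpha$ on $L^2(\Omega_E)_\rho$. $\operatorname{ind}(d^\alpha)=\dim\ker d^\alpha-\dim\ker\delta_\rho^\alpha$. For $A\in\{D^\alpha,\Delta^\alpha_\rho\}$ the heat kernel is $p_{A,t}=\sum_\lambda e^{-\lambda t}f_\lambda(x)\overline{f_\lambda(y)}$ over an orthonormal eigenbasis (eigenvalues with multiplicity),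 with trace $\operatorname{tr}(p_{A,t})=\sum_\lambda e^{-\lambda t}$.
   Formalization: The limit formula is asserted only for α ≥ 1/2; for 0 < α < 1/2 the operator D^α is bounded on an infinite-dimensional space, so its heat trace is +∞ for all t and the printed limit fails. The index formula is kept for all α > 0. *)

(* Defs.v *)
From HB Require Import structures.
From mathcomp Require Import all_boot all_order all_algebra.
From mathcomp Require Import all_classical all_reals all_analysis.
From mathcomp Require Import complex.
Set Implicit Arguments.
Unset Strict Implicit.
Unset Printing Implicit Defensive.
Import Order.TTheory GRing.Theory Num.Theory.
Import numFieldNormedType.Exports.
Local Open Scope classical_set_scope.
Local Open Scope ring_scope.

(* [padicField p R] collects the models of (Q_p, |.|_p): the completions of Q
   for the p-adic absolute value, with absolute value taking values in [R].
   Any two of them are isometrically isomorphic over Q. *)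
Record padicField (p : nat) (R : realType) := PadicField {
  padic_carrier : fieldType;
  padic_abs : padic_carrier -> R;
  padic_abs_eq0 : forall x, padic_abs x = 0 <-> x = 0;
  padic_absM : forall x y, padic_abs (x * y) = padic_abs x * padic_abs y;
  padic_absD : forall x y,
    padic_abs (x + y) <= Num.max (padic_abs x) (padic_abs y);
  padic_abs_nat : forall n : nat, (0 < n)%N ->
    padic_abs n%:R = p%:R ^- logn p n;
  padic_dense : forall x (e : R), 0 < e ->
    exists q : rat, padic_abs (x - ratr q) < e;
  padic_complete : forall u : nat -> padic_carrier,
    (forall e : R, 0 < e -> exists n0 : nat, forall m n : nat,
       (n0 <= m)%N -> (n0 <= n)%N -> padic_abs (u m - u n) < e) ->
    exists l, forall e : R, 0 < e -> exists n0 : nat, forall n : nat,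
       (n0 <= n)%N -> padic_abs (u n - l) < e
}.

Definition Qp p (R : realType) (K : padicField p R) : Type := padic_carrier K.

HB.instance Definition _ p R (K : padicField p R) :=
  GRing.Field.on (Qp K).
HB.instance Definition _ p R (K : padicField p R) :=
  isPointed.Build (Qp K) 0.

Definition absp p (R : realType) (K : padicField p R) (x : Qp K) : R :=
  padic_abs x.

Definition padic_open p R (K : padicField p R) : set (set (Qp K)) :=
  [set U | forall x, U x ->
     exists2 e : R, 0 < e & forall y, absp (x - y) < e -> U y].

(* Q_p carries its Borel sigma-algebra. *)
HB.instance Definition _ p R (K : padicField p R) :=
  @isMeasurable.Build default_measure_display (Qp K) <<s @padic_open p R K >>
    (@sigma_algebra0 _ setT (@padic_open p R K))
    (@sigma_algebraC _ (@padic_open p R K))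
    (@sigma_algebra_bigcup _ setT (@padic_open p R K)).

(* The Haar measure of (Q_p, +) such that Z_p has measure 1. *)
Definition is_haar p (R : realType) (K : padicField p R)
    (mu : set (Qp K) -> \bar R) : Prop :=
  (forall (x : Qp K) (A : set (Qp K)), measurable A ->
     mu [set x + y | y in A] = mu A) /\
  mu [set x | absp x <= 1] = 1%E.

(** * Mumford curves and good fundamental domains *)

Section mumford.
Context (p : nat) (R : realType) (K : padicField p R).

(* The projective line P^1(Q_p); [None] is the point at infinity. *)
Definition P1 : Type := option (Qp K).

Definition mobius (A : 'M[Qp K]_2) (z : P1) : P1 :=
  match z with
  | Some x => if A 1 0 * x + A 1 1 == 0 then None
              else Some ((A 0 0 * x + A 0 1) / (A 1 0 * x + A 1 1))
  | None => if A 1 0 == 0 then None else Some (A 0 0 / A 1 0)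
  end.

(* A disc of P^1 is [|z - a| < r] or [|z - a| > r], the latter containing
   infinity. The radius belongs to the data, because different radii may give
   the same set of Q_p-points but different associated closed discs. *)
Record disc := Disc {
  disc_at_infty : bool;
  disc_centre : Qp K;
  disc_radius : R;
  disc_radius_gt0 : 0 < disc_radius
}.

Definition open_disc (B : disc) : set P1 := [set z : P1 |
  match z with
  | Some x => if disc_at_infty B then disc_radius B < absp (x - disc_centre B)
              else absp (x - disc_centre B) < disc_radius B
  | None => disc_at_infty B
  end].

Definition closed_disc (B : disc) : set P1 := [set z : P1 |
  match z with
  | Some x => if disc_at_infty B then disc_radius B <= absp (x - disc_centre B)
              else absp (x - disc_centre B) <= disc_radius B
  | None => disc_at_infty B
  end].

(* Subgroups of PGL_2(Q_p) are represented by their preimages in GL_2(Q_p),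
   in which the class of the identity is the set of scalar matrices. A letter
   [(i, b)] stands for the [i]-th generator, or its inverse when [b]. *)
Definition word g (gam : 'I_g -> 'M[Qp K]_2) (w : seq ('I_g * bool)) :
    'M[Qp K]_2 :=
  \prod_(l <- w) (if l.2 then invmx (gam l.1) else gam l.1).

Definition reduced g (w : seq ('I_g * bool)) : bool :=
  sorted (fun l m => ~~ ((l.1 == m.1) && (l.2 != m.2))) w.

Definition free_generators g (gam : 'I_g -> 'M[Qp K]_2)
    (Gam : set 'M[Qp K]_2) : Prop :=
  [/\ forall i, gam i \in unitmx,
      forall A, Gam A <-> exists w c, c != 0 /\ A = c *: word gam w &
      forall w, reduced w -> w != [::] -> ~~ is_scalar_mx (word gam w)].

Definition discrete_in_PGL2 (Gam : set 'M[Qp K]_2) : Prop :=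
  exists2 e : R, 0 < e & forall A, Gam A ->
    (forall i j, absp (A i j - (1%:M : 'M[Qp K]_2) i j) < e) ->
    is_scalar_mx A.

(* A Mumford curve is given by the Schottky group uniformising it: its points
   are the orbits of the group on the ordinary points of the projective line.
   Over the locally compact field Q_p the discontinuous subgroups of PGL_2 are
   the discrete ones. *)
Record mumford_curve (g : nat) := MumfordCurve {
  schottky_group : set 'M[Qp K]_2;
  schottky_discrete : discrete_in_PGL2 schottky_group;
  schottky_free : exists gam : 'I_g -> 'M[Qp K]_2,
    free_generators gam schottky_group
}.

Definition two_sides g (B C : 'I_g -> disc) (j : 'I_g + 'I_g) : disc :=
  match j with inl i => B i | inr i => C i end.

Record good_fundamental_domain g (X : mumford_curve g) := GoodDomain {
  fd_gen : 'I_g -> 'M[Qp K]_2;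
  fd_B : 'I_g -> disc;
  fd_C : 'I_g -> disc;
  fd_free : free_generators fd_gen (schottky_group X);
  fd_disjoint : forall j k : 'I_g + 'I_g, j != k ->
    closed_disc (two_sides fd_B fd_C j) `&`
    closed_disc (two_sides fd_B fd_C k) = set0;
  fd_open_closed : forall i,
    mobius (fd_gen i) @` (~` open_disc (fd_B i)) = closed_disc (fd_C i);
  fd_closed_open : forall i,
    mobius (fd_gen i) @` (~` closed_disc (fd_B i)) = open_disc (fd_C i)
}.

Definition fd_set g (X : mumford_curve g) (F : good_fundamental_domain X) :
    set P1 :=
  ~` \bigcup_(j in [set: 'I_g + 'I_g])
       open_disc (two_sides (fd_B F) (fd_C F) j).

Definition inner_holes g (X : mumford_curve g)
    (F : good_fundamental_domain X) : set (set (Qp K)) :=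
  [set H | exists j : 'I_g + 'I_g,
     let B := two_sides (fd_B F) (fd_C F) j in
     ~ open_disc B None /\ H = [set x | open_disc B (Some x)]].

End mumford.

(** * Complex L^2 spaces and unbounded operators *)

(* Elements of L^2(D, mu) are represented by functions, identified when they
   agree almost everywhere on [D]. *)
Section L2.
Context d (T : measurableType d) (R : realType).
Variables (mu : {measure set T -> \bar R}) (D : set T).
Implicit Types f g : T -> R[i].

Definition sqmod (z : R[i]) : R := complex.Re z ^+ 2 + complex.Im z ^+ 2.

Definition L2 : set (T -> R[i]) := [set f |
  [/\ measurable_fun D (fun x => complex.Re (f x)),
      measurable_fun D (fun x => complex.Im (f x)) &
      (\int[mu]_(x in D) (sqmod (f x))%:E < +oo)%E]].

Definition eq_ae f g : Prop := {ae mu, forall x, D x -> f x = g x}.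

Definition L2_cvg (u : nat -> T -> R[i]) f : Prop :=
  (fun n => \int[mu]_(x in D) (sqmod (u n x - f x))%:E)%E @ \oo --> 0%E.

Definition Cintegral f : R[i] :=
  Complex (\int[mu]_(x in D) complex.Re (f x))%R
          (\int[mu]_(x in D) complex.Im (f x))%R.

Definition inner f g : R[i] := Cintegral (fun x => f x * conjc (g x)).

(* [S] has dimension [n] over the complex numbers, modulo a.e. equality. *)
Definition has_dim (S : set (T -> R[i])) (n : nat) : Prop :=
  exists e : 'I_n -> T -> R[i],
  [/\ forall i, S (e i),
      forall c : 'I_n -> R[i],
        eq_ae (fun x => \sum_i c i * e i x) (fun=> 0) -> forall i, c i = 0 &
      forall f, S f ->
        exists c : 'I_n -> R[i], eq_ae f (fun x => \sum_i c i * e i x)].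

(* [f] and [lam] form an orthonormal basis, indexed by [I], of eigenvectors of
   [A] in the Hilbert space [S], with their eigenvalues. Operators are given
   by their graphs. *)
Definition eigenbasis (S : set (T -> R[i]))
    (A : (T -> R[i]) -> (T -> R[i]) -> Prop)
    (I : set nat) (f : nat -> T -> R[i]) (lam : nat -> R) : Prop :=
  [/\ forall i, I i -> S (f i) /\ A (f i) (fun x => (lam i)%:C%C * f i x),
      forall i j, I i -> I j -> inner (f i) (f j) = (i == j)%:R &
      forall h, S h -> (forall i, I i -> inner h (f i) = 0) ->
        eq_ae h (fun=> 0)].

(* [tr t] is the trace of the heat kernel
   sum_i e^(- lam i t) f_i(x) conj(f_i(y)) of [A]; it may be infinite. *)
Definition is_heat_trace (S : set (T -> R[i]))
    (A : (T -> R[i]) -> (T -> R[i]) -> Prop) (tr : R -> \bar R) : Prop :=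
  exists (I : set nat) (e : nat -> T -> R[i]) lam, eigenbasis S A I e lam /\
    forall t, tr t = \esum_(i in I) (expR (- lam i * t))%:E.

End L2.

(* Closure of (the graph of) an operator L^2(D1) -> L^2(D2). *)
Definition op_closure d1 (T1 : measurableType d1) d2 (T2 : measurableType d2)
    (R : realType) (mu1 : {measure set T1 -> \bar R}) (D1 : set T1)
    (mu2 : {measure set T2 -> \bar R}) (D2 : set T2)
    (A : (T1 -> R[i]) -> (T2 -> R[i]) -> Prop)
    (f : T1 -> R[i]) (g : T2 -> R[i]) : Prop :=
  [/\ L2 mu1 D1 f, L2 mu2 D2 g &
      exists (u : nat -> T1 -> R[i]) (w : nat -> T2 -> R[i]),
        [/\ forall n, A (u n) (w n), L2_cvg mu1 D1 u f & L2_cvg mu2 D2 w g]].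

(** * The operators attached to the complete graph on the holes *)

Section operators.
Context (p : nat) (R : realType) (K : padicField p R).
Variables (mu : {sigma_finite_measure set (Qp K) -> \bar R}).
Variables (holes : set (set (Qp K))) (alpha : R).

Let Q := Qp K.
Let mu2 : {measure set (Q * Q) -> \bar R} := (mu \x mu)%E.

Definition OmegaV : set Q := \bigcup_(H in holes) H.
(* The edges, loops included, are all pairs of holes. *)
Definition OmegaE : set (Q * Q) :=
  \bigcup_(HH in holes `*` holes) (HH.1 `*` HH.2).

Definition locally_constantV (f : Q -> R[i]) : Prop :=
  forall x, OmegaV x -> exists2 e : R, 0 < e &
    forall y, OmegaV y -> absp (y - x) < e -> f y = f x.

Definition locally_constantE (h : Q * Q -> R[i]) : Prop :=
  forall z, OmegaE z -> exists2 e : R, 0 < e &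
    forall w, OmegaE w -> absp (w.1 - z.1) < e -> absp (w.2 - z.2) < e ->
      h w = h z.

Definition antisymmetric (h : Q * Q -> R[i]) : Prop :=
  forall x y, OmegaE (x, y) -> h (x, y) = - h (y, x).

Definition d_formula (f : Q -> R[i]) (z : Q * Q) : R[i] :=
  (f z.1 - f z.2) / (2 * (absp (z.1 - z.2) `^ alpha))%:C%C.

Definition delta_formula (h : Q * Q -> R[i]) (x : Q) : R[i] :=
  Cintegral mu OmegaV (fun y => h (x, y) * (absp (x - y) `^ (- alpha))%:C%C).

Definition d_op : (Q -> R[i]) -> (Q * Q -> R[i]) -> Prop :=
  op_closure mu OmegaV mu2 OmegaE
    (fun f h => locally_constantV f /\ h = d_formula f).

Definition delta_op : (Q * Q -> R[i]) -> (Q -> R[i]) -> Prop :=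
  op_closure mu2 OmegaE mu OmegaV
    (fun h f => [/\ locally_constantE h, antisymmetric h &
                    f = delta_formula h]).

Definition D_op : (Q -> R[i]) -> (Q -> R[i]) -> Prop :=
  op_closure mu OmegaV mu OmegaV
    (fun f g => locally_constantV f /\ g = delta_formula (d_formula f)).

Definition L2V : set (Q -> R[i]) := L2 mu OmegaV.

Definition L2sigma : set (Q * Q -> R[i]) := [set h |
  L2 mu2 OmegaE h /\
  eq_ae mu2 OmegaE h (fun z => - h (z.2, z.1))].

Definition L2rho : set (Q * Q -> R[i]) := [set h |
  L2sigma h /\ forall H H', holes H -> holes H' ->
    exists c : R[i], eq_ae mu2 (H `*` H') h (fun=> c)].

Definition delta_rho (h : Q * Q -> R[i]) (f : Q -> R[i]) : Prop :=
  L2rho h /\ delta_op h f.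

Definition Delta_rho (h k : Q * Q -> R[i]) : Prop :=
  exists f, delta_rho h f /\ d_op f k.

(* [n] is the index dim ker d - dim ker delta_rho, both being finite. *)
Definition is_index (n : int) : Prop :=
  exists a b : nat,
  [/\ has_dim mu OmegaV [set f | d_op f (fun=> 0)] a,
      has_dim mu2 OmegaE [set h | delta_rho h (fun=> 0)] b &
      n = a%:Z - b%:Z].

(* For [alpha < 1 / 2] the kernel [absp (x - y) `^ (- 2 * alpha)] is integrable,
   so [D_op] is bounded and its heat trace is identically [+oo]. *)
Definition is_trace_D : (R -> \bar R) -> Prop :=
  is_heat_trace mu OmegaV L2V D_op.

Definition is_trace_Delta_rho : (R -> \bar R) -> Prop :=
  is_heat_trace mu2 OmegaE L2rho Delta_rho.

End operators.

(* Main.v *)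
Require Import Defs.
From mathcomp Require Import all_boot all_order all_algebra.
From mathcomp Require Import all_classical all_reals all_analysis.
From mathcomp Require Import complex measurable_realfun spectral.
From mathcomp Require Import ring lra.
From mathcomp Require finmap.
Set Implicit Arguments.
Unset Strict Implicit.
Unset Printing Implicit Defensive.
Import Order.TTheory GRing.Theory Num.Theory.
Import numFieldNormedType.Exports.
Local Open Scope classical_set_scope.
Local Open Scope ring_scope.

(** The argument replaces the unbounded operators by finite matrices, one for
    each way of cutting the union of the holes into finitely many clopen pieces
    any two of which are at a constant distance. The discs of a given radius
    are such pieces, and so are the holes. On the averages over the pieces the
    operators [d], [delta] and [D] act by explicit finite matrices ([d_weak],
    [delta_weak], [D_weak]); this is clear on locally constant functions and
    survives the closure because convergence in L^2 implies convergence of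
    averages ([L2_cvg_Cint]). The matrix of [D] is the Laplacian of a complete
    graph with positive weights. Conversely a function is zero almost everywhere
    when all its averages over discs vanish ([lball_null]), so that the matrices
    determine everything that is needed.

    Index. A function in the kernel of [d] has the same average on all discs of
    a given radius, hence is constant ([ker_d_dim]). A function in the domain of
    [delta_rho] is an antisymmetric matrix of values [b i j] on the products of
    holes, and [delta] kills it exactly when the matrix of the
    [m i * k i j * m j * b i j], with [m] the masses and [k] the distance
    kernel, has zero row sums. These matrices are the cycles of the complete
    graph on the [N] holes (the loops carry the value zero); the triangles
    through a fixed vertex are a basis, so the dimension is ['C(N - 1, 2)]
    ([ker_delta_rho_dim]), and [1 - 'C(N - 1, 2)] is the announced polynomial.

    Heat traces. If the spectrum is nonnegative, zero is isolated in it and the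
    trace is finite at some time, then the trace tends to the multiplicity of
    the eigenvalue zero ([heat_trace_cvg]). An eigenfunction of [D] with
    eigenvalue zero has averages that are harmonic on a connected graph, hence
    is constant; one of [Delta_rho] satisfies [<Delta h, h> = |delta h|^2], hence
    is killed by [delta]. The two multiplicities are therefore the two terms of
    the index. The trace of [Delta_rho] is a finite sum. For [D] and
    [alpha >= 1 / 2] each refinement of the radius by a factor [p] adds at least
    [1 / 4] to the degrees of the weighted graph ([deg_lb]); an eigenfunction
    with eigenvalue below [n / 4] is thus constant on the discs of the [n]-th
    radius ([weak_eigen_low]), which leaves room for at most [M n] of them, and
    [M n] grows like [p ^ n]. A comparison with a geometric series bounds the
    trace at time [4 * ln (2 * p)].

    Eigenbases exist because the spaces of functions constant on the pieces are
    stable: on each of them the operator is a hermitian matrix, and for [D] the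
    functions at one radius with zero averages at the previous one are stable
    again and exhaust L^2 as the radius shrinks. *)

(** * The p-adic absolute value *)

Section padic_abs.
Context (p : nat) (p_prime : prime p) (R : realType) (K : padicField p R).
Implicit Types x y z : Qp K.
Local Notation "`| x |_p" := (absp x) (format "`| x |_p").

Lemma absp_eq0 x : (`|x|_p == 0) = (x == 0).
Proof. by apply/eqP/eqP => /(padic_abs_eq0 x). Qed.

Lemma absp0 : `|0 : Qp K|_p = 0.
Proof. by apply/eqP; rewrite absp_eq0. Qed.

Lemma abspM x y : `|x * y|_p = `|x|_p * `|y|_p.
Proof. exact: padic_absM. Qed.

Lemma absp_nat n : (0 < n)%N -> `|n%:R : Qp K|_p = p%:R ^- logn p n.
Proof. exact: padic_abs_nat. Qed.

Lemma absp1 : `|1 : Qp K|_p = 1.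
Proof. by have := @absp_nat 1 isT; rewrite logn1 expr0 invr1. Qed.

Lemma prime_gt1R : 1 < p%:R :> R.
Proof. by rewrite ltr1n prime_gt1. Qed.

Lemma prime_gt0R : 0 < p%:R :> R.
Proof. by rewrite ltr0n prime_gt0. Qed.

Lemma absp_p : `|p%:R : Qp K|_p = p%:R^-1.
Proof. by rewrite absp_nat ?prime_gt0// logn_prime// eqxx expr1. Qed.

Lemma abspN x : `|- x|_p = `|x|_p.
Proof.
rewrite -mulN1r abspM; suff -> : `|(-1) : Qp K|_p = 1 by rewrite mul1r.
have : `|(-1) : Qp K|_p ^+ 2 = 1 by rewrite expr2 -abspM mulrNN mulr1 absp1.
move/eqP; rewrite sqrf_eq1 => /orP[/eqP//|/eqP h].
have p1 := prime_gt1 p_prime.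
have := padic_absD (p%:R : Qp K) (- (p.-1)%:R).
have -> : p%:R - (p.-1)%:R = 1 :> Qp K.
  by rewrite -natrB ?leq_pred// -[X in (X - _)%N](prednK (prime_gt0 p_prime)) subSnn.
have -> : padic_abs (1 : Qp K) = 1 by exact: absp1.
have -> : padic_abs (p%:R : Qp K) = p%:R^-1 by exact: absp_p.
have -> : padic_abs (- (p.-1)%:R : Qp K) = - 1.
  rewrite -[LHS]/(absp _) -mulN1r abspM h absp_nat; last by rewrite -ltnS prednK// ltnW.
  rewrite lognE; case: ifPn; last by rewrite expr0 invr1 mulr1.
  move=> /and3P[_ pp /dvdn_leq-/(_ pp)]; rewrite leqNgt => /negP; case.
  by rewrite ltn_predL ltnW.
rewrite le_max => /orP[|]; last by lra.
by rewrite invf_ge1 ?prime_gt0R// leNgt prime_gt1R.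
Qed.

Lemma absp_max x y : `|x + y|_p <= Num.max `|x|_p `|y|_p.
Proof. exact: padic_absD. Qed.

Lemma absp_ge0 x : 0 <= `|x|_p.
Proof.
rewrite leNgt; apply/negP => x0.
by have := absp_max x (- x); rewrite subrr absp0 abspN maxxx leNgt x0.
Qed.

Lemma absp_distC x y : `|x - y|_p = `|y - x|_p.
Proof. by rewrite -abspN opprB. Qed.

Lemma absp_dist_le x y z r :
  `|x - y|_p <= r -> `|y - z|_p <= r -> `|x - z|_p <= r.
Proof.
move=> xy yz; have -> : x - z = (x - y) + (y - z) by rewrite addrA subrK.
by rewrite (le_trans (absp_max _ _))// ge_max xy.
Qed.

Lemma absp_dist_lt x y z r :
  `|x - y|_p < r -> `|y - z|_p < r -> `|x - z|_p < r.
Proof.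
move=> xy yz; have -> : x - z = (x - y) + (y - z) by rewrite addrA subrK.
by rewrite (le_lt_trans (absp_max _ _))// gt_max xy.
Qed.

Lemma absp_isosceles x x' y : `|x - x'|_p < `|x - y|_p -> `|x' - y|_p = `|x - y|_p.
Proof.
move=> h; apply/eqP; rewrite eq_le; apply/andP; split.
  by apply: absp_dist_le (lexx _); rewrite absp_distC ltW.
rewrite leNgt; apply/negP => h'.
by have := absp_dist_lt h h'; rewrite ltxx.
Qed.

Lemma expp_gt0 n : 0 < p%:R ^- n :> R.
Proof. by rewrite invr_gt0 exprn_gt0// prime_gt0R. Qed.

Lemma lepX m n : (p%:R ^- m <= p%:R ^- n :> R) = (n <= m)%N.
Proof.
rewrite lef_pV2 ?posrE ?exprn_gt0 ?prime_gt0R//.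
by rewrite ler_eXn2l ?prime_gt1R.
Qed.

Lemma expp_le1 n : p%:R ^- n <= 1 :> R.
Proof. by have := lepX n 0; rewrite expr0 invr1 leq0n. Qed.

Lemma expp_small (e : R) : 0 < e -> exists n, p%:R ^- n < e.
Proof.
move=> e0; exists (Num.bound e^-1).
rewrite -[ltRHS]invrK ltf_pV2 ?posrE ?invr_gt0 ?exprn_gt0 ?prime_gt0R//.
apply: lt_le_trans (archi_boundP _) _; first by rewrite invr_ge0 ltW.
by rewrite -natrX ler_nat ltnW// ltn_expl// prime_gt1.
Qed.

Lemma absp_int (z : int) : `|z%:~R : Qp K|_p <= 1.
Proof.
have h n : `|n%:R : Qp K|_p <= 1.
  case: n => [|n]; first by rewrite absp0.
  by rewrite absp_nat// expp_le1.
by case: z => n; rewrite ?NegzE ?mulrNz ?abspN -pmulrn h.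
Qed.

Lemma absp_natr n : `|n%:R : Qp K|_p <= 1.
Proof. by have := absp_int n; rewrite -pmulrn. Qed.

Lemma absp_pX n : `|p%:R ^+ n : Qp K|_p = p%:R ^- n.
Proof.
rewrite -exprVn; elim: n => [|n IH]; first by rewrite !expr0 absp1.
by rewrite !exprS abspM IH absp_p.
Qed.

Lemma natr_Qp_neq0 n : (0 < n)%N -> n%:R != 0 :> Qp K.
Proof. by move=> n0; rewrite -absp_eq0 absp_nat// gt_eqF// expp_gt0. Qed.

Lemma absp_natr_eq1 n : ~~ (p %| n)%N -> `|n%:R : Qp K|_p = 1.
Proof.
case: n => [|n]; first by rewrite dvdn0.
by move=> pn; rewrite absp_nat// lognE (negbTE pn) !andbF expr0 invr1.
Qed.

Lemma absp_natr_lt1 n : (p %| n)%N -> `|n%:R : Qp K|_p < 1.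
Proof.
move=> /dvdnP[k ->]; rewrite natrM abspM absp_p.
apply: (@le_lt_trans _ _ (1 * p%:R^-1)).
  by rewrite ler_pM2r ?absp_natr ?invr_gt0 ?prime_gt0R.
by rewrite mul1r invf_lt1 ?prime_gt1R ?prime_gt0R.
Qed.

Lemma absp_intE (z : int) : `|z%:~R : Qp K|_p = `| (absz z)%:R : Qp K|_p.
Proof. by case: z => n; rewrite ?NegzE ?mulrNz ?abspN -pmulrn. Qed.

Lemma absp_int_dvd n (z : int) : ((p ^ n)%:Z %| z)%Z -> `|z%:~R : Qp K|_p <= p%:R ^- n.
Proof.
move=> /dvdzP[k ->]; rewrite rmorphM/= abspM -pmulrn natrX absp_pX.
by rewrite ler_piMl ?absp_int// ltW// expp_gt0.
Qed.

(** Every p-adic integer is approximated by a rational with denominator prime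
    to [p], and that denominator can be inverted modulo [p ^ n]. *)
Lemma padic_residue n x : `|x|_p <= 1 ->
  exists2 k, (k < p ^ n)%N & `|x - k%:R|_p <= p%:R ^- n.
Proof.
move=> x1; have [r xr] := padic_dense x (expp_gt0 n).
have n1 : p%:R ^- n <= 1 :> R by exact: expp_le1.
have r1 : `|ratr r : Qp K|_p <= 1.
  have -> : ratr r = x - (x - ratr r) :> Qp K by rewrite opprB addrC subrK.
  rewrite (le_trans (absp_max _ _))// ge_max x1 abspN.
  by rewrite (le_trans (ltW xr)).
pose d := absz (denq r).
have dE : denq r = d%:Z by rewrite /d gez0_abs.
have d_gt0 : (0 < d)%N by rewrite -ltz_nat -dE denq_gt0.
have rd : ratr r * d%:R = (numq r)%:~R :> Qp K.
  by rewrite /ratr dE -pmulrn divfK// natr_Qp_neq0.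
have pd : ~~ (p %| d)%N.
  apply/negP => pd; have := coprime_num_den r; rewrite dE /= => cop.
  have pn : ~~ (p %| `|numq r|)%N.
    apply/negP => pn; move: cop => /eqP h; have : (p %| 1)%N by rewrite -h dvdn_gcd pn.
    by rewrite Euclid_dvd1.
  have := absp_natr_lt1 pd; have := absp_natr_eq1 pn.
  rewrite -absp_intE -rd abspM => h1 h2.
  by have := le_lt_trans (ler_piMl (absp_ge0 d%:R) r1) h2; rewrite h1 ltxx.
have cop : coprime d (p ^ n) by rewrite coprime_sym coprimeXl// prime_coprime.
have [u v uv _] := egcdnP (p ^ n) d_gt0.
have {uv cop} uv : (u * d = v * p ^ n + 1)%N by rewrite uv (eqP cop).
pose k := (modz (numq r * u) (p ^ n)%N)%Z.
have pn0 : (p ^ n)%:Z != 0 by rewrite -lt0n expn_gt0 prime_gt0.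
have k0 : 0 <= k by rewrite modz_ge0.
exists (absz k).
  by rewrite -ltz_nat gez0_abs// ltz_pmod// ltz_nat expn_gt0 prime_gt0.
apply: (absp_dist_le (ltW xr)).
have -> : `|k|%:R = k%:~R :> Qp K by rewrite -[in RHS](gez0_abs k0) -pmulrn.
rewrite -[leLHS]mulr1 -[X in _ * X](absp_natr_eq1 pd) -abspM mulrBl rd.
rewrite [d%:R]pmulrn -rmorphM/= -rmorphB/=; apply: absp_int_dvd.
have -> : numq r - k * d = (numq r * u - k) * d - numq r * (v * p ^ n)%N.
  have -> : (v * p ^ n)%N%:Z = u%:Z * d%:Z - 1 by rewrite -PoszM uv PoszD addrK.
  ring.
rewrite rpredB//; last by rewrite PoszM mulrA dvdz_mull.
by rewrite dvdz_mulr// -eqz_mod_dvd eq_sym modz_mod.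
Qed.

Lemma padic_residue_inj n k l : (k < p ^ n)%N -> (l < p ^ n)%N ->
  `|k%:R - l%:R : Qp K|_p <= p%:R ^- n -> k = l.
Proof.
wlog kl : k l / (l <= k)%N.
  move=> h kn ln kl; case: (leqP l k) => [lk|/ltnW lk]; first exact: h.
  by apply/esym/h => //; rewrite absp_distC.
move=> kn ln; rewrite -natrB//; move: kl; rewrite leq_eqVlt => /orP[/eqP//|kl].
rewrite absp_nat ?subn_gt0// lepX => h.
have : (p ^ n %| k - l)%N by rewrite pfactor_dvdn// subn_gt0.
move=> /dvdn_leq; rewrite subn_gt0 => /(_ kl) h'.
by have := leq_ltn_trans h' (leq_ltn_trans (leq_subr l k) kn); rewrite ltnn.
Qed.

(** The discs of radius [p ^- n] inside [`|x|_p <= p ^ m] are indexed by the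
    residues modulo [p ^ (m + n)]. *)
Lemma padic_ball_residue m n x : `|x|_p <= p%:R ^+ m ->
  exists2 k, (k < p ^ (m + n))%N & `|x - k%:R / p%:R ^+ m|_p <= p%:R ^- n.
Proof.
move=> xm; have pm : `|p%:R ^+ m : Qp K|_p != 0 by rewrite absp_pX gt_eqF// expp_gt0.
have [|k kn xk] := @padic_residue (m + n) (x * p%:R ^+ m).
  by rewrite abspM absp_pX ler_pdivrMr ?mul1r// exprn_gt0// prime_gt0R.
exists k => //; have pm0 : p%:R ^+ m != 0 :> Qp K by rewrite -absp_eq0.
have -> : x - k%:R / p%:R ^+ m = (x * p%:R ^+ m - k%:R) / p%:R ^+ m.
  by rewrite mulrBl mulfK.
have VE y : y != 0 -> `|y^-1|_p = `|y|_p^-1.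
  move=> y0; apply: (@mulIf _ `|y|_p); first by rewrite absp_eq0.
  by rewrite -abspM !mulVf ?absp1// absp_eq0.
have pm1 : p%:R ^+ m != 0 :> R by rewrite gt_eqF// exprn_gt0// prime_gt0R.
rewrite abspM VE// absp_pX invrK (le_trans (ler_wpM2r _ xk))//.
by rewrite exprD invfM mulrAC mulVf// mul1r.
Qed.

Lemma padic_ball_residue_inj m n k l :
  (k < p ^ (m + n))%N -> (l < p ^ (m + n))%N ->
  `|k%:R / p%:R ^+ m - l%:R / p%:R ^+ m : Qp K|_p <= p%:R ^- n -> k = l.
Proof.
move=> kn ln h; apply: (padic_residue_inj kn ln).
have pm0 : p%:R ^+ m != 0 :> Qp K by rewrite -absp_eq0 absp_pX gt_eqF// expp_gt0.
rewrite -[X in absp X](mulfK pm0) mulrAC abspM mulrBl absp_pX exprD invfM mulrC.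
by rewrite ler_pM2l// expp_gt0.
Qed.

End padic_abs.

(** * Clopen domains and locally constant functions *)

Definition pball p (R : realType) (K : padicField p R) (x : Qp K) (r : R) :
    set (Qp K) := [set y | absp (x - y) <= r].

(** A compact open subset of Q_p. An enumeration of its discs of every radius
    [p ^- (dom_base + n)] is part of the data, so that the averages of a
    function at radius [n] form a vector indexed by ['I_(dom_num n)]. *)
Record clopen_domain p (R : realType) (K : padicField p R) := ClopenDomain {
  dom_set :> Qp K -> Prop;
  dom_base : nat;
  dom_num : nat -> nat;
  dom_ctr : forall n, 'I_(dom_num n) -> Qp K;
  dom_stable : forall x y, dom_set x -> absp (x - y) <= p%:R ^- dom_base ->
    dom_set y;
  dom_ctr_in : forall n i, dom_set (@dom_ctr n i);
  dom_ctr_cover : forall n x, dom_set x ->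
    exists i, absp (x - @dom_ctr n i) <= p%:R ^- (dom_base + n);
  dom_ctr_inj : forall n i j,
    absp (@dom_ctr n i - @dom_ctr n j) <= p%:R ^- (dom_base + n) -> i = j
}.
Arguments dom_ctr {p R K} c n i.
Arguments dom_num {p R K} c n.

(** The centres are the fractions [k / p ^ m] with [k] a residue modulo
    [p ^ (m + n0 + n)] that lie in the set. *)
Lemma clopen_domain_exists p (p_prime : prime p) (R : realType)
    (K : padicField p R) (Om : set (Qp K)) (n0 m : nat) :
  (forall x y, Om x -> absp (x - y) <= p%:R ^- n0 -> Om y) ->
  (forall x, Om x -> absp x <= p%:R ^+ m) ->
  exists D : clopen_domain K, dom_set D = Om.
Proof.
move=> Ost Obd.
pose ct n (k : 'I_(p ^ (m + (n0 + n)))) : Qp K := k%:R / p%:R ^+ m.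
pose S n := [set k | `[< Om (ct n k) >]]%SET.
pose c n (i : 'I_#|S n|) := ct n (enum_val i).
have st n x y : Om x -> absp (x - y) <= p%:R ^- (n0 + n) -> Om y.
  by move=> /Ost h xy; apply: h; rewrite (le_trans xy)// lepX// leq_addr.
unshelve eexists (@ClopenDomain _ _ _ Om n0 (fun n => #|S n|) c _ _ _ _) => //.
- by move=> n i; have := enum_valP i; rewrite inE => /asboolP.
- move=> n x Ox; have [k kn xk] := padic_ball_residue p_prime (n0 + n) (Obd _ Ox).
  have kS : Ordinal kn \in S n by rewrite inE; apply/asboolP; exact: st xk.
  by exists (enum_rank_in kS (Ordinal kn)); rewrite /c enum_rankK_in.
- move=> n i j; rewrite /c /ct => /(padic_ball_residue_inj p_prime) h.
  by apply: enum_val_inj; apply: val_inj; apply: h.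
Qed.

Section clopen_domain.
Context (p : nat) (p_prime : prime p) (R : realType) (K : padicField p R).
Variable Om : clopen_domain K.
Implicit Types x y z : Qp K.

Definition rad n : R := p%:R ^- (dom_base Om + n).

Lemma rad_gt0 n : 0 < rad n.
Proof. exact: expp_gt0. Qed.

Lemma le_rad m n : (n <= m)%N -> rad m <= rad n.
Proof. by move=> nm; rewrite /rad lepX// leq_add2l. Qed.

Lemma radS n : rad n = p%:R * rad n.+1.
Proof.
rewrite /rad addnS exprS invfM mulrA mulfV ?mul1r//.
by rewrite gt_eqF// prime_gt0R.
Qed.

Lemma rad_small (e : R) : 0 < e -> exists n, rad n < e.
Proof.
move=> /(expp_small p_prime)[n ne]; exists n; apply: le_lt_trans ne.
by rewrite /rad lepX// leq_addl.
Qed.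

Lemma dom_stable_rad n x y : Om x -> absp (x - y) <= rad n -> Om y.
Proof.
move=> Ox xy; apply: dom_stable Ox _; rewrite (le_trans xy)//.
by rewrite /rad lepX// leq_addr.
Qed.

Lemma dom_ctr_unique n i j x : absp (x - dom_ctr Om n i) <= rad n ->
  absp (x - dom_ctr Om n j) <= rad n -> i = j.
Proof.
move=> xi xj; apply: (@dom_ctr_inj _ _ _ Om n).
by apply: absp_dist_le xj; rewrite absp_distC.
Qed.

(** Compactness: if a monotone family of conditions on discs holds locally,
    then it holds uniformly. Otherwise a nested sequence of discs on which it
    is not uniform shrinks to a point, by completeness. *)
Lemma dom_compact (P : nat -> Qp K -> Prop) :
  (forall n x, P n x -> P n.+1 x) ->
  (forall n x y, Om x -> P n x -> absp (x - y) <= rad n -> P n y) ->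
  (forall x, Om x -> exists n, P n x) ->
  exists m, forall x, Om x -> P m x.
Proof.
move=> PS Pst Pex; apply: contrapT => /forallNP Pn.
have Pmono n m x : (n <= m)%N -> P n x -> P m x.
  by move=> /subnK <-; elim: (m - n)%N => // k IH /IH /PS.
pose bad n x := Om x /\ forall m, exists y, absp (x - y) <= rad n /\ ~ P m y.
have badS n x : bad n x -> exists x', bad n.+1 x' /\ absp (x - x') <= rad n.
  move=> [Ox xbad]; apply: contrapT => /forallNP xn.
  have h (i : 'I_(dom_num Om n.+1)) : exists m,
      absp (x - dom_ctr Om n.+1 i) <= rad n ->
      forall y, absp (dom_ctr Om n.+1 i - y) <= rad n.+1 -> P m y.
    case: (lerP (absp (x - dom_ctr Om n.+1 i)) (rad n)) => [xi|_]; last by exists 0%N.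
    have /not_andP[nb|//] := xn (dom_ctr Om n.+1 i).
    have /not_andP[] := nb; first by case; exact: dom_ctr_in.
    move=> /existsNP[m /forallNP hm]; exists m => _ y yi.
    by have /not_andP[//|/contrapT] := hm y.
  have [f fP] := choice h.
  have [y [xy Py]] := xbad (\max_i f i).
  have [i yi] := dom_ctr_cover n.+1 (dom_stable_rad Ox xy).
  apply: Py; apply: (Pmono _ _ _ (leq_bigmax i)); apply: fP.
    by apply: absp_dist_le xy _; rewrite (le_trans yi)// le_rad.
  by rewrite absp_distC.
have [x0 bad0] : exists x, bad 0 x.
  apply: contrapT => /forallNP nb.
  have h (i : 'I_(dom_num Om 0)) : exists m,
      forall y, absp (dom_ctr Om 0 i - y) <= rad 0 -> P m y.
    have /not_andP[] := nb (dom_ctr Om 0 i); first by case; exact: dom_ctr_in.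
    move=> /existsNP[m /forallNP hm]; exists m => y yi.
    by have /not_andP[//|/contrapT] := hm y.
  have [f fP] := choice h.
  apply: (Pn (\max_i f i)) => y Oy; have [i yi] := dom_ctr_cover 0 Oy.
  by apply: (Pmono _ _ _ (leq_bigmax i)); apply: fP; rewrite absp_distC.
have /choice[F FP] : forall nx : nat * Qp K, exists x', bad nx.1 nx.2 ->
    bad nx.1.+1 x' /\ absp (nx.2 - x') <= rad nx.1.
  move=> [n x]; have [/badS[x' ?]|nb] := pselect (bad n x); first by exists x'.
  by exists x.
pose u := fix u n := if n is k.+1 then F (k, u k) else x0.
have ubad n : bad n (u n) by elim: n => //= n IH; case: (FP (n, u n) IH).
have uS n : absp (u n - u n.+1) <= rad n by case: (FP (n, u n) (ubad n)).
have ule n m : (n <= m)%N -> absp (u n - u m) <= rad n.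
  move=> /subnK <-; elim: (m - n)%N => [|k IH]; first by rewrite subrr absp0 ltW ?rad_gt0.
  by apply: absp_dist_le IH _; rewrite (le_trans (uS _))// le_rad// leq_addl.
have [|l lP] := @padic_complete _ _ K u.
  move=> e e0; have [n ne] := rad_small e0; exists n => i j ni nj.
  apply: le_lt_trans ne; apply: (@absp_dist_le _ _ _ _ (u n)); last exact: ule.
  by rewrite absp_distC//; exact: ule.
have ul n : absp (u n - l) <= rad n.
  have [m mP] := lP _ (rad_gt0 n).
  apply: (@absp_dist_le _ _ _ _ (u (maxn n m))).
    by apply: ule; rewrite leq_maxl.
  by apply: ltW; apply: mP; rewrite leq_maxr.
have Ol : Om l := dom_stable_rad (proj1 (ubad 0)) (ul 0).
have [n Pnl] := Pex l Ol.
have [y [xy]] := proj2 (ubad n) n; apply.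
apply: Pst Ol Pnl _; apply: absp_dist_le xy => //.
by rewrite absp_distC.
Qed.

Definition lvl_const T n (f : Qp K -> T) := forall x y, Om x ->
  absp (x - y) <= rad n -> f x = f y.

Definition lvl_const2 T n (h : Qp K * Qp K -> T) := forall x x' y y',
  Om x -> Om y -> absp (x - x') <= rad n -> absp (y - y') <= rad n ->
  h (x, y) = h (x', y').

Lemma lvl_const_mono T m n (f : Qp K -> T) : (m <= n)%N ->
  lvl_const m f -> lvl_const n f.
Proof.
by move=> mn fm x y Ox xy; apply: fm => //; rewrite (le_trans xy)// le_rad.
Qed.

Lemma lvl_const2_mono T m n (f : _ -> T) : (m <= n)%N ->
  lvl_const2 m f -> lvl_const2 n f.
Proof.
move=> mn fm x x' y y' Ox Oy xx yy; apply: fm => //.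
  by rewrite (le_trans xx)// le_rad.
by rewrite (le_trans yy)// le_rad.
Qed.

(** By compactness a locally constant function is constant on all discs of
    some radius. *)
Lemma locally_const_lvl T (f : Qp K -> T) :
  (forall x, Om x -> exists2 e : R, 0 < e & forall y, Om y -> absp (y - x) < e ->
     f y = f x) -> exists n, lvl_const n f.
Proof.
move=> fl; pose P n x := forall y, absp (x - y) <= rad n -> f x = f y.
have [||x Ox|m mP] := @dom_compact P; last first.
- by exists m => x y Ox; exact: mP.
- have [e e0 fe] := fl x Ox; have [n ne] := rad_small e0; exists n => y xy.
  apply/esym/fe; first exact: dom_stable_rad xy.
  by rewrite absp_distC// (le_lt_trans xy).
- move=> n x y Ox Pnx xy z yz; rewrite -(Pnx y xy); apply: Pnx.
  exact: absp_dist_le xy yz.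
- by move=> n x Pnx y xy; apply: Pnx; rewrite (le_trans xy)// le_rad.
Qed.

Lemma locally_const_lvl2 T (h : Qp K * Qp K -> T) :
  (forall z : _ * _, Om z.1 -> Om z.2 -> exists2 e : R, 0 < e &
     forall w : _ * _, Om w.1 -> Om w.2 -> absp (w.1 - z.1) < e ->
     absp (w.2 - z.2) < e -> h w = h z) -> exists n, lvl_const2 n h.
Proof.
move=> hl; pose P n x y := forall x' y', absp (x - x') <= rad n ->
  absp (y - y') <= rad n -> h (x, y) = h (x', y').
have PS n x y : P n x y -> P n.+1 x y.
  move=> Pn x' y' xx yy; apply: Pn; [rewrite (le_trans xx)//|rewrite (le_trans yy)//];
  exact: le_rad.
have Pst n x x' y y' : P n x y -> absp (x - x') <= rad n ->
    absp (y - y') <= rad n -> P n x' y'.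
  move=> Pn xx yy x'' y'' xx' yy'; rewrite -(Pn x' y')//; apply: Pn.
    exact: absp_dist_le xx xx'.
  exact: absp_dist_le yy yy'.
have xx0 n x : absp (x - x) <= rad n by rewrite subrr absp0 ltW// rad_gt0.
have Puni x : Om x -> exists n, forall y, Om y -> P n x y.
  move=> Ox; apply: (@dom_compact (fun n y => P n x y)) => [n y|n y y'|y Oy].
  - exact: PS.
  - by move=> _ Pn yy; apply: (Pst _ _ _ _ _ Pn).
  - have [e e0 he] := hl (x, y) Ox Oy; have [n ne] := rad_small e0.
    exists n => x' y' xx yy; apply/esym/he => /=.
    + exact: dom_stable_rad Ox xx.
    + exact: dom_stable_rad Oy yy.
    + by rewrite absp_distC// (le_lt_trans xx).
    + by rewrite absp_distC// (le_lt_trans yy).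
have [n x Pn y Oy|n x x' Ox Pn xx y Oy|x Ox|m mP] :=
    @dom_compact (fun n x => forall y, Om y -> P n x y).
- by apply: PS; exact: Pn.
- by apply: (Pst _ _ _ _ _ (Pn y Oy)).
- exact: Puni.
- by exists m => x x' y y' Ox Oy; exact: mP.
Qed.

End clopen_domain.
(** * Square-integrable complex functions on a set of finite measure *)

(** The real ([true]) or imaginary ([false]) part: integrals of complex
    functions are computed part by part. *)
Definition part (R : realType) (b : bool) (z : R[i]) : R :=
  if b then complex.Re z else complex.Im z.

Section part.
Context (R : realType).
Implicit Types (z w : R[i]) (r : R) (b : bool).

Lemma part_eq z w : (forall b, part b z = part b w) -> z = w.
Proof.
by move=> h; apply/eqP; rewrite eq_complex; have := h true; have := h false; rewrite /part => -> ->; rewrite !eqxx.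
Qed.

Lemma partD b z w : part b (z + w) = part b z + part b w.
Proof. by case: b; case: z => ? ?; case: w. Qed.

Lemma partN b z : part b (- z) = - part b z.
Proof. by case: b; case: z. Qed.

Lemma partB b z w : part b (z - w) = part b z - part b w.
Proof. by rewrite partD partN. Qed.

Lemma part0 b : part b 0 = 0 :> R.
Proof. by case: b. Qed.

Lemma partZ b r z : part b (r%:C%C * z) = r * part b z.
Proof. by case: b; case: z => x y /=; rewrite mul0r ?subr0 ?addr0. Qed.

Lemma part_sum b (I : Type) (s : seq I) (P : pred I) (F : I -> R[i]) :
  part b (\sum_(i <- s | P i) F i) = \sum_(i <- s | P i) part b (F i).
Proof.
by elim/big_rec2: _ => [|i x y _ <-]; rewrite ?part0// partD.
Qed.

Lemma part_conj b z : part b (conjc z) = (if b then 1 else - 1) * part b z.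
Proof. by case: b; case: z => x y /=; rewrite ?mul1r ?mulN1r. Qed.

Lemma conjcZ r z : conjc (r%:C%C * z) = r%:C%C * conjc z.
Proof. by apply: part_eq => b; rewrite !(part_conj, partZ) mulrCA. Qed.

Lemma partM b z w : part b (z * w) =
  part true z * part b w + (if b then -1 else 1) * (part false z * part (~~ b) w).
Proof. by case: b; case: z => x y; case: w => x' y' /=; ring. Qed.

Lemma sqmodE z : sqmod z = part true z ^+ 2 + part false z ^+ 2.
Proof. by []. Qed.

Lemma sqmod_ge0 z : 0 <= sqmod z.
Proof. by rewrite addr_ge0// sqr_ge0. Qed.

Lemma part_sq_le b z : part b z ^+ 2 <= sqmod z.
Proof. by case: b; rewrite sqmodE ?lerDl ?lerDr sqr_ge0. Qed.

End part.

(** The inequality between arithmetic and geometric means, used to bound a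
    function by a constant and a multiple of its square. *)
Lemma le_add_sqr_div (R : realType) (k a : R) : 0 < k -> 0 <= a ->
  a <= k + k^-1 * a ^+ 2.
Proof.
move=> k0 a0; have -> : k + k^-1 * a ^+ 2 = a + k^-1 * ((a - k) ^+ 2 + a * k).
  by field; rewrite gt_eqF.
by rewrite lerDl mulr_ge0 ?invr_ge0 ?(ltW k0)// addr_ge0 ?sqr_ge0// mulr_ge0// ltW.
Qed.

Section L2_finite.
Context d (T : measurableType d) (R : realType).
Variables (mu : {measure set T -> \bar R}) (D : set T).
Hypotheses (mD : measurable D) (fD : (mu D < +oo)%E).
Implicit Types (f g h : T -> R[i]) (u v : T -> R).

Local Notation intble A u := (mu.-integrable A (EFin \o u)).

Lemma intbleD A u v : measurable A -> intble A u -> intble A v ->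
  intble A (fun x => u x + v x).
Proof. by move=> mA iu iv; exact: (integrableD mA iu iv). Qed.

Lemma intbleZ A r u : measurable A -> intble A u -> intble A (fun x => r * u x).
Proof. by move=> mA iu; exact: (integrableZl mA r iu). Qed.

Lemma intble_mul u v : measurable_fun D u -> measurable_fun D v ->
  intble D (fun x => u x ^+ 2) -> intble D (fun x => v x ^+ 2) ->
  intble D (fun x => u x * v x).
Proof.
move=> mu' mv iu iv.
apply: (@le_integrable _ _ _ mu D mD _ (EFin \o (fun x => u x ^+ 2 + v x ^+ 2))).
- by apply/measurable_EFinP; exact: measurable_funM.
- move=> x _; rewrite /= lee_fin [leRHS]ger0_norm ?addr_ge0 ?sqr_ge0//.
  rewrite normrM -[u x ^+ 2]real_normK ?num_real// -[v x ^+ 2]real_normK ?num_real//.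
  have := sqr_ge0 (`|u x| - `|v x|).
  by have := sqr_ge0 `|u x|; have := sqr_ge0 `|v x|; nra.
- exact: intbleD.
Qed.

Lemma intble_cst r : intble D (fun=> r).
Proof.
apply: measurable_bounded_integrable => //; exact: bounded_cst.
Qed.

Lemma L2_part f b : L2 mu D f -> measurable_fun D (fun x => part b (f x)).
Proof. by case: b => -[]. Qed.

Lemma L2_sq f b : L2 mu D f -> intble D (fun x => part b (f x) ^+ 2).
Proof.
move=> Lf; have [_ _ h] := Lf; apply/integrableP; split.
  by apply/measurable_EFinP; apply: measurable_funX; exact: L2_part.
apply: le_lt_trans h; apply: ge0_le_integral => //.
- by do 2 apply: measurableT_comp => //; apply: measurable_funX; exact: L2_part.
- apply/measurable_EFinP; apply: measurable_funD; apply: measurable_funX.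
    exact: (L2_part true).
  exact: (L2_part false).
- by move=> x _; rewrite /= lee_fin ger0_norm ?sqr_ge0// part_sq_le.
Qed.

Lemma L2P f : (forall b, measurable_fun D (fun x => part b (f x))) ->
  (forall b, intble D (fun x => part b (f x) ^+ 2)) -> L2 mu D f.
Proof.
move=> mf sf; split; [exact: (mf true)|exact: (mf false)|].
have := integrableD mD (sf true) (sf false).
move=> /integrableP[_]; apply: le_lt_trans; apply: ge0_le_integral => //.
- by move=> x _; rewrite lee_fin sqmod_ge0.
- apply/measurable_EFinP; apply: measurable_funD; apply: measurable_funX.
    exact: (mf true).
  exact: (mf false).
- apply: measurableT_comp => //; apply: emeasurable_funD;
  apply/measurable_EFinP; apply: measurable_funX; exact: mf.
- by move=> x Dx; rewrite /= ger0_norm ?addr_ge0 ?sqr_ge0.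
Qed.

Lemma L2_intble f b : L2 mu D f -> intble D (fun x => part b (f x)).
Proof.
move=> Lf; rewrite (_ : (fun x => _) = fun x => part b (f x) * 1); last first.
  by apply/funext => x; rewrite mulr1.
apply: intble_mul => //; [exact: L2_part|exact: L2_sq|exact: intble_cst].
Qed.

Lemma L2_mul_intble f g b b' : L2 mu D f -> L2 mu D g ->
  intble D (fun x => part b (f x) * part b' (g x)).
Proof.
by move=> Lf Lg; apply: intble_mul; [exact: L2_part|exact: L2_part|exact: L2_sq|exact: L2_sq].
Qed.

Lemma L2_sqmod f : L2 mu D f -> intble D (fun x => sqmod (f x)).
Proof.
by move=> Lf; apply: intbleD => //; [exact: (L2_sq true)|exact: (L2_sq false)].
Qed.

Lemma L2D f g : L2 mu D f -> L2 mu D g -> L2 mu D (fun x => f x + g x).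
Proof.
move=> Lf Lg; apply: L2P => b.
  under eq_fun do rewrite partD.
  by apply: measurable_funD; exact: L2_part.
under eq_fun do rewrite partD sqrrD.
apply: intbleD => //; last exact: L2_sq.
apply: intbleD => //; first exact: L2_sq.
under eq_fun do rewrite -mulr_natl.
by apply: intbleZ => //; exact: L2_mul_intble.
Qed.

Lemma L2Z (c : R[i]) f : L2 mu D f -> L2 mu D (fun x => c * f x).
Proof.
move=> Lf; apply: L2P => b.
  under eq_fun do rewrite partM.
  apply: measurable_funD; do ?apply: measurable_funM => //; exact: L2_part.
under eq_fun do rewrite partM sqrrD.
have i1 b' r : intble D (fun x => (r * part b' (f x)) ^+ 2).
  by under eq_fun do rewrite exprMn; apply: intbleZ => //; exact: L2_sq.
apply: intbleD => //; last by under eq_fun do rewrite mulrA; exact: i1.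
apply: intbleD => //.
under eq_fun do rewrite -mulr_natl.
apply: intbleZ => //.
rewrite (_ : (fun x => _) = fun x => part true c * (if b then -1 else 1) *
    part false c * (part b (f x) * part (~~ b) (f x))); last first.
  by apply/funext => x; ring.
by apply: intbleZ => //; exact: L2_mul_intble.
Qed.

Lemma L2_cst (c : R[i]) : L2 mu D (fun=> c).
Proof. by apply: L2P => b; [exact: measurable_cst|exact: intble_cst]. Qed.

Lemma L2B f g : L2 mu D f -> L2 mu D g -> L2 mu D (fun x => f x - g x).
Proof.
move=> Lf /(L2Z (-1)) Lg; have := L2D Lf Lg.
by under eq_fun do rewrite mulN1r.
Qed.

Lemma L2_sum (I : Type) (s : seq I) (c : I -> R[i]) (e : I -> T -> R[i]) :
  (forall i, L2 mu D (e i)) -> L2 mu D (fun x => \sum_(i <- s) c i * e i x).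
Proof.
move=> Le; elim: s => [|i s IH].
  by under eq_fun do rewrite big_nil; exact: L2_cst.
by under eq_fun do rewrite big_cons; apply: L2D => //; exact: L2Z.
Qed.

Lemma L2_bounded f M : (forall b, measurable_fun D (fun x => part b (f x))) ->
  (forall x b, D x -> `|part b (f x)| <= M) -> L2 mu D f.
Proof.
move=> mf bf; apply: L2P => // b; apply: measurable_bounded_integrable => //.
  exact: measurable_funX.
exists (M ^+ 2); split; first exact: num_real.
move=> N MN x Dx /=; apply: le_trans (ltW MN).
by rewrite normrX lerXn2r ?nnegrE ?normr_ge0//; [exact: le_trans (bf x b Dx)|exact: bf].
Qed.

Lemma L2_eqD f g : L2 mu D f -> {in D, f =1 g} -> L2 mu D g.
Proof.
move=> [a b c] fg; split.
- by apply: eq_measurable_fun a => x xD; rewrite fg.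
- by apply: eq_measurable_fun b => x xD; rewrite fg.
- by under eq_integral do rewrite -fg//.
Qed.

(** [Cintegral] as a linear functional *)

Lemma part_Cint A f b :
  part b (Cintegral mu A f) = \int[mu]_(x in A) part b (f x).
Proof. by case: b. Qed.

Lemma eq_Cint A f g : {in A, f =1 g} -> Cintegral mu A f = Cintegral mu A g.
Proof.
by move=> fg; apply: part_eq => b; rewrite !part_Cint; apply: eq_Rintegral => x xA; rewrite fg.
Qed.

Definition Cintble A f := forall b, intble A (fun x => part b (f x)).

Lemma L2_Cintble A f : measurable A -> A `<=` D -> L2 mu D f -> Cintble A f.
Proof.
by move=> mA AD Lf b; apply: (integrableS mD mA AD); exact: L2_intble.
Qed.

Lemma CintbleD A f g : measurable A -> Cintble A f -> Cintble A g ->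
  Cintble A (fun x => f x + g x).
Proof.
by move=> mA fi gi b; under eq_fun do rewrite partD; exact: intbleD.
Qed.

Lemma CintbleZ A c f : measurable A -> Cintble A f -> Cintble A (fun x => c * f x).
Proof.
move=> mA fi b; under eq_fun do rewrite partM mulrA.
by apply: intbleD => //; apply: intbleZ.
Qed.

Lemma CintD A f g : measurable A -> Cintble A f -> Cintble A g ->
  Cintegral mu A (fun x => f x + g x) = Cintegral mu A f + Cintegral mu A g.
Proof.
move=> mA fi gi; apply: part_eq => b; rewrite partD !part_Cint.
by under eq_Rintegral do rewrite partD; exact: RintegralD.
Qed.

Lemma CintZ A c f : measurable A -> Cintble A f ->
  Cintegral mu A (fun x => c * f x) = c * Cintegral mu A f.
Proof.
move=> mA fi; apply: part_eq => b; rewrite partM !part_Cint.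
under eq_Rintegral do rewrite partM mulrA.
by rewrite RintegralD// ?RintegralZl// ?mulrA//; apply: intbleZ.
Qed.

Lemma Cint0 A : Cintegral mu A (fun=> 0) = 0.
Proof.
apply: part_eq => b; rewrite part_Cint part0 /Rintegral.
by rewrite integral0.
Qed.

Lemma CintB A f g : measurable A -> Cintble A f -> Cintble A g ->
  Cintegral mu A (fun x => f x - g x) = Cintegral mu A f - Cintegral mu A g.
Proof.
move=> mA fi gi; under [in LHS]eq_Cint => x _ do rewrite -mulN1r.
by rewrite CintD ?CintZ ?mulN1r//; exact: CintbleZ.
Qed.

Lemma Cint_sum A (I : Type) (s : seq I) (c : I -> R[i]) (e : I -> T -> R[i]) :
  measurable A -> (forall i, Cintble A (e i)) ->
  Cintegral mu A (fun x => \sum_(i <- s) c i * e i x) =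
  \sum_(i <- s) c i * Cintegral mu A (e i).
Proof.
move=> mA ei; have : Cintble A (fun x => \sum_(i <- s) c i * e i x) /\
    Cintegral mu A (fun x => \sum_(i <- s) c i * e i x) =
    \sum_(i <- s) c i * Cintegral mu A (e i); last by case.
elim: s => [|i s [IH1 IH2]].
  rewrite big_nil; under eq_fun do rewrite big_nil; split; last exact: Cint0.
  by move=> b; under eq_fun do rewrite part0; exact: integrable0.
rewrite big_cons; under eq_fun do rewrite big_cons.
split; first by apply: CintbleD => //; exact: CintbleZ.
by rewrite CintD// ?CintZ ?IH2//; exact: CintbleZ.
Qed.

Lemma Cint_cst A (c : R[i]) : measurable A ->
  Cintegral mu A (fun=> c) = c * (fine (mu A))%:C%C.
Proof.
move=> mA; apply: part_eq => b; rewrite mulrC partZ part_Cint.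
by rewrite Rintegral_cst// mulrC.
Qed.

Lemma Cint_ae A f g : measurable A -> A `<=` D -> L2 mu D f -> L2 mu D g ->
  eq_ae mu D f g -> Cintegral mu A f = Cintegral mu A g.
Proof.
move=> mA AD Lf Lg fg; apply: part_eq => b; rewrite !part_Cint; congr fine.
apply: ae_eq_integral => //.
- by apply/measurable_EFinP; apply: measurable_funS (L2_part b Lf).
- by apply/measurable_EFinP; apply: measurable_funS (L2_part b Lg).
- by apply: filterS fg => x h Ax /=; rewrite h//; exact: AD.
Qed.

(** Convergence in L^2 implies convergence of the averages: by the
    inequality [|w| <= e + e^-1 * w ^ 2]. *)
Lemma L2_cvg_Cint A (u : nat -> T -> R[i]) f b : measurable A -> A `<=` D ->
  (forall n, L2 mu D (u n)) -> L2 mu D f -> L2_cvg mu D u f ->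
  part b (Cintegral mu A (u n)) @[n --> \oo] --> part b (Cintegral mu A f).
Proof.
move=> mA AD Lu Lf uf; apply/cvgrPdist_le => e e0.
have mD0 : 0 <= fine (mu D) by rewrite fine_ge0.
pose k := e / 2 / (fine (mu D) + 1).
have k0 : 0 < k by rewrite !divr_gt0// ltr_wpDl.
have kD : k * fine (mu D) <= e / 2.
  rewrite /k mulrAC ler_pdivrMr ?ltr_wpDl// ler_wpM2l ?lerDl//.
  by rewrite ltW// divr_gt0.
move/fine_cvgP : uf => [ufin /cvgrPdist_lt/(_ (k * (e / 2)))].
rewrite !mulr_gt0//= ?divr_gt0// => /(_ isT) ucv.
near=> n.
have un : (\int[mu]_(x in D) (sqmod (u n x - f x))%:E)%E \is a fin_num by near: n.
have uke : fine (\int[mu]_(x in D) (sqmod (u n x - f x))%:E)%E < k * (e / 2).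
  apply: le_lt_trans (ler_norm _) _; rewrite -normrN -sub0r; near: n.
  exact: ucv.
rewrite distrC -partB -CintB//; try exact: L2_Cintble.
have Lw := L2B (Lu n) Lf; pose w x := part b (u n x - f x).
have iw : intble D w by exact: L2_intble.
rewrite part_Cint -/w; apply: le_trans (le_normr_Rintegral _ _) _ => //.
  exact: integrableS iw.
have i1 : intble D (fun x => k + k^-1 * sqmod (u n x - f x)).
  apply: intbleD => //; first exact: intble_cst.
  by apply: intbleZ => //; exact: L2_sqmod Lw.
apply: (@le_trans _ _ (\int[mu]_(x in D) (k + k^-1 * sqmod (u n x - f x)))).
  have iw' : intble D (fun x => `|w x|) by exact: integrable_norm.
  apply: (@le_trans _ _ (\int[mu]_(x in D) `|w x|)).
    rewrite /Rintegral fine_le//.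
    - by apply: integrable_fin_num => //; exact: integrableS iw'.
    - exact: integrable_fin_num.
    - by apply: ge0_subset_integral => //; exact: measurable_int iw'.
  apply: le_Rintegral => // x _.
  apply: (@le_trans _ _ (k + k^-1 * w x ^+ 2)); last first.
    by rewrite lerD2l ler_pM2l ?invr_gt0// part_sq_le.
  have -> : w x ^+ 2 = `|w x| ^+ 2 by rewrite real_normK ?num_real.
  exact: le_add_sqr_div.
rewrite RintegralD//; [|exact: intble_cst|]; last first.
  by apply: intbleZ => //; exact: L2_sqmod Lw.
rewrite Rintegral_cst// RintegralZl//; last first.
  exact: L2_sqmod Lw.
rewrite (splitr e) lerD// ler_pdivrMl//; exact: ltW.
Unshelve. all: by end_near.
Qed.

End L2_finite.

Section inner_product.
Context d (T : measurableType d) (R : realType).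
Variables (mu : {measure set T -> \bar R}) (D : set T).
Hypotheses (mD : measurable D) (fD : (mu D < +oo)%E).
Implicit Types (f g h : T -> R[i]).

Lemma inner_Cintble f g : L2 mu D f -> L2 mu D g ->
  Cintble mu D (fun x => f x * conjc (g x)).
Proof.
move=> Lf Lg b; under eq_fun do rewrite partM !part_conj.
have h r s b1 b2 : mu.-integrable D
    (EFin \o (fun x => r * (part b1 (f x) * (s * part b2 (g x))))).
  rewrite (_ : (fun x => _) = fun x => r * s * (part b1 (f x) * part b2 (g x))).
    by apply: intbleZ => //; exact: L2_mul_intble.
  by apply/funext => x; ring.
apply: (intbleD mD); last first.
  exact: (h (if b then -1 else 1) (if ~~ b then 1 else -1) false (~~ b)).
rewrite (_ : (fun x => _) = fun x => 1 * (part true (f x) *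
  ((if b then 1 else -1) * part b (g x)))); first exact: h.
by apply/funext => x; rewrite mul1r.
Qed.

Lemma inner_suml (I : Type) (s : seq I) (c : I -> R[i]) (e : I -> T -> R[i]) g :
  (forall i, L2 mu D (e i)) -> L2 mu D g ->
  inner mu D (fun x => \sum_(i <- s) c i * e i x) g =
  \sum_(i <- s) c i * inner mu D (e i) g.
Proof.
move=> Le Lg; rewrite -Cint_sum//; last by move=> i; exact: inner_Cintble.
apply: eq_Cint => x _; rewrite big_distrl/=.
by apply: eq_bigr => i _; rewrite mulrA.
Qed.

Lemma inner_conj f g : L2 mu D f -> L2 mu D g ->
  inner mu D g f = conjc (inner mu D f g).
Proof.
move=> Lf Lg; apply: part_eq => b.
rewrite part_conj !part_Cint -RintegralZl//; last exact: inner_Cintble.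
apply: eq_Rintegral => x _; rewrite -part_conj rmorphM/= conjcK mulrC.
by [].
Qed.

Lemma inner_ae f f' g : L2 mu D f -> L2 mu D f' -> L2 mu D g ->
  eq_ae mu D f f' -> inner mu D f g = inner mu D f' g.
Proof.
move=> Lf Lf' Lg ff; apply: part_eq => b; rewrite !part_Cint; congr fine.
apply: ae_eq_integral => //.
- exact: measurable_int (inner_Cintble Lf Lg b).
- exact: measurable_int (inner_Cintble Lf' Lg b).
- by apply: filterS ff => x h Dx /=; rewrite h.
Qed.

Lemma inner0l g : inner mu D (fun=> 0) g = 0.
Proof. by rewrite -[RHS](@Cint0 _ _ _ mu D); apply: eq_Cint => x _; rewrite mul0r. Qed.

Lemma eq_ae_refl f : eq_ae mu D f f.
Proof. exact: aeW. Qed.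

Lemma eq_ae_trans f g h : eq_ae mu D f g -> eq_ae mu D g h -> eq_ae mu D f h.
Proof. by apply: filterS2 => x a b Dx; rewrite a// b. Qed.

(** ** Orthonormal systems in a finite-dimensional space *)

Section finite_dim.
Variables (S : set (T -> R[i])) (n : nat).
Hypotheses (Sdim : has_dim mu D S n) (SL2 : forall h, S h -> L2 mu D h).
Hypothesis Ssum : forall m (c : 'I_m -> R[i]) (e : 'I_m -> T -> R[i]),
  (forall i, S (e i)) -> S (fun x => \sum_i c i * e i x).

(** The matrix of inner products of the [f j] with a basis has a left inverse,
    which bounds [m]. If [m < n] then a nonzero combination of the basis is
    orthogonal to the [f j], against totality. *)
Lemma orthonormal_dim m (f : 'I_m -> T -> R[i]) : (forall i, S (f i)) ->
  (forall i j, inner mu D (f i) (f j) = (i == j)%:R) ->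
  (m <= n)%N /\
  ((forall h, S h -> (forall i, inner mu D h (f i) = 0) -> eq_ae mu D h (fun=> 0)) ->
   m = n).
Proof.
have [e [Se eind egen]] := Sdim; move=> Sf fon.
pose G := \matrix_(k < n, j < m) inner mu D (e k) (f j).
have [y yP] := choice (fun i => egen (f i) (Sf i)).
pose Y := \matrix_(i < m, k < n) y i k.
have YG : Y *m G = 1%:M.
  apply/matrixP => i j; rewrite !mxE -fon.
  rewrite (inner_ae _ _ _ (yP i)) ?inner_suml//; try exact: SL2.
  - by apply: eq_bigr => k _; rewrite !mxE.
  - by move=> k; exact: SL2.
  - by apply: SL2; exact: Ssum.
have mn : (m <= n)%N by exact: mulmx1_min YG.
split=> // ftot; apply/eqP; rewrite eqn_leq mn/=.
suff : row_free G by rewrite /row_free => /eqP <-; exact: rank_leq_col.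
rewrite -kermx_eq0; apply/eqP/row_matrixP => i; rewrite row0.
move: (kermx G) (mulmx_ker G) => W WG; apply/rowP => k; rewrite !mxE.
apply: (eind (fun k => W i k)); apply: ftot; first exact: Ssum.
move=> j; rewrite inner_suml//; try (by move=> ?; exact: SL2); last exact: SL2.
by have /matrixP/(_ i j) := WG; rewrite mxE [RHS]mxE => h; apply: etrans h; apply: eq_bigr => l _; rewrite /G mxE.
Qed.

Lemma orthonormal_finite (I : set nat) (f : nat -> T -> R[i]) :
  (forall i, I i -> S (f i)) ->
  (forall i j, I i -> I j -> inner mu D (f i) (f j) = (i == j)%:R) ->
  finite_set I.
Proof.
move=> Sf fon; apply: contrapT => /infiniteP.
move=> /pcard_leP/unsquash g.
have [| |] := @orthonormal_dim n.+1 (fun i => f (g (i : nat))); last by rewrite ltnn.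
- by move=> i; apply: Sf; exact: funS.
- move=> i j; rewrite fon; try exact: funS.
  by congr (_ %:R); congr nat_of_bool; apply/eqP/eqP => [/inj h|->//]; apply: val_inj; apply: h; rewrite inE.
Qed.

Lemma orthonormal_card (I : set nat) (f : nat -> T -> R[i]) :
  (forall i, I i -> S (f i)) ->
  (forall i j, I i -> I j -> inner mu D (f i) (f j) = (i == j)%:R) ->
  (forall h, S h -> (forall i, I i -> inner mu D h (f i) = 0) ->
     eq_ae mu D h (fun=> 0)) ->
  (I #= `I_n)%card.
Proof.
move=> Sf fon ftot; have /finite_setP[m Im] := orthonormal_finite Sf fon.
suff <- : m = n by [].
have /card_esym/ppcard_eqP/unsquash g := Im.
have [i|i j|_] := @orthonormal_dim m (fun i => f (g (i : nat))).
- by apply: Sf; apply: funS => /=.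
- rewrite fon; try by apply: funS => /=.
  congr (_ %:R); congr nat_of_bool; apply/eqP/eqP => [h|->//].
  by apply: val_inj; apply: (@inj _ _ _ g) h; rewrite inE/=.
- apply=> h Sh hf; apply: ftot => // i Ii.
  have [k km <-] := @surj _ _ _ _ g i Ii.
  exact: (hf (Ordinal km)).
Qed.

End finite_dim.

End inner_product.

(** ** Hermitian matrices *)

(** A hermitian matrix has an orthonormal basis of real eigenvectors on each
    stable subspace: compress it to an orthonormal basis of the subspace, then
    apply the spectral theorem. *)
Lemma hermitian_stable_eigenbasis (C : numClosedFieldType) M k
    (A : 'M[C]_M) (U : 'M[C]_(k, M)) :
  (forall i j, A i j = (A j i)^*) -> (U *m A <= U)%MS ->
  exists r (E : 'M[C]_(r, M)) (lam : 'I_r -> C),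
    [/\ E *m (map_mx Num.conj E^T) = 1%:M, (E :=: U)%MS,
        forall i, row i E *m A = lam i *: row i E &
        forall i, lam i \is Num.real].
Proof.
move=> Aherm UA; pose B := schmidt (row_base U).
have Bu : B \is unitarymx by exact: schmidt_unitarymx (rank_leq_col _).
have BU : (B :=: U)%MS.
  by apply: eqmx_trans (eqmx_schmidt_free (row_base_free _)) (eq_row_base _).
have BBt : B *m (map_mx Num.conj B^T) = 1%:M by exact/unitarymxP.
have At : A = map_mx Num.conj A^T by apply/matrixP => i j; rewrite !mxE.
pose A' := B *m A *m (map_mx Num.conj B^T).
have A'B : A' *m B = B *m A.
  have /submxP[Z BA] : (B *m A <= B)%MS.
    by rewrite (submx_trans _ (submx_trans UA _)) ?BU// submxMr// BU.
  by rewrite /A' BA -[Z *m B *m _]mulmxA BBt mulmx1.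
have A'h : A' \is hermsymmx.
  apply/is_hermitianmxP; rewrite expr0 scale1r /A' !trmx_mul !map_mxM -At.
  rewrite map_trmx trmxK -map_mx_comp (map_mx_id (@conjCK _)) mulmxA.
  by rewrite -map_trmx.
have /orthomx_spectralP A'E := hermitian_normalmx A'h.
have Pu := spectral_unitarymx A'.
set P := spectralmx A' in A'E Pu; set sp := spectral_diag A' in A'E.
have PB : P *m B \is unitarymx by exact: mul_unitarymx.
exists (\rank U), (P *m B), (fun i => sp 0 i); split.
- exact/unitarymxP.
- apply: eqmx_trans BU; apply/eqmxMfull; rewrite row_full_unit.
  exact: spectral_unit.
- move=> i; rewrite -row_mul -mulmxA -A'B A'E !mulmxA mulmxV ?spectral_unit// mul1mx.
  by rewrite -mulmxA row_mul row_diag_mx -scalemxAl -rowE.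
- by move=> i; have /mxOverP := hermitian_spectral_diag_real A'h; exact.
Qed.

(** * Functions that are constant on the pieces of a finite partition *)

Section step_functions.
Context d (T : measurableType d) (R : realType) (mu : {measure set T -> \bar R}).
Variables (A : set T) (I : finType) (P : I -> set T).
Hypotheses (mA : measurable A) (fA : (mu A < +oo)%E).
Hypotheses (mP : forall i, measurable (P i)).
Hypothesis P_cover : forall x, A x -> exists i, P i x.
Hypothesis P_disj : forall i j x, A x -> P i x -> P j x -> i = j.
Variables (F : T -> R[i]) (v : I -> R[i]).
Hypothesis FE : forall i x, A x -> P i x -> F x = v i.

Let FE_indic b : {in A, (fun x => part b (F x)) =1
  (fun x => \sum_i part b (v i) * \1_(P i) x)}.
Proof.
move=> x /set_mem Ax; have [i Pi] := P_cover Ax.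
rewrite (bigD1 i)//= big1 ?addr0 ?indicE ?mem_set// ?mulr1 ?(FE Ax Pi)//.
move=> j ji; rewrite indicE memNset ?mulr0// => Pj.
by move: ji; rewrite (P_disj Ax Pi Pj) eqxx.
Qed.

Let mv b i : measurable_fun A (fun x => part b (v i) * \1_(P i) x).
Proof. by apply: measurable_funM => //; exact: measurable_indic. Qed.

Lemma step_L2 : L2 mu A F.
Proof.
apply: (@L2_bounded _ _ _ _ _ mA fA F (\sum_i (`|part true (v i)| + `|part false (v i)|))) => [b|x b Ax].
- by apply: eq_measurable_fun (measurable_sum _ (mv b)) => x xA; rewrite FE_indic.
- have [i Pi] := P_cover Ax; rewrite (FE Ax Pi) (bigD1 i)//=.
  apply: ler_wpDr; first by apply: sumr_ge0 => j _; rewrite addr_ge0.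
  by case: b; rewrite ?lerDl ?lerDr.
Qed.

Lemma Cint_step : Cintegral mu A F = \sum_i (fine (mu (A `&` P i)))%:C%C * v i.
Proof.
apply: part_eq => b; rewrite part_Cint part_sum (eq_Rintegral _ (FE_indic b)).
have mi i : mu.-integrable A (EFin \o (fun x => part b (v i) * \1_(P i) x)).
  apply: intbleZ => //; apply/integrableP; split.
    by apply/measurable_EFinP; exact: measurable_indic.
  under eq_integral do rewrite /= ger0_norm//.
  rewrite integral_indic//; apply: le_lt_trans fA.
  by apply: le_measure; rewrite ?inE//; exact: measurableI.
rewrite /Rintegral; under eq_integral do rewrite -sumEFin.
rewrite integral_sum//= -[RHS]/(fine (\sum_i _)%:E) -sumEFin; congr fine.
apply: eq_bigr => i _; rewrite partZ mulrC EFinM.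
have fin : mu (A `&` P i) \is a fin_num.
  rewrite ge0_fin_numE//; apply: le_lt_trans fA.
  by apply: le_measure; rewrite ?inE//; exact: measurableI.
under eq_integral do rewrite EFinM.
rewrite integralZl//; last first.
  by apply/integrableP; split; [apply/measurable_EFinP; exact: measurable_indic|
    under eq_integral do rewrite /= ger0_norm//; rewrite integral_indic// setIC -ge0_fin_numE].
by rewrite integral_indic// setIC fineK.
Qed.

End step_functions.

(** * Haar measure of discs *)

Section haar.
Context (p : nat) (p_prime : prime p) (R : realType) (K : padicField p R).
Variable mu : {sigma_finite_measure set (Qp K) -> \bar R}.
Hypothesis mu_haar : is_haar mu.
Local Notation Q := (Qp K).
Implicit Types x y : Q.

Lemma padic_open_measurable (U : set Q) : padic_open U -> measurable U.
Proof. by move=> oU; exact: sub_sigma_algebra. Qed.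

Lemma pball_open x r : 0 < r -> padic_open (pball x r).
Proof.
move=> r0 y xy; exists r => // z yz.
exact: absp_dist_le xy (ltW yz).
Qed.

Lemma measurable_pball x r : 0 < r -> measurable (pball x r).
Proof. by move=> r0; apply: padic_open_measurable; exact: pball_open. Qed.

(** The unit disc is the disjoint union of [p ^ n] translates of the disc of
    radius [p ^- n]. *)
Lemma mu_pball x n : mu (pball x (p%:R ^- n)) = (p%:R ^- n)%:E.
Proof.
have [tr unit] := mu_haar.
have r0 := @expp_gt0 p p_prime R n.
have tr0 y : mu (pball y (p%:R ^- n)) = mu (pball 0 (p%:R ^- n)).
  rewrite -(tr y _ (measurable_pball 0 r0)); congr (mu _); apply/seteqP; split => z /=.
    move=> yz; exists (z - y); last by rewrite addrC subrK.
    by rewrite /pball/= sub0r opprB.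
  by move=> [w w0 <-]; rewrite /pball/= opprD addNKr// -sub0r.
rewrite tr0; pose B (k : 'I_(p ^ n)) := pball (k%:R : Q) (p%:R ^- n).
have E : [set x | absp x <= 1] = \big[setU/set0]_(k < p ^ n) B k.
  rewrite -bigcup_seq; apply/seteqP; split => y /=.
    move=> /(padic_residue p_prime n)[k kn yk]; exists (Ordinal kn); first by rewrite /= mem_index_enum.
    by rewrite /B /pball/= absp_distC.
  move=> [k _ ky]; have -> : y = k%:R - (k%:R - y) by rewrite subKr.
  rewrite (le_trans (absp_max _ _))// ge_max absp_natr// abspN//.
  by rewrite (le_trans ky)// expp_le1.
have mB k : measurable (B k) by exact: measurable_pball.
have fin : mu (pball 0 (p%:R ^- n)) \is a fin_num.
  rewrite ge0_fin_numE//; apply: (@le_lt_trans _ _ 1%E); last exact: ltry.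
  rewrite -unit; apply: le_measure; rewrite ?inE//; try exact: measurable_pball.
    by rewrite E; exact: bigsetU_measurable.
  by move=> y; rewrite /pball/= sub0r abspN// => h; rewrite (le_trans h)// expp_le1.
move: unit; rewrite E measure_semi_additive_ord//; last 2 first.
- apply/trivIsetP => i j _ _ ij; rewrite -subset0 => y [iy jy]; move/eqP: ij; apply.
  apply/val_inj/(padic_residue_inj p_prime (ltn_ord i) (ltn_ord j)).
  by apply: absp_dist_le iy _; rewrite absp_distC.
- exact: bigsetU_measurable.
move=> h0; have : (\sum_(k < p ^ n) mu (pball 0%R (p%:R ^- n)) = 1)%E.
  by rewrite -h0; apply: eq_bigr => k _; rewrite -(tr0 k%:R).
rewrite -(fineK fin) sumEFin sumr_const card_ord => -[] h.
congr EFin; rewrite -[LHS](@mulfK _ (p%:R ^+ n)) ?gt_eqF ?exprn_gt0 ?prime_gt0R//.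
have e : fine (mu (pball 0 (p%:R ^- n))) * p%:R ^+ n = 1.
  by rewrite -[RHS]h -[RHS]mulr_natr natrX.
by rewrite e mul1r.
Qed.

Variable Om : clopen_domain K.
Local Notation c := (dom_ctr Om).
Local Notation rad := (rad Om).
Let mu2 : {measure set (Q * Q) -> \bar R} := (mu \x mu)%E.

Lemma clopen_measurable (A : set Q) n :
  (forall x y, A x -> absp (x - y) <= rad n -> A y) -> measurable A.
Proof.
move=> Ast; apply: padic_open_measurable => x Ax; exists (rad n).
  exact: rad_gt0.
by move=> y xy; apply: Ast Ax (ltW xy).
Qed.

Lemma measurable_dom : measurable (dom_set Om).
Proof. by apply: (@clopen_measurable _ 0) => x y; exact: dom_stable_rad. Qed.

Lemma measurable_lball n x : measurable (pball x (rad n)).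
Proof. by apply: measurable_pball; exact: rad_gt0. Qed.

Lemma mu_lball n x : mu (pball x (rad n)) = (rad n)%:E.
Proof. exact: mu_pball. Qed.

Let dom_bigcup n : dom_set Om `<=` \big[setU/set0]_i pball (c n i) (rad n).
Proof.
rewrite -bigcup_seq => x Ox; have [i xi] := dom_ctr_cover n Ox.
by exists i; [rewrite /= mem_index_enum|rewrite /pball/= absp_distC].
Qed.

Lemma lball_disj n i j x :
  pball (c n i) (rad n) x -> pball (c n j) (rad n) x -> i = j.
Proof.
by move=> ix jx; apply: (dom_ctr_unique p_prime (x := x)); rewrite absp_distC.
Qed.

Let dom_bigE n : dom_set Om = \big[setU/set0]_i pball (c n i) (rad n).
Proof.
apply/seteqP; split; first exact: dom_bigcup.
by rewrite -bigcup_seq => x [i _]; exact: dom_stable_rad (dom_ctr_in _).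
Qed.

Lemma mu_dom n : mu (dom_set Om) = ((dom_num Om n)%:R * rad n)%:E.
Proof.
rewrite {1}(dom_bigE n) measure_semi_additive_ord.
- rewrite (eq_bigr (fun=> (rad n)%:E)); last by move=> i _; exact: mu_lball.
  by rewrite sumEFin sumr_const card_ord mulr_natl.
- by move=> i; exact: measurable_lball.
- by move=> i j _ _ [x [ix jx]]; exact: lball_disj ix jx.
- by apply: bigsetU_measurable => i _; exact: measurable_lball.
Qed.

Lemma mu_dom_lty : (mu (dom_set Om) < +oo)%E.
Proof. by rewrite (mu_dom 0) ltry. Qed.

Lemma mu_lty (A : set Q) : measurable A -> A `<=` dom_set Om -> (mu A < +oo)%E.
Proof.
move=> mA AO; apply: le_lt_trans mu_dom_lty; apply: le_measure => //; rewrite inE//.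
exact: measurable_dom.
Qed.

Lemma lball_cover n x : Om x -> exists i, pball (c n i) (rad n) x.
Proof.
move=> Ox; have [i xi] := dom_ctr_cover n Ox.
by exists i; rewrite /pball/= absp_distC.
Qed.

Section stable_set.
Variables (A : set Q) (n : nat).
Hypotheses (AO : A `<=` dom_set Om)
  (Ast : forall x y, A x -> absp (x - y) <= rad n -> A y).

Lemma lball_capE i : A `&` pball (c n i) (rad n) =
  if `[< A (c n i) >] then pball (c n i) (rad n) else set0.
Proof.
case: asboolP => Ai; apply/seteqP; split => x //=.
- by move=> [].
- by move=> ix; split => //; exact: Ast ix.
- by move=> [Ax ix]; apply: Ai; apply: Ast Ax _; rewrite absp_distC.
Qed.

Lemma mu_lball_cap i : fine (mu (A `&` pball (c n i) (rad n))) =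
  if `[< A (c n i) >] then rad n else 0.
Proof.
by rewrite lball_capE; case: ifP => _; [rewrite mu_lball|rewrite measure0].
Qed.

Lemma measurable_stable : measurable A.
Proof. exact: clopen_measurable Ast. Qed.

Variable F : Q -> R[i].
Hypothesis FA : forall x y, A x -> absp (x - y) <= rad n -> F x = F y.

Let FE i x : A x -> pball (c n i) (rad n) x -> F x = F (c n i).
Proof. by move=> Ax ix; apply: FA => //; rewrite absp_distC. Qed.

Lemma lvl_L2 : L2 mu A F.
Proof.
apply: (@step_L2 _ _ _ mu A _ (fun i => pball (c n i) (rad n)) _ _ _ _ _ F (F \o c n)).
- exact: measurable_stable.
- exact: mu_lty measurable_stable AO.
- by move=> i; exact: measurable_lball.
- by move=> x /AO; exact: lball_cover.
- by move=> i j x _; exact: lball_disj.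
- exact: FE.
Qed.

Lemma Cint_lvl : Cintegral mu A F =
  (rad n)%:C%C * \sum_(i | `[< A (c n i) >]) F (c n i).
Proof.
rewrite (@Cint_step _ _ _ mu A _ (fun i => pball (c n i) (rad n)) _ _ _ _ _ F (F \o c n)).
- rewrite mulr_sumr [RHS]big_mkcond/=; apply: eq_bigr => i _.
  by rewrite mu_lball_cap; case: ifP => _ //; rewrite mul0r.
- exact: measurable_stable.
- exact: mu_lty measurable_stable AO.
- by move=> i; exact: measurable_lball.
- by move=> x /AO; exact: lball_cover.
- by move=> i j x _; exact: lball_disj.
- exact: FE.
Qed.

End stable_set.

Section stable_sets2.
Variables (A B : set Q) (n : nat).
Hypotheses (AO : A `<=` dom_set Om) (BO : B `<=` dom_set Om)
  (Ast : forall x y, A x -> absp (x - y) <= rad n -> A y)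
  (Bst : forall x y, B x -> absp (x - y) <= rad n -> B y).
Variable F : Q * Q -> R[i].
Hypothesis FA : forall x x' y y', A x -> B y ->
  absp (x - x') <= rad n -> absp (y - y') <= rad n -> F (x, y) = F (x', y').

Let mA := measurable_stable Ast.
Let mB := measurable_stable Bst.
Let P (ij : 'I_(dom_num Om n) * 'I_(dom_num Om n)) :=
  pball (c n ij.1) (rad n) `*` pball (c n ij.2) (rad n).

Let mP ij : measurable (P ij).
Proof. by apply: measurableX; exact: measurable_lball. Qed.

Let P_cover z : (A `*` B) z -> exists ij, P ij z.
Proof.
move=> [/AO/(lball_cover n)[i iz] /BO/(lball_cover n)[j jz]].
by exists (i, j).
Qed.

Let P_disj ij kl z : (A `*` B) z -> P ij z -> P kl z -> ij = kl.
Proof.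
move: ij kl => [i j] [k l] _ [/= a b] [/= a' b'].
by rewrite (lball_disj a a') (lball_disj b b').
Qed.

Let FE ij z : (A `*` B) z -> P ij z -> F z = F (c n ij.1, c n ij.2).
Proof.
by move: z => [x y] [/= Ax By] [/= ix jy]; apply: FA => //; rewrite absp_distC.
Qed.

Lemma mu2_rect (A' B' : set Q) : measurable A' -> measurable B' ->
  mu2 (A' `*` B') = (mu A' * mu B')%E.
Proof. exact: product_measure1E. Qed.

Let fAB : (mu2 (A `*` B) < +oo)%E.
Proof.
rewrite mu2_rect// lte_mul_pinfty//; last exact: mu_lty.
by rewrite ge0_fin_numE//; exact: mu_lty.
Qed.

Lemma lvl_L2_2 : L2 mu2 (A `*` B) F.
Proof.
apply: (@step_L2 _ _ _ mu2 _ _ P _ _ _ _ _ F (fun ij => F (c n ij.1, c n ij.2))) => //.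
exact: measurableX.
Qed.

Lemma Cint_lvl2 : Cintegral mu2 (A `*` B) F =
  (rad n ^+ 2)%:C%C * \sum_(i | `[< A (c n i) >]) \sum_(j | `[< B (c n j) >])
    F (c n i, c n j).
Proof.
rewrite (@Cint_step _ _ _ mu2 _ _ P _ _ _ _ _ F (fun ij => F (c n ij.1, c n ij.2)))//.
  rewrite -(pair_bigA _ (fun i j => (fine (mu2 (A `*` B `&` P (i, j))))%:C%C *
    F (c n i, c n j)))/= mulr_sumr [RHS]big_mkcond/=; apply: eq_bigr => i _.
  have muP j : fine (mu2 (A `*` B `&` P (i, j))) =
      (if `[< A (c n i) >] then rad n else 0) * (if `[< B (c n j) >] then rad n else 0).
    rewrite -setXI mu2_rect; try (apply: measurableI => //; exact: measurable_lball).
    rewrite !lball_capE//; case: ifP => _; case: ifP => _; rewrite ?measure0 ?mu_lball/= ?mul0e ?mule0 ?mul0r ?mulr0//.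
  under eq_bigr do rewrite muP.
  case: ifP => _; last by rewrite big1// => j _; rewrite !mul0r.
  rewrite mulr_sumr [RHS]big_mkcond/=; apply: eq_bigr => j _.
  by case: ifP => _; rewrite ?mulr0 ?mul0r// expr2.
exact: measurableX.
Qed.

End stable_sets2.

(** ** Functions with vanishing averages *)

Section lball_null.

Let G : set (set Q) := [set B | B = set0 \/ exists n x, B = pball x (rad n)].

Let lball_nested m n x y z : (m <= n)%N -> pball x (rad m) z -> pball y (rad n) z ->
  pball x (rad m) `&` pball y (rad n) = pball y (rad n).
Proof.
move=> mn xz yz; apply/seteqP; split => w /=; first by case.
move=> yw; split => //; apply: absp_dist_le xz _.
apply: (@le_trans _ _ (rad n)); last exact: le_rad.
by apply: absp_dist_le yw; rewrite absp_distC.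
Qed.

Let G_setI : setI_closed G.
Proof.
move=> A B [->|[n [x ->]]]; first by rewrite set0I; left.
move=> [->|[m [y ->]]]; first by rewrite setI0; left.
have [[z [xz yz]]|h] := pselect (exists z, pball x (rad n) z /\ pball y (rad m) z); last first.
  by left; rewrite -subset0 => z [xz yz]; apply: h; exists z.
right; case: (leqP n m) => [nm|/ltnW mn].
  by exists m, y; exact: lball_nested xz yz.
by exists n, x; rewrite setIC; exact: lball_nested yz xz.
Qed.

Let G_gen : @measurable _ Q = <<s G >>.
Proof.
apply/seteqP; split.
  apply: smallest_sub; first exact: smallest_sigma_algebra.
  move=> U oU.
  pose F k := if unpickle k is Some (q, n) then
    if `[< pball (ratr q) (rad n) `<=` U >] then pball (ratr q : Q) (rad n) else set0
    else set0.
  have -> : U = \bigcup_k F k.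
    apply/seteqP; split => [x Ux|x [k _]]; last first.
      rewrite /F; case: unpickle => // -[q n]; case: asboolP => // h; exact: h.
    have [e e0 eU] := oU x Ux; have [n ne] := rad_small p_prime Om e0.
    have [q qx] := padic_dense x (rad_gt0 p_prime Om n).
    have qx' : pball (ratr q) (rad n) x by rewrite /pball/= absp_distC// ltW.
    exists (pickle (q, n)); [exact: Logic.I|rewrite /F pickleK; case: asboolP => // h].
    exfalso; apply: h => y qy; apply: eU; apply: le_lt_trans ne.
    by apply: absp_dist_le qy; exact: ltW.
  apply: sigma_algebra_bigcup => k; rewrite /F.
  have s0 : <<s G >> set0 by exact: sigma_algebra0.
  case: unpickle => // -[q n]; case: asboolP => // _.
  by apply: sub_sigma_algebra; right; exists n, (ratr q).
apply: smallest_sub; first exact: sigma_algebra_measurable.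
by move=> B [->//|[n [x ->]]]; exact: measurable_lball.
Qed.

(** The Borel sets over which [f] integrates to zero form a Dynkin system, and
    the small discs are a generating pi-system. *)
Lemma lball_null (f : Q -> R[i]) : L2 mu (dom_set Om) f ->
  (forall n i, Cintegral mu (pball (c n i) (rad n)) f = 0) ->
  eq_ae mu (dom_set Om) f (fun=> 0).
Proof.
move=> Lf f0; have mO := measurable_dom; have fO := mu_dom_lty.
have part_ae b : ae_eq mu (dom_set Om) (EFin \o (fun x => part b (f x))) (fun=> 0%E).
  set u := (fun x => part b (f x)).
  have iu : mu.-integrable (dom_set Om) (EFin \o u) by exact: L2_intble.
  have iuS E : measurable E -> mu.-integrable (dom_set Om `&` E) (EFin \o u).
    by move=> mE; apply: integrableS iu => //; exact: measurableI.
  pose N (E : set Q) := (\int[mu]_(x in dom_set Om `&` E) (u x)%:E = 0)%E.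
  have u0 n i : (\int[mu]_(x in pball (c n i) (rad n)) (u x)%:E = 0)%E.
    have ib : mu.-integrable (pball (c n i) (rad n)) (EFin \o u).
      apply: integrableS iu => //; first exact: measurable_lball.
      by move=> x; exact: dom_stable_rad (dom_ctr_in _).
    rewrite -[LHS]fineK; last by apply: integrable_fin_num ib; exact: measurable_lball.
    by have := congr1 (part b) (f0 n i); rewrite part_Cint part0 /Rintegral => ->.
  have NT : N setT.
    rewrite /N setIT.
    have E := dom_bigE 0.
    rewrite {1}E (@integral_bigsetU_EFin _ _ _ mu _ (fun i => pball (c 0%N i) (rad 0)))//.
    - by rewrite big1// => i _; exact: u0.
    - by move=> i; exact: measurable_lball.
    - exact: index_enum_uniq.
    - by move=> i j _ _ [x [ix jx]]; exact: lball_disj ix jx.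
    - by rewrite -E; exact: measurable_int iu.
  have NE E : measurable E -> N E.
    move=> mE; apply: (@dynkin_induction _ _ G N G_gen G_setI NT) => //; last first.
    - by rewrite -G_gen.
    - move=> F mF tF NF; rewrite /N setI_bigcupr integral_bigcup.
      + by under eq_eseriesr do rewrite NF; exact: eseries0.
      + apply/trivIsetP => i j _ _ ij; rewrite setIACA setIid.
        by move/trivIsetP : tF => /(_ i j Logic.I Logic.I ij) ->; rewrite setI0.
      + by move=> k; exact: measurableI.
      + rewrite -setI_bigcupr; apply: iuS; exact: bigcupT_measurable.
    - move=> S mS NS; rewrite /N.
      have := @Rintegral_setU _ _ _ mu (dom_set Om `&` S) (dom_set Om `&` ~` S) u.
      rewrite -setIUr setUv setIT /Rintegral NS add0r => h.
      rewrite -[LHS]fineK; last by apply: integrable_fin_num (iuS _ (measurableC mS)); exact/measurableI/measurableC.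
      rewrite -h//; [|exact: measurableI|exact/measurableI/measurableC|]; last first.
        by apply/disj_setPS => x [[_ ?] [_]].
      by move: NT; rewrite /N setIT => ->.
    - move=> B [->|[n [x ->]]]; rewrite /N; first by rewrite setI0 integral_set0.
      have [Ox|nOx] := pselect (Om x).
        have [i ix] := lball_cover n Ox.
        rewrite (_ : _ `&` _ = pball (c n i) (rad n)) ?u0//.
        apply/seteqP; split => y /=.
          by move=> [_ xy]; apply: absp_dist_le ix xy.
        move=> iy; split; first exact: dom_stable_rad (dom_ctr_in _) iy.
        by apply: absp_dist_le iy; rewrite absp_distC.
      rewrite (_ : _ `&` _ = set0) ?integral_set0// -subset0 => y [Oy xy].
      by apply: nOx; apply: (dom_stable_rad p_prime Oy (n := n)); rewrite absp_distC.
  apply: integral_ae_eq => // E EO mE; rewrite integral0.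
  by have := NE E mE; rewrite /N (setIidr EO).
move: (part_ae true) (part_ae false).
apply: filterS2 => x /= h1 h2 Ox; apply: part_eq => -[]; rewrite part0.
  by have := h1 Ox => -[].
by have := h2 Ox => -[].
Qed.

End lball_null.

End haar.

(** * Ultrametric partitions *)

(** A finite partition of the domain into clopen pieces, any two of which are
    at a constant distance: the discs of a given radius, or the holes. *)
Record ultra_partition p (R : realType) (K : padicField p R)
    (Om : clopen_domain K) (I : finType) := UltraPartition {
  up_set :> I -> set (Qp K);
  up_ctr : I -> Qp K;
  up_lvl : nat;
  up_cover : forall x, Om x -> exists i, up_set i x;
  up_sub : forall i x, up_set i x -> Om x;
  up_disj : forall i j x, up_set i x -> up_set j x -> i = j;
  up_in : forall i, up_set i (up_ctr i);
  up_stable : forall i x y, up_set i x -> absp (x - y) <= rad Om up_lvl ->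
    up_set i y;
  up_dist : forall i j x y, i != j -> up_set i x -> up_set j y ->
    absp (x - y) = absp (up_ctr i - up_ctr j)
}.

Section level_partition.
Context (p : nat) (p_prime : prime p) (R : realType) (K : padicField p R).
Variables (Om : clopen_domain K) (n : nat).

(** Moving two points by at most [r] does not change their distance when it
    exceeds [r]. *)
Lemma absp_far_eq (r : R) (x x' y y' : Qp K) : absp (x - x') <= r ->
  absp (y - y') <= r -> r < absp (x - y) -> absp (x' - y') = absp (x - y).
Proof.
move=> xx yy xy; have x'y : absp (x' - y) = absp (x - y).
  by apply: absp_isosceles => //; exact: le_lt_trans xy.
rewrite absp_distC// -x'y [RHS]absp_distC//; apply: absp_isosceles => //.
by rewrite [ltRHS]absp_distC// x'y; exact: le_lt_trans xy.
Qed.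

Lemma level_partition_dist i j x y : i != j ->
  pball (dom_ctr Om n i) (rad Om n) x -> pball (dom_ctr Om n j) (rad Om n) y ->
  absp (x - y) = absp (dom_ctr Om n i - dom_ctr Om n j).
Proof.
move=> ij ix jy; apply: (absp_far_eq ix jy); rewrite ltNge; apply/negP => h.
by move: ij; rewrite (dom_ctr_inj h) eqxx.
Qed.

Definition level_partition : ultra_partition Om 'I_(dom_num Om n).
Proof.
apply: (@UltraPartition _ _ _ Om _ (fun i => pball (dom_ctr Om n i) (rad Om n))
  (dom_ctr Om n) n).
- exact: lball_cover.
- by move=> i x; exact: (dom_stable_rad p_prime (dom_ctr_in _)).
- by move=> i j x; exact: lball_disj.
- by move=> i; rewrite /pball/= subrr absp0 ltW// rad_gt0.
- by move=> i x y; exact: absp_dist_le.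
- by move=> i j x y; exact: level_partition_dist.
Defined.

End level_partition.

Section Ccvg.
Context (R : realType).
Implicit Types (z w : nat -> R[i]).

Definition Ccvg z (l : R[i]) :=
  forall b, part b (z n) @[n --> \oo] --> part b l.

Lemma Ccvg_unique z w l l' : Ccvg z l -> Ccvg w l' -> z = w -> l = l'.
Proof.
move=> zl wl zw; apply: part_eq => b; move: (wl b); rewrite -zw => wl'.
exact: cvg_unique (zl b) wl'.
Qed.

Lemma CcvgZ (r : R) z l : Ccvg z l -> Ccvg (fun n => r%:C%C * z n) (r%:C%C * l).
Proof.
move=> zl b; rewrite partZ; under eq_fun do rewrite partZ.
by apply: cvgM => //; exact: cvg_cst.
Qed.

Lemma CcvgB z w l l' : Ccvg z l -> Ccvg w l' -> Ccvg (fun n => z n - w n) (l - l').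
Proof.
by move=> zl wl b; rewrite partB; under eq_fun do rewrite partB; apply: cvgB.
Qed.

Lemma Ccvg_sum (I : Type) (s : seq I) (P : pred I) (z : I -> nat -> R[i])
    (l : I -> R[i]) : (forall i, P i -> Ccvg (z i) (l i)) ->
  Ccvg (fun n => \sum_(i <- s | P i) z i n) (\sum_(i <- s | P i) l i).
Proof.
move=> zl b; elim: s => [|i s IH].
  by rewrite big_nil; under eq_fun do rewrite big_nil; exact: cvg_cst.
rewrite big_cons; under eq_fun do rewrite big_cons.
case: ifPn => // Pi; rewrite partD.
rewrite (_ : (fun n => part b (z i n + \sum_(j <- s | P j) z j n)) =
  (fun n => part b (z i n) + part b (\sum_(j <- s | P j) z j n))).
  by apply: cvgD => //; exact: zl.
by apply/funext => n; rewrite partD.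
Qed.

End Ccvg.

Section closure.
Context d1 (T1 : measurableType d1) d2 (T2 : measurableType d2) (R : realType).
Variables (mu1 : {measure set T1 -> \bar R}) (D1 : set T1).
Variables (mu2 : {measure set T2 -> \bar R}) (D2 : set T2).
Variable A : (T1 -> R[i]) -> (T2 -> R[i]) -> Prop.

Lemma L2_cvg_cst d (T : measurableType d) (mu : {measure set T -> \bar R})
  (D : set T) (f g : T -> R[i]) : {in D, f =1 g} -> L2_cvg mu D (fun=> f) g.
Proof.
move=> fg; rewrite /L2_cvg.
under eq_fun => n.
  rewrite (eq_integral (fun=> 0%E)); last first.
    by move=> x xD; rewrite fg// subrr /sqmod/= expr0n addr0.
  rewrite integral0; over.
exact: cvg_cst.
Qed.

Lemma L2_cvg_eq d (T : measurableType d) (mu : {measure set T -> \bar R})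
  (D : set T) (u : nat -> T -> R[i]) f g : {in D, f =1 g} ->
  L2_cvg mu D u f -> L2_cvg mu D u g.
Proof.
move=> fg; apply: cvg_trans; rewrite (_ : (fun n => _) = fun n =>
  (\int[mu]_(x in D) (sqmod (u n x - g x))%:E)%E); first exact: cvg_refl.
by apply/funext => n; apply: eq_integral => x xD; rewrite fg.
Qed.

Lemma op_closure_sub f g f' g' : A f g -> {in D1, f =1 f'} -> {in D2, g =1 g'} ->
  L2 mu1 D1 f -> L2 mu2 D2 g -> op_closure mu1 D1 mu2 D2 A f' g'.
Proof.
move=> Afg ff gg Lf Lg; split; [exact: L2_eqD ff|exact: L2_eqD gg|].
by exists (fun=> f), (fun=> g); split => //; exact: L2_cvg_cst.
Qed.

Lemma op_closure_eq f g f' g' : op_closure mu1 D1 mu2 D2 A f g ->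
  {in D1, f =1 f'} -> {in D2, g =1 g'} -> op_closure mu1 D1 mu2 D2 A f' g'.
Proof.
move=> [Lf Lg [u [w [Auw uf wg]]]] ff gg; split; [exact: L2_eqD ff|exact: L2_eqD gg|].
exists u, w; split => //.
- exact: L2_cvg_eq uf.
- exact: L2_cvg_eq wg.
Qed.

End closure.

(** * The operators on an ultrametric partition *)

Lemma sum_sub (V : comPzRingType) (I J : finType) (A : pred I) (B : pred J)
    (F : I -> V) (G : J -> V) :
  \sum_(k | A k) \sum_(l | B l) (F k - G l) =
  (\sum_(l | B l) 1) * (\sum_(k | A k) F k) -
  (\sum_(k | A k) 1) * (\sum_(l | B l) G l).
Proof.
under eq_bigr do rewrite sumrB; rewrite sumrB; congr (_ - _).
  by rewrite mulrC big_distrl/=; apply: eq_bigr => k _; rewrite mulr_sumr; apply: eq_bigr => l _; rewrite mulr1.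
by rewrite big_distrl/=; apply: eq_bigr => k _; rewrite mul1r.
Qed.

Section operators.
Context (p : nat) (p_prime : prime p) (R : realType) (K : padicField p R).
Variable mu : {sigma_finite_measure set (Qp K) -> \bar R}.
Hypothesis mu_haar : is_haar mu.
Variable Om : clopen_domain K.
Variable holes : set (set (Qp K)).
Hypothesis OmE : OmegaV holes = dom_set Om.
Variable alpha : R.
Hypothesis alpha_gt0 : 0 < alpha.
Local Notation Q := (Qp K).
Local Notation c := (dom_ctr Om).
Local Notation rad := (rad Om).
Local Notation mu2 := ((mu \x mu)%E : {measure set (Q * Q) -> \bar R}).
Local Notation Om2 := (dom_set Om `*` dom_set Om).

Lemma OmegaE_E : OmegaE holes = Om2.
Proof.
rewrite -OmE; apply/seteqP; split => [[x y]|[x y]].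
  by move=> [[H H'] [/= HH HH'] [/= Hx Hy]]; split; [exists H|exists H'].
by move=> [[H HH Hx] [H' HH' Hy]]; exists (H, H').
Qed.

Let mO := measurable_dom p_prime Om.
Let fO := mu_dom_lty p_prime mu_haar Om.
Let mO2 : measurable Om2 := measurableX mO mO.

Lemma mu2_dom_lty : (mu2 Om2 < +oo)%E.
Proof.
rewrite mu2_rect// lte_mul_pinfty//.
by rewrite ge0_fin_numE//; exact: mu_dom_lty.
Qed.
Let fO2 := mu2_dom_lty.

Let Ost n x y : Om x -> absp (x - y) <= rad n -> Om y.
Proof. exact: dom_stable_rad. Qed.

Lemma lvl_const_L2 n (f : Q -> R[i]) : lvl_const Om n f -> L2 mu (dom_set Om) f.
Proof. by move=> fn; apply: (@lvl_L2 _ p_prime _ _ _ mu_haar Om _ n) => //; exact: Ost. Qed.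

Lemma lvl_const2_L2 n (h : Q * Q -> R[i]) : lvl_const2 Om n h -> L2 mu2 Om2 h.
Proof.
by move=> hn; apply: (@lvl_L2_2 _ p_prime _ _ _ mu_haar Om _ _ n) => //; exact: Ost.
Qed.

Lemma locally_constantV_lvl (f : Q -> R[i]) :
  locally_constantV holes f <-> exists n, lvl_const Om n f.
Proof.
rewrite /locally_constantV OmE; split; first exact: locally_const_lvl.
move=> [n fn] x Ox; exists (rad n); first exact: rad_gt0.
by move=> y Oy yx; apply: fn => //; exact: ltW.
Qed.

Lemma locally_constantE_lvl (h : Q * Q -> R[i]) :
  locally_constantE holes h <-> exists n, lvl_const2 Om n h.
Proof.
rewrite /locally_constantE OmegaE_E; split.
  move=> hl; apply: (locally_const_lvl2 p_prime) => z z1 z2.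
  have [//|e e0 he] := hl z; exists e => // w w1 w2; apply: he; exact: conj.
move=> [n hn] [x y] [/= Ox Oy]; exists (rad n); first exact: rad_gt0.
by move=> [x' y'] [/= Ox' Oy'] xx yy; apply: hn => //; exact: ltW.
Qed.

(** ** The distance kernel *)

Lemma powR_absp_ctr0 : absp (0 : Q) `^ (- alpha) = 0.
Proof. by rewrite absp0 powR0// oppr_eq0 gt_eqF. Qed.

Lemma d_formulaE (f : Q -> R[i]) x y : d_formula alpha f (x, y) =
  ((absp (x - y) `^ (- alpha)) / 2)%:C%C * (f x - f y).
Proof.
rewrite /d_formula /= mulrC; congr (_ * _).
by rewrite -fmorphV/= invfM powRN mulrC.
Qed.

(** At distance at most [rad n] the numerator of [d_formula] vanishes; beyond,
    the denominator depends on the two discs only. *)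
Lemma d_formula_lvl n (f : Q -> R[i]) : lvl_const Om n f ->
  lvl_const2 Om n (d_formula alpha f).
Proof.
move=> fn x x' y y' Ox Oy xx yy; rewrite !d_formulaE -(fn x x')// -(fn y y')//.
have [xy|xy] := lerP (absp (x - y)) (rad n); last by rewrite (absp_far_eq p_prime xx yy xy).
by rewrite (fn x y)// subrr !mulr0.
Qed.

Lemma d_formula_anti (f : Q -> R[i]) x y :
  d_formula alpha f (x, y) = - d_formula alpha f (y, x).
Proof. by rewrite !d_formulaE absp_distC// -mulrN opprB. Qed.

Definition anti (h : Q * Q -> R[i]) := forall x y, Om x -> Om y ->
  h (x, y) = - h (y, x).

Lemma anti_diag h x : anti h -> Om x -> h (x, x) = 0.
Proof.
move=> ha Ox; have /eqP := ha x x Ox Ox.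
by rewrite -addr_eq0 -mulr2n mulrn_eq0/= => /eqP.
Qed.

Lemma antisymmetricE h : Defs.antisymmetric holes h <-> anti h.
Proof.
rewrite /Defs.antisymmetric OmegaE_E; split=> ha x y.
  by move=> Ox Oy; exact: ha.
by move=> [Ox Oy]; exact: ha.
Qed.

(** The singularity of the kernel on the diagonal is harmless: an antisymmetric
    function that is constant on products of discs vanishes near the diagonal. *)
Lemma anti_near0 n h x y : lvl_const2 Om n h -> anti h -> Om x ->
  absp (x - y) <= rad n -> h (x, y) = 0.
Proof.
move=> hn ha Ox xy; rewrite -(anti_diag ha Ox); apply/esym/hn => //.
by rewrite subrr absp0 ltW// rad_gt0.
Qed.

Section lvl_delta.
Variables (n : nat) (h : Q * Q -> R[i]).
Hypotheses (hn : lvl_const2 Om n h) (ha : anti h).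

Let integrand_lvl x y y' : Om x -> Om y -> absp (y - y') <= rad n ->
  h (x, y) * (absp (x - y) `^ (- alpha))%:C%C =
  h (x, y') * (absp (x - y') `^ (- alpha))%:C%C.
Proof.
move=> Ox Oy yy; have xx : absp (x - x) <= rad n by rewrite subrr absp0 ltW// rad_gt0.
have [xy|xy] := lerP (absp (x - y)) (rad n).
  rewrite !(anti_near0 hn)// ?mul0r//.
  exact: absp_dist_le xy yy.
by rewrite (hn Ox Oy xx yy) (absp_far_eq p_prime xx yy xy).
Qed.

Lemma delta_formula_sum x : Om x -> delta_formula mu holes alpha h x =
  (rad n)%:C%C * \sum_l h (x, c n l) * (absp (x - c n l) `^ (- alpha))%:C%C.
Proof.
move=> Ox; rewrite /delta_formula OmE (@Cint_lvl _ p_prime _ _ _ mu_haar Om _ n)//.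
- by congr (_ * _); apply: eq_bigl => l; apply/asboolP; exact: dom_ctr_in.
- exact: Ost.
- by move=> y y' Oy; exact: integrand_lvl.
Qed.

Lemma delta_formula_lvl : lvl_const Om n (delta_formula mu holes alpha h).
Proof.
move=> x x' Ox xx; have Ox' := Ost Ox xx.
rewrite !delta_formula_sum//; congr (_ * _); apply: eq_bigr => l _.
have ll : absp (c n l - c n l) <= rad n by rewrite subrr absp0 ltW// rad_gt0.
have Ol := dom_ctr_in (c:=Om) l.
have [xl|xl] := lerP (absp (x - c n l)) (rad n).
  rewrite !(anti_near0 hn)// ?mul0r//.
  by apply: absp_dist_le xl; rewrite absp_distC.
by rewrite (hn Ox Ol xx ll) (absp_far_eq p_prime xx ll xl).
Qed.

End lvl_delta.

(** ** Locally constant functions in the domains of the closures *)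

Lemma d_op_lvl n f g : lvl_const Om n f ->
  {in Om2, d_formula alpha f =1 g} -> d_op mu holes alpha f g.
Proof.
move=> fn fg; rewrite /d_op OmE OmegaE_E.
apply: (@op_closure_sub _ _ _ _ _ _ _ _ _ _ f (d_formula alpha f)) => //.
- by split => //; apply/locally_constantV_lvl; exists n.
- exact: lvl_const_L2 fn.
- exact: lvl_const2_L2 (d_formula_lvl fn).
Qed.

Lemma delta_op_lvl n h f : lvl_const2 Om n h -> anti h ->
  (forall x, Om x -> delta_formula mu holes alpha h x = f x) ->
  delta_op mu holes alpha h f.
Proof.
move=> hn ha hf; rewrite /delta_op OmE OmegaE_E.
apply: (@op_closure_sub _ _ _ _ _ _ _ _ _ _ h (delta_formula mu holes alpha h)) => //.
- by split => //; [apply/locally_constantE_lvl; exists n|exact/antisymmetricE].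
- by move=> x /set_mem; exact: hf.
- exact: lvl_const2_L2 hn.
- exact: lvl_const_L2 (delta_formula_lvl hn ha).
Qed.

Lemma D_op_lvl n f g : lvl_const Om n f ->
  (forall x, Om x -> delta_formula mu holes alpha (d_formula alpha f) x = g x) ->
  D_op mu holes alpha f g.
Proof.
move=> fn fg; rewrite /D_op OmE.
apply: (@op_closure_sub _ _ _ _ _ _ _ _ _ _ f
  (delta_formula mu holes alpha (d_formula alpha f))) => //.
- by split => //; apply/locally_constantV_lvl; exists n.
- by move=> x /set_mem; exact: fg.
- exact: lvl_const_L2 fn.
- apply: lvl_const_L2 (delta_formula_lvl (d_formula_lvl fn) _).
  by move=> x y _ _; exact: d_formula_anti.
Qed.

(** ** Weak formulation on the pieces of a partition *)

Section partition.
Variables (I : finType) (P : ultra_partition Om I).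
Local Notation ctr := (up_ctr P).

Definition mass i : R := fine (mu (P i)).
Definition ker i j : R := absp (ctr i - ctr j) `^ (- alpha).

Lemma up_stable_lvl n i x y : (up_lvl P <= n)%N -> P i x ->
  absp (x - y) <= rad n -> P i y.
Proof.
by move=> Pn ix xy; apply: up_stable ix _; rewrite (le_trans xy)// le_rad.
Qed.

Lemma measurable_up i : measurable (P i).
Proof.
by apply: (@clopen_measurable _ p_prime _ _ Om _ (up_lvl P)) => x y; exact: up_stable.
Qed.

Lemma up_subset i : P i `<=` dom_set Om.
Proof. by move=> x; exact: up_sub. Qed.

Lemma mu_up i : mu (P i) = (mass i)%:E.
Proof.
rewrite fineK// ge0_fin_numE//; apply: (mu_lty p_prime mu_haar (Om := Om)).
  exact: measurable_up.
exact: up_subset.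
Qed.

Lemma mass_gt0 i : 0 < mass i.
Proof.
rewrite -lte_fin -mu_up; apply: (@lt_le_trans _ _ (rad (up_lvl P))%:E).
  by rewrite lte_fin rad_gt0.
rewrite -(mu_lball p_prime mu_haar Om _ (ctr i)); apply: le_measure; rewrite ?inE.
- exact: measurable_lball.
- exact: measurable_up.
- by move=> x; apply: up_stable; exact: up_in.
Qed.

Lemma mass_ge0 i : 0 <= mass i. Proof. exact: ltW (mass_gt0 i). Qed.

Lemma ker_sym i j : ker i j = ker j i.
Proof. by rewrite /ker absp_distC. Qed.

Lemma ker_diag i : ker i i = 0.
Proof. by rewrite /ker subrr powR_absp_ctr0. Qed.

Lemma ker_gt0 i j : i != j -> 0 < ker i j.
Proof.
move=> ij; rewrite powR_gt0// lt_neqAle absp_ge0// andbT eq_sym absp_eq0 subr_eq0.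
apply: contra ij => /eqP h; apply/eqP; apply: (@up_disj _ _ _ _ _ P _ _ (ctr i)).
  exact: up_in.
by rewrite h; exact: up_in.
Qed.

Lemma ker_up i j x y : i != j -> P i x -> P j y ->
  absp (x - y) `^ (- alpha) = ker i j.
Proof. by move=> ij ix jy; rewrite (up_dist ij ix jy). Qed.

Lemma Cint_up n i (F : Q -> R[i]) : (up_lvl P <= n)%N -> lvl_const Om n F ->
  Cintegral mu (P i) F = (rad n)%:C%C * \sum_(k | `[< P i (c n k) >]) F (c n k).
Proof.
move=> Pn Fn; apply: (@Cint_lvl _ p_prime _ _ _ mu_haar Om) => //.
- exact: up_subset.
- by move=> x y; exact: up_stable_lvl.
- by move=> x y /up_sub; exact: Fn.
Qed.

Lemma mass_lvl n i : (up_lvl P <= n)%N ->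
  (mass i)%:C%C = (rad n)%:C%C * \sum_(k | `[< P i (c n k) >]) 1.
Proof.
move=> Pn; rewrite -(@Cint_up n i (fun=> 1))// Cint_cst ?mul1r//.
exact: measurable_up.
Qed.

Lemma Cint_up2 n i j (F : Q * Q -> R[i]) : (up_lvl P <= n)%N ->
  lvl_const2 Om n F -> Cintegral mu2 (P i `*` P j) F = (rad n ^+ 2)%:C%C *
  \sum_(k | `[< P i (c n k) >]) \sum_(l | `[< P j (c n l) >]) F (c n k, c n l).
Proof.
move=> Pn Fn; apply: (@Cint_lvl2 _ p_prime _ _ _ mu_haar Om) => //.
- exact: up_subset.
- exact: up_subset.
- by move=> x y; exact: up_stable_lvl.
- by move=> x y; exact: up_stable_lvl.
- by move=> x x' y y' /up_sub Ox /up_sub Oy; exact: Fn.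
Qed.

Lemma d_weak_lvl n i j (f : Q -> R[i]) : (up_lvl P <= n)%N -> lvl_const Om n f ->
  i != j -> Cintegral mu2 (P i `*` P j) (d_formula alpha f) = (ker i j / 2)%:C%C *
  ((mass j)%:C%C * Cintegral mu (P i) f - (mass i)%:C%C * Cintegral mu (P j) f).
Proof.
move=> Pn fn ij; rewrite (Cint_up2 _ _ Pn (d_formula_lvl fn)).
rewrite (eq_bigr (fun k => \sum_(l | `[< P j (c n l) >])
    (ker i j / 2)%:C%C * (f (c n k) - f (c n l)))); last first.
  move=> k /asboolP ik; apply: eq_bigr => l /asboolP jl.
  by rewrite d_formulaE (ker_up ij ik jl).
rewrite !(mass_lvl _ Pn) !(Cint_up _ Pn fn) rmorphXn/=.
under eq_bigr do rewrite -mulr_sumr.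
by rewrite -mulr_sumr sum_sub; ring.
Qed.

(** The part of the integral over [P i `*` P i] cancels by antisymmetry, since
    the kernel is symmetric; outside the kernel is constant on products of
    pieces. *)
Lemma delta_weak_lvl n i (h : Q * Q -> R[i]) : (up_lvl P <= n)%N ->
  lvl_const2 Om n h -> anti h ->
  Cintegral mu (P i) (delta_formula mu holes alpha h) =
  \sum_j (ker i j)%:C%C * Cintegral mu2 (P i `*` P j) h.
Proof.
move=> Pn hn ha; rewrite (Cint_up _ Pn (delta_formula_lvl hn ha)).
pose F k l := h (c n k, c n l) * (absp (c n k - c n l) `^ (- alpha))%:C%C.
have Fa k l : F k l = - F l k.
  by rewrite /F -mulNr -ha; [rewrite absp_distC|exact: dom_ctr_in|exact: dom_ctr_in].
rewrite (eq_bigr (fun k => (rad n)%:C%C * \sum_l F k l)); last first.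
  by move=> k _; exact: (delta_formula_sum hn ha (dom_ctr_in _)).
rewrite -mulr_sumr mulrA -expr2 -rmorphXn/=.
have /choice[blk blkP] k : exists j, P j (c n k).
  by apply: up_cover; exact: dom_ctr_in.
have blkE j k : `[< P j (c n k) >] = (blk k == j).
  by apply/asboolP/eqP => [jk|<-//]; exact: up_disj (blkP k) jk.
transitivity ((rad n ^+ 2)%:C%C * \sum_j \sum_(k | `[< P i (c n k) >])
    \sum_(l | `[< P j (c n l) >]) F k l).
  congr (_ * _); rewrite [in RHS]exchange_big/=; apply: eq_bigr => k _.
  rewrite (partition_big blk xpredT)//=; apply: eq_bigr => j _.
  by apply: eq_bigl => l; rewrite blkE.
rewrite mulr_sumr; apply: eq_bigr => j _; rewrite (Cint_up2 _ _ Pn hn) mulrCA.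
congr (_ * _); have [<-|ij] := eqVneq i j.
  rewrite ker_diag mul0r; set S := LHS.
  have /eqP : S = - S.
    rewrite /S {1}exchange_big -sumrN; apply: eq_bigr => k _.
    by rewrite -sumrN; apply: eq_bigr => l _.
  by rewrite -addr_eq0 -mulr2n mulrn_eq0/= => /eqP.
rewrite mulr_sumr; apply: eq_bigr => k /asboolP ik.
rewrite mulr_sumr; apply: eq_bigr => l /asboolP jl.
by rewrite /F (ker_up ij ik jl) mulrC.
Qed.

(** Passage to the closure: both sides are continuous for L^2 convergence. *)
Lemma d_weak f g i j : d_op mu holes alpha f g -> i != j ->
  Cintegral mu2 (P i `*` P j) g = (ker i j / 2)%:C%C *
  ((mass j)%:C%C * Cintegral mu (P i) f - (mass i)%:C%C * Cintegral mu (P j) f).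
Proof.
rewrite /d_op OmE OmegaE_E => -[Lf Lg [u [w [uw uf wg]]]] ij.
have {}uw n : exists m, [/\ (up_lvl P <= m)%N, lvl_const Om m (u n) &
    w n = d_formula alpha (u n)].
  have [/locally_constantV_lvl[m um] ->] := uw n.
  exists (maxn m (up_lvl P)); split; rewrite ?leq_maxr//.
  exact: (lvl_const_mono p_prime (leq_maxl _ _) um).
have Lu n : L2 mu (dom_set Om) (u n) by have [m [_ um _]] := uw n; exact: lvl_const_L2 um.
have Lw n : L2 mu2 Om2 (w n).
  by have [m [_ um ->]] := uw n; exact: lvl_const2_L2 (d_formula_lvl um).
have cu k : Ccvg (fun n => Cintegral mu (P k) (u n)) (Cintegral mu (P k) f).
  by move=> b; apply: (L2_cvg_Cint (D := dom_set Om)) => //; [exact: measurable_up|exact: up_subset].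
have cw : Ccvg (fun n => Cintegral mu2 (P i `*` P j) (w n))
    (Cintegral mu2 (P i `*` P j) g).
  move=> b; apply: (L2_cvg_Cint (D := Om2)) => //.
    by apply: measurableX; exact: measurable_up.
  by apply: setSX; exact: up_subset.
have cr : Ccvg (fun n => (ker i j / 2)%:C%C *
    ((mass j)%:C%C * Cintegral mu (P i) (u n) - (mass i)%:C%C * Cintegral mu (P j) (u n)))
    ((ker i j / 2)%:C%C *
    ((mass j)%:C%C * Cintegral mu (P i) f - (mass i)%:C%C * Cintegral mu (P j) f)).
  by apply: CcvgZ; apply: CcvgB; exact: CcvgZ.
apply: (Ccvg_unique cw cr).
by apply/funext => n; have [m [Pm um ->]] := uw n; exact: d_weak_lvl um ij.
Qed.

Lemma delta_weak h f i : delta_op mu holes alpha h f ->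
  Cintegral mu (P i) f = \sum_j (ker i j)%:C%C * Cintegral mu2 (P i `*` P j) h.
Proof.
rewrite /delta_op OmE OmegaE_E => -[Lh Lf [u [w [uw uf wg]]]].
have {}uw n : exists m, [/\ (up_lvl P <= m)%N, lvl_const2 Om m (u n), anti (u n) &
    w n = delta_formula mu holes alpha (u n)].
  have [/locally_constantE_lvl[m um] /antisymmetricE ua ->] := uw n.
  exists (maxn m (up_lvl P)); split; rewrite ?leq_maxr//.
  exact: (lvl_const2_mono p_prime (leq_maxl _ _) um).
have Lu n : L2 mu2 Om2 (u n) by have [m [_ um _ _]] := uw n; exact: lvl_const2_L2 um.
have Lw n : L2 mu (dom_set Om) (w n).
  by have [m [_ um ua ->]] := uw n; exact: lvl_const_L2 (delta_formula_lvl um ua).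
have cw : Ccvg (fun n => Cintegral mu (P i) (w n)) (Cintegral mu (P i) f).
  by move=> b; apply: (L2_cvg_Cint (D := dom_set Om)) => //; [exact: measurable_up|exact: up_subset].
have cu j : Ccvg (fun n => Cintegral mu2 (P i `*` P j) (u n))
    (Cintegral mu2 (P i `*` P j) h).
  move=> b; apply: (L2_cvg_Cint (D := Om2)) => //.
    by apply: measurableX; exact: measurable_up.
  by apply: setSX; exact: up_subset.
have cr : Ccvg (fun n => \sum_j (ker i j)%:C%C * Cintegral mu2 (P i `*` P j) (u n))
    (\sum_j (ker i j)%:C%C * Cintegral mu2 (P i `*` P j) h).
  by apply: Ccvg_sum => j _; exact: CcvgZ.
apply: (Ccvg_unique cw cr).
by apply/funext => n; have [m [Pm um ua ->]] := uw n; exact: delta_weak_lvl um ua.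
Qed.

(** The weight of the edge between two pieces in the graph Laplacian that
    [D_op] induces on the averages over the pieces. *)
Definition wt i j : R := ker i j ^+ 2 / 2.

Lemma wt_ge0 i j : 0 <= wt i j.
Proof. by rewrite divr_ge0// sqr_ge0. Qed.

Lemma wt_gt0 i j : i != j -> 0 < wt i j.
Proof. by move=> ij; rewrite divr_gt0// exprn_gt0// ker_gt0. Qed.

Lemma wt_sym i j : wt i j = wt j i.
Proof. by rewrite /wt ker_sym. Qed.

Lemma wt_diag i : wt i i = 0.
Proof. by rewrite /wt ker_diag expr0n mul0r. Qed.

Lemma D_weak f g i : D_op mu holes alpha f g ->
  Cintegral mu (P i) g = \sum_j (wt i j)%:C%C *
  ((mass j)%:C%C * Cintegral mu (P i) f - (mass i)%:C%C * Cintegral mu (P j) f).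
Proof.
rewrite /D_op OmE => -[Lf Lg [u [w [uw uf wg]]]].
have {}uw n : exists m, [/\ (up_lvl P <= m)%N, lvl_const Om m (u n) &
    w n = delta_formula mu holes alpha (d_formula alpha (u n))].
  have [/locally_constantV_lvl[m um] ->] := uw n.
  exists (maxn m (up_lvl P)); split; rewrite ?leq_maxr//.
  exact: (lvl_const_mono p_prime (leq_maxl _ _) um).
have da n : anti (d_formula alpha (u n)) by move=> x y _ _; exact: d_formula_anti.
have Lu n : L2 mu (dom_set Om) (u n) by have [m [_ um _]] := uw n; exact: lvl_const_L2 um.
have Lw n : L2 mu (dom_set Om) (w n).
  have [m [_ um ->]] := uw n.
  exact: lvl_const_L2 (delta_formula_lvl (d_formula_lvl um) (da n)).
have cu k : Ccvg (fun n => Cintegral mu (P k) (u n)) (Cintegral mu (P k) f).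
  by move=> b; apply: (L2_cvg_Cint (D := dom_set Om)) => //; [exact: measurable_up|exact: up_subset].
have cw : Ccvg (fun n => Cintegral mu (P i) (w n)) (Cintegral mu (P i) g).
  by move=> b; apply: (L2_cvg_Cint (D := dom_set Om)) => //; [exact: measurable_up|exact: up_subset].
have cr : Ccvg (fun n => \sum_j (wt i j)%:C%C * ((mass j)%:C%C *
    Cintegral mu (P i) (u n) - (mass i)%:C%C * Cintegral mu (P j) (u n)))
    (\sum_j (wt i j)%:C%C * ((mass j)%:C%C *
    Cintegral mu (P i) f - (mass i)%:C%C * Cintegral mu (P j) f)).
  by apply: Ccvg_sum => j _; apply: CcvgZ; apply: CcvgB; exact: CcvgZ.
apply: (Ccvg_unique cw cr).
apply/funext => n; have [m [Pm um ->]] := uw n.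
rewrite (delta_weak_lvl _ Pm (d_formula_lvl um) (da n)).
apply: eq_bigr => j _; have [<-|ij] := eqVneq i j.
  by rewrite ker_diag wt_diag !mul0r.
by rewrite (d_weak_lvl Pm um ij) mulrA -rmorphM/= /wt expr2 mulrA.
Qed.

(** ** Functions that are constant on the pieces *)

Definition up_step (a : I -> R[i]) (x : Q) : R[i] :=
  \sum_i (if `[< P i x >] then a i else 0).

Lemma up_stepE a i x : P i x -> up_step a x = a i.
Proof.
move=> ix; rewrite /up_step (bigD1 i)//= big1 ?addr0; first by case: asboolP.
move=> j ji; case: asboolP => // jx; by rewrite (up_disj jx ix) eqxx in ji.
Qed.

Lemma up_const_lvl (f : Q -> R[i]) (a : I -> R[i]) :
  (forall i x, P i x -> f x = a i) -> lvl_const Om (up_lvl P) f.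
Proof.
move=> fa x y Ox xy; have [i ix] := up_cover P Ox.
by rewrite (fa i x)// (fa i y)//; exact: up_stable xy.
Qed.

Lemma up_const2_lvl (h : Q * Q -> R[i]) (b : I -> I -> R[i]) :
  (forall i j x y, P i x -> P j y -> h (x, y) = b i j) ->
  lvl_const2 Om (up_lvl P) h.
Proof.
move=> hb x x' y y' Ox Oy xx yy; have [i ix] := up_cover P Ox; have [j jy] := up_cover P Oy.
by rewrite (hb i j x y)// (hb i j x' y')//; [exact: up_stable xx|exact: up_stable yy].
Qed.

Lemma up_const2_anti (h : Q * Q -> R[i]) (b : I -> I -> R[i]) :
  (forall i j x y, P i x -> P j y -> h (x, y) = b i j) ->
  (forall i j, b i j = - b j i) -> anti h.
Proof.
move=> hb ba x y Ox Oy; have [i ix] := up_cover P Ox; have [j jy] := up_cover P Oy.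
by rewrite (hb i j x y)// (hb j i y x).
Qed.

Lemma Cint_up_const (f : Q -> R[i]) (a : I -> R[i]) :
  (forall i x, P i x -> f x = a i) ->
  Cintegral mu (dom_set Om) f = \sum_i (mass i)%:C%C * a i.
Proof.
move=> fa; rewrite (@Cint_step _ _ _ mu _ _ (fun i => P i) _ _ _ _ _ f a) => //.
- by apply: eq_bigr => i _; rewrite setIidr//; exact: up_subset.
- exact: measurable_up.
- by move=> x; exact: up_cover.
- by move=> i j x _; exact: up_disj.
- by move=> i x _; exact: fa.
Qed.

Lemma delta_formula_up (h : Q * Q -> R[i]) (b : I -> I -> R[i]) i x :
  (forall i j x y, P i x -> P j y -> h (x, y) = b i j) ->
  (forall i j, b i j = - b j i) -> P i x ->
  delta_formula mu holes alpha h x =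
  \sum_j (mass j)%:C%C * ((ker i j)%:C%C * b i j).
Proof.
move=> hb ba ix; rewrite /delta_formula OmE.
have bii : b i i = 0.
  by have /eqP := ba i i; rewrite -addr_eq0 -mulr2n mulrn_eq0/= => /eqP.
apply: Cint_up_const => j y jy; rewrite (hb i j)// mulrC.
have [<-|ij] := eqVneq i j; first by rewrite bii !mulr0.
by rewrite (ker_up ij ix jy).
Qed.

Lemma d_formula_up (f : Q -> R[i]) (a : I -> R[i]) i j x y :
  (forall i x, P i x -> f x = a i) -> P i x -> P j y ->
  d_formula alpha f (x, y) = (ker i j / 2)%:C%C * (a i - a j).
Proof.
move=> fa ix jy; rewrite d_formulaE (fa i x)// (fa j y)//.
have [<-|ij] := eqVneq i j; first by rewrite subrr !mulr0.
by rewrite (ker_up ij ix jy).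
Qed.

Lemma D_formula_up (f : Q -> R[i]) (a : I -> R[i]) i x :
  (forall i x, P i x -> f x = a i) -> P i x ->
  delta_formula mu holes alpha (d_formula alpha f) x =
  \sum_j (wt i j)%:C%C * ((mass j)%:C%C * (a i - a j)).
Proof.
move=> fa ix; rewrite (@delta_formula_up _ (fun i j => (ker i j / 2)%:C%C * (a i - a j)) i)//.
- apply: eq_bigr => j _; rewrite mulrCA; rewrite [X in _ * X]mulrCA mulrA -rmorphM/=.
  by congr (_%:C%C * _); rewrite /wt expr2 mulrA.
- by move=> {ix} j k {}x y jx ky; exact: d_formula_up.
- by move=> j k; rewrite ker_sym -mulrN opprB.
Qed.

Lemma D_op_up (f g : Q -> R[i]) (a : I -> R[i]) :
  (forall i x, P i x -> f x = a i) ->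
  (forall i x, P i x -> g x = \sum_j (wt i j)%:C%C * ((mass j)%:C%C * (a i - a j))) ->
  D_op mu holes alpha f g.
Proof.
move=> fa ga; apply: (D_op_lvl (up_const_lvl fa)) => x Ox.
by have [i ix] := up_cover P Ox; rewrite (ga i x ix) (D_formula_up fa ix).
Qed.

End partition.

End operators.

(** * Finite weighted graph Laplacians *)

Section laplacian.
Context (R : realType) (I : finType) (w : I -> I -> R).
Hypotheses (w_sym : forall i j, w i j = w j i) (w_ge0 : forall i j, 0 <= w i j).
Implicit Type a : I -> R.

Lemma laplacian_energy a : \sum_i a i * (\sum_j w i j * (a i - a j)) =
  (\sum_i \sum_j w i j * (a i - a j) ^+ 2) / 2.
Proof.
set S := LHS; have S1 : S = \sum_i \sum_j w i j * (a i * (a i - a j)).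
  by apply: eq_bigr => i _; rewrite mulr_sumr; apply: eq_bigr => j _; ring.
have S2 : S = \sum_i \sum_j w i j * (a j * (a j - a i)).
  rewrite S1 exchange_big; apply: eq_bigr => i _; apply: eq_bigr => j _.
  by rewrite w_sym.
apply: (@mulIf _ 2%:R); rewrite ?pnatr_eq0// divfK ?pnatr_eq0//.
rewrite mulr_natr mulr2n {1}S1 S2 -big_split/=; apply: eq_bigr => i _.
by rewrite -big_split/=; apply: eq_bigr => j _; ring.
Qed.

Lemma laplacian_ge0 a : 0 <= \sum_i a i * (\sum_j w i j * (a i - a j)).
Proof.
rewrite laplacian_energy divr_ge0// sumr_ge0// => i _.
by apply: sumr_ge0 => j _; rewrite mulr_ge0// sqr_ge0.
Qed.

(** A harmonic vector has zero energy, and the energy is a sum of squares. *)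
Lemma laplacian_harmonic a i j : (forall i, \sum_j w i j * (a i - a j) = 0) ->
  0 < w i j -> a i = a j.
Proof.
move=> a0 wij; have := laplacian_energy a.
rewrite big1; last by move=> k _; rewrite a0 mulr0.
move=> /esym/eqP; rewrite mulf_eq0 invr_eq0 pnatr_eq0 orbF.
rewrite psumr_eq0 => [/allP/(_ i (mem_index_enum _))|k _]; last first.
  by apply: sumr_ge0 => l _; rewrite mulr_ge0// sqr_ge0.
rewrite psumr_eq0 => [/allP/(_ j (mem_index_enum _))|k _]; last first.
  by rewrite mulr_ge0// sqr_ge0.
by rewrite mulf_eq0 gt_eqF//= sqrf_eq0 subr_eq0 => /eqP.
Qed.

End laplacian.

(** Spectral gap: if the weight between different blocks depends on the blocks
    only, then on vectors that sum to zero over each block the Laplacian is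
    the sum of the block Laplacians, which are nonnegative, and of
    multiplication by the total weight leaving the block. *)
Lemma laplacian_gap (R : realType) (I J : finType) (w : I -> I -> R)
    (blk : I -> J) (a : I -> R) (lam L : R) :
  (forall i j, w i j = w j i) -> (forall i j, 0 <= w i j) ->
  (forall b, \sum_(i | blk i == b) a i = 0) ->
  (forall i j k, blk j = blk k -> blk i != blk j -> w i j = w i k) ->
  (forall i, L <= \sum_(j | blk j != blk i) w i j) ->
  (forall i, lam * a i = \sum_j w i j * (a i - a j)) ->
  lam < L -> forall i, a i = 0.
Proof.
move=> w_sym w_ge0 a0 wblk wL alam lamL.
pose w' i j := if blk i == blk j then w i j else 0.
have sm : \sum_i a i * (lam * a i) = \sum_i a i * (\sum_j w' i j * (a i - a j)) +
    \sum_i a i ^+ 2 * \sum_(j | blk j != blk i) w i j.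
  rewrite -big_split/=; apply: eq_bigr => i _; rewrite alam expr2 -mulrA -mulrDr.
  congr (_ * _); rewrite (bigID (fun j => blk j == blk i))/=; congr (_ + _).
    rewrite big_mkcond/=; apply: eq_bigr => j _; rewrite /w' eq_sym.
    by case: ifP => // _; rewrite mul0r.
  under eq_bigr do rewrite mulrBr; rewrite sumrB -mulr_suml mulrC.
  rewrite [X in _ - X](_ : _ = 0) ?subr0//.
  rewrite (partition_big blk (fun b => b != blk i))//=.
  rewrite big1// => b bi; have [j /eqP jb|nob] := pickP (fun j => blk j == b).
    rewrite (eq_bigr (fun k => w i j * a k)); last first.
      move=> k /andP[ki /eqP kb]; rewrite (wblk i k j)//; first by rewrite kb jb.
      by rewrite eq_sym.
    rewrite -mulr_sumr (eq_bigl (fun k => blk k == b)) ?a0 ?mulr0// => k.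
    by have [->|] := eqVneq (blk k) b; rewrite ?bi ?andbF.
  by rewrite big1// => k /andP[_ kb]; rewrite nob in kb.
have w'_sym i j : w' i j = w' j i by rewrite /w' eq_sym w_sym.
have w'_ge0 i j : 0 <= w' i j by rewrite /w'; case: ifP.
have h : \sum_i (L - lam) * a i ^+ 2 <= 0.
  rewrite -subr_ge0 sub0r -sumrN.
  have := laplacian_ge0 w'_sym w'_ge0 a => /le_trans; apply.
  rewrite -[leLHS](addrK (\sum_i a i ^+ 2 * \sum_(j | blk j != blk i) w i j)) -sm.
  rewrite -sumrB; apply: ler_sum => i _.
  have -> : - ((L - lam) * a i ^+ 2) = a i * (lam * a i) - a i ^+ 2 * L by ring.
  by rewrite lerD2l lerN2 ler_wpM2l ?sqr_ge0.
have h0 : \sum_i (L - lam) * a i ^+ 2 = 0.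
  apply/eqP; rewrite eq_le h sumr_ge0// => i _.
  by rewrite mulr_ge0 ?sqr_ge0// subr_ge0 ltW.
move=> i; move/eqP: h0; rewrite psumr_eq0 => [/allP/(_ i (mem_index_enum _))|k _]; last first.
  by rewrite mulr_ge0 ?sqr_ge0// subr_ge0 ltW.
by rewrite mulf_eq0 subr_eq0 gt_eqF//= sqrf_eq0 => /eqP.
Qed.

(** * Heat traces *)

Section heat_trace.
Context (R : realType).
Implicit Types (I : set nat) (lam a : nat -> R).

Lemma esum_le_seq I a (C : R) :
  (forall s : seq nat, uniq s -> (forall i, i \in s -> I i) ->
    \sum_(i <- s) a i <= C) ->
  (\esum_(i in I) (a i)%:E <= C%:E)%E.
Proof.
move=> h; apply: ub_ereal_sup => _ [F [finF FI] <-].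
rewrite fsbig_finite//= sumEFin lee_fin; apply: h; first exact: finmap.fset_uniq.
by move=> i; rewrite in_fset_set// => /set_mem; exact: FI.
Qed.

Lemma esum_card1 I n : (I #= `I_n)%card ->
  (\esum_(i in I) 1%:E = n%:R%:E :> \bar R)%E.
Proof.
move=> In; have finI : finite_set I by apply/finite_setP; exists n.
by rewrite finite_card_sum// (card_fset_set In).
Qed.

(** The terms with eigenvalue zero contribute [n]; after the time [t0] the
    others decrease at least as fast as [expR (- lm * (t - t0))]. *)
Lemma heat_trace_cvg I lam n (C t0 lm : R) : 0 < lm ->
  (I `&` [set i | lam i = 0] #= `I_n)%card ->
  (forall i, I i -> lam i <> 0 -> lm <= lam i) ->
  (forall s : seq nat, uniq s -> (forall i, i \in s -> I i /\ lam i <> 0) ->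
    \sum_(i <- s) expR (- lam i * t0) <= C) ->
  (\esum_(i in I) (expR (- lam i * t))%:E)%E @[t --> +oo] --> (n%:R%:E : \bar R).
Proof.
move=> lm0 In Ilm IC.
pose Z := [set i | lam i = 0].
pose T t := (\esum_(i in I `&` ~` Z) (expR (- lam i * t))%:E)%E.
have ge0 t i : (0 <= (expR (- lam i * t))%:E :> \bar R)%E by rewrite lee_fin expR_ge0.
have split_t t : (\esum_(i in I) (expR (- lam i * t))%:E = n%:R%:E + T t)%E.
  rewrite (esumID Z)//; congr (_ + _)%E.
  rewrite -(esum_card1 In); apply: eq_esum => i [_ ->].
  by rewrite oppr0 mul0r expR0.
suff T0 : T t @[t --> +oo] --> 0%E.
  rewrite (_ : (fun t => _) = (fun t => n%:R%:E + T t)%E); last first.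
    by apply/funext => t; exact: split_t.
  rewrite -[X in _ --> X]adde0; apply: cvgeD => //; exact: cvg_cst.
have C0 : 0 <= C by have := IC [::] isT; rewrite big_nil; apply.
have T_le t : t0 <= t -> (T t <= (C * expR (- (lm * (t - t0))))%:E)%E.
  move=> tt; apply: esum_le_seq => s us sI.
  have sI' i : i \in s -> I i /\ lam i <> 0 by move=> /sI[].
  apply: (@le_trans _ _ (\sum_(i <- s) expR (- lam i * t0) * expR (- (lm * (t - t0))))).
    rewrite big_seq [leRHS]big_seq; apply: ler_sum => i /sI'[Ii li].
    rewrite -expRD ler_expR.
    have := Ilm i Ii li; rewrite -subr_ge0 => h.
    have := mulr_ge0 h (_ : 0 <= t - t0); rewrite subr_ge0 => /(_ tt); lra.
  rewrite -mulr_suml ler_wpM2r ?expR_ge0//; exact: IC.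
apply: (@squeeze_cvge _ _ _ _ (fun=> 0%E) _ (fun t => (C * expR (- (lm * (t - t0))))%:E)).
- near=> t; apply/andP; split; first exact: esum_ge0.
  by apply: T_le; near: t; exact: (nbhs_pinfty_ge (num_real _)).
- exact: cvg_cst.
- apply: cvg_EFin; first by near=> t.
  rewrite -[X in _ --> X](mulr0 C); apply: cvgM; first exact: cvg_cst.
  have h : lm * (t - t0) @[t --> +oo] --> +oo.
    apply/cvgryPge => A; near=> t.
    rewrite -ler_pdivrMl// lerBrDr; near: t; exact: (nbhs_pinfty_ge (num_real _)).
  exact: (cvg_comp _ _ h (@cvgr_expR R)).
Unshelve. all: by end_near.
Qed.

Lemma seq_pos_lower_bound (s : seq nat) lam :
  exists2 lm : R, 0 < lm & forall i, i \in s -> 0 < lam i -> lm <= lam i.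
Proof.
elim: s => [|i s [lm lm0 h]]; first by exists 1.
have [li|li] := ltP 0 (lam i).
  exists (Num.min lm (lam i)); first by rewrite lt_min lm0.
  move=> j; rewrite inE => /orP[/eqP->|js] lj; rewrite ge_min ?lexx ?orbT//.
  by rewrite h.
exists lm => // j; rewrite inE => /orP[/eqP->|/h//].
by rewrite ltNge li.
Qed.

(** Values [n] of [k] that are taken at most [A * q ^ n] times contribute at
    most [A / 2 ^ n]. *)
Lemma sum_geometric_le (s : seq nat) (k : nat -> nat) (q A : nat) : (0 < q)%N ->
  (forall n, (count (fun i => k i == n) s <= A * q ^ n)%N) ->
  \sum_(i <- s) (2 * q%:R) ^- k i <= 2 * A%:R :> R.
Proof.
move=> q0 kA; pose K := (\max_(i <- s) k i).+1.
have q0' : q%:R != 0 :> R by rewrite pnatr_eq0 -lt0n.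
have -> : \sum_(i <- s) (2 * q%:R) ^- k i =
    \sum_(n < K) (2 * q%:R) ^- n * (count (fun i => k i == n) s)%:R :> R.
  transitivity (\sum_(i <- s) \sum_(n < K | k i == n) (2 * q%:R) ^- n : R).
    rewrite big_seq [RHS]big_seq; apply: eq_bigr => i si.
    have kK : (k i < K)%N by rewrite ltnS; exact: leq_bigmax_seq.
    by rewrite (big_pred1 (Ordinal kK)).
  rewrite (exchange_big_dep xpredT)//=; apply: eq_bigr => n _.
  by rewrite big_const_seq iter_addr addr0 [RHS]mulr_natr.
apply: (@le_trans _ _ (\sum_(n < K) A%:R * 2^-1 ^+ n)).
  apply: ler_sum => n _; rewrite exprMn invfM -exprVn [leLHS]mulrAC.
  rewrite [leRHS]mulrC -mulrA ler_wpM2l ?exprn_ge0 ?invr_ge0//.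
  rewrite ler_pdivrMr ?exprn_gt0 ?ltr0n//.
  by rewrite -natrX -natrM ler_nat.
rewrite -mulr_sumr mulrC ler_wpM2r//.
suff -> : \sum_(n < K) 2^-1 ^+ n = 2 - 2 * 2^-1 ^+ K :> R.
  by rewrite gerBl mulr_ge0 ?exprn_ge0 ?invr_ge0.
elim: K => [|K IH]; first by rewrite big_ord0 expr0; lra.
by rewrite big_ord_recr/= IH exprS; lra.
Qed.

End heat_trace.

(** * Spectrum of the operator on functions *)

Section vertex_operator.
Context (p : nat) (p_prime : prime p) (R : realType) (K : padicField p R).
Variable mu : {sigma_finite_measure set (Qp K) -> \bar R}.
Hypothesis mu_haar : is_haar mu.
Variable Om : clopen_domain K.
Variable holes : set (set (Qp K)).
Hypothesis OmE : OmegaV holes = dom_set Om.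
Variable alpha : R.
Hypothesis alpha_gt0 : 0 < alpha.
Hypothesis Om_neq0 : exists x, Om x.
Local Notation Q := (Qp K).
Local Notation c := (dom_ctr Om).
Local Notation M := (dom_num Om).
Local Notation rad := (rad Om).
Local Notation LP n := (level_partition p_prime Om n).
Local Notation lball n i := (pball (c n i) (rad n)).

Let mO := measurable_dom p_prime Om.
Let fO := mu_dom_lty p_prime mu_haar Om.

Lemma lball_sub n i : lball n i `<=` dom_set Om.
Proof. exact: (@up_subset _ _ _ _ _ (LP n) i). Qed.

Lemma mass_lball n i : mass mu (LP n) i = rad n.
Proof. by rewrite /mass/= mu_lball. Qed.

Lemma L2_Cintble_dom f : L2 mu (dom_set Om) f -> Cintble mu (dom_set Om) f.
Proof. exact: L2_Cintble. Qed.

(** Averages over a clopen set are sums of averages over small discs. *)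
Lemma Cint_sum_lball (A : set Q) n f : Cintble mu (dom_set Om) f ->
  A `<=` dom_set Om -> (forall x y, A x -> absp (x - y) <= rad n -> A y) ->
  Cintegral mu A f = \sum_(i | `[< A (c n i) >]) Cintegral mu (lball n i) f.
Proof.
move=> Lf AO Ast; have mA := measurable_stable p_prime Ast.
pose s := [seq i <- index_enum 'I_(M n) | `[< A (c n i) >]].
have AE : A = \big[setU/set0]_(i <- s) lball n i.
  rewrite -bigcup_seq; apply/seteqP; split => [x Ax|x [i /=]].
    have [i ix] := lball_cover p_prime n (AO _ Ax).
    exists i => //=; rewrite mem_filter mem_index_enum andbT; apply/asboolP.
    by apply: Ast Ax _; rewrite absp_distC.
  by rewrite mem_filter => /andP[/asboolP Ai _]; exact: Ast.
apply: part_eq => b; rewrite part_sum part_Cint.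
under eq_bigr do rewrite part_Cint.
have iA : mu.-integrable A (EFin \o (fun x => part b (f x))).
  by apply: (integrableS mO mA AO); exact: Lf.
rewrite /Rintegral {1}AE (@integral_bigsetU_EFin _ _ _ mu _ (fun i => lball n i))//=.
- rewrite big_filter -sum_fine//= => i _.
  apply: integrable_fin_num; first exact: measurable_lball.
  apply: (integrableS mO) (Lf b); first exact: measurable_lball.
  exact: lball_sub.
- by move=> i; exact: measurable_lball.
- by rewrite filter_uniq// index_enum_uniq.
- by move=> i j _ _ [x [ix jx]]; exact: (lball_disj p_prime ix jx).
- by rewrite -AE; exact: measurable_int iA.
Qed.

Lemma Cint_dom n f : Cintble mu (dom_set Om) f ->
  Cintegral mu (dom_set Om) f = \sum_i Cintegral mu (lball n i) f.
Proof.
move=> Lf; rewrite (@Cint_sum_lball _ n)//.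
  by apply: eq_bigl => i; apply/asboolP; exact: dom_ctr_in.
by move=> x y; exact: dom_stable_rad.
Qed.

Lemma lball_stable m n i x y : (m <= n)%N -> lball m i x ->
  absp (x - y) <= rad n -> lball m i y.
Proof.
move=> mn ix xy; apply: absp_dist_le ix _; rewrite (le_trans xy)//.
exact: le_rad.
Qed.

Lemma Cint_children m n i f : (m <= n)%N -> Cintble mu (dom_set Om) f ->
  Cintegral mu (lball m i) f =
  \sum_(k | `[< lball m i (c n k) >]) Cintegral mu (lball n k) f.
Proof.
move=> mn Lf; apply: (Cint_sum_lball Lf); first exact: lball_sub.
by move=> x y; exact: lball_stable.
Qed.

Lemma L2_Cintble_lball n i f : L2 mu (dom_set Om) f -> Cintble mu (lball n i) f.
Proof.
by move=> Lf; apply: (L2_Cintble mO fO) Lf; [exact: measurable_lball|exact: lball_sub].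
Qed.

Lemma num_gt0 n : (0 < M n)%N.
Proof.
have [x Ox] := Om_neq0; have [i _] := dom_ctr_cover n Ox.
exact: leq_ltn_trans (leq0n _) (ltn_ord i).
Qed.

Lemma mu_dom_gt0 : 0 < fine (mu (dom_set Om)).
Proof.
by rewrite (mu_dom p_prime mu_haar Om 0)/= mulr_gt0 ?rad_gt0// ltr0n num_gt0.
Qed.

Lemma rad_neq0 n : (rad n)%:C%C != 0 :> R[i].
Proof. by rewrite fmorph_eq0 gt_eqF// rad_gt0. Qed.

Lemma Cint_lball_cst n i (z : R[i]) :
  Cintegral mu (lball n i) (fun=> z) = z * (rad n)%:C%C.
Proof.
rewrite Cint_cst; last exact: measurable_lball.
by congr (_ * _%:C%C); exact: (congr1 fine (mu_lball p_prime mu_haar Om n (c n i))).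
Qed.

(** The difference with the mean value has zero averages over all discs. *)
Lemma const_of_lball f : L2 mu (dom_set Om) f ->
  (forall n i j, Cintegral mu (lball n i) f = Cintegral mu (lball n j) f) ->
  exists z, eq_ae mu (dom_set Om) f (fun=> z).
Proof.
move=> Lf fE; pose V := (fine (mu (dom_set Om)))%:C%C : R[i].
have V0 : V != 0 by rewrite fmorph_eq0 gt_eqF// mu_dom_gt0.
pose z := Cintegral mu (dom_set Om) f / V; exists z.
have Lz : L2 mu (dom_set Om) (fun=> z) by exact: L2_cst.
have Lfz := L2B mO Lf Lz.
have : eq_ae mu (dom_set Om) (fun x => f x - z) (fun=> 0).
  apply: (lball_null p_prime mu_haar Lfz) => n i.
  rewrite CintB; [|exact: measurable_lball|exact: L2_Cintble_lball|exact: L2_Cintble_lball].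
  rewrite Cint_lball_cst /z (Cint_dom n (L2_Cintble_dom Lf)) (eq_bigr (fun=> Cintegral mu (lball n i) f)).
    have VE : V = (M n)%:R * (rad n)%:C%C.
      by rewrite /V (mu_dom p_prime mu_haar Om n)/= rmorphM/= rmorph_nat.
    rewrite sumr_const card_ord -mulr_natl -[X in X - _](mulfK V0).
    by rewrite [X in _ * X / _ - _]VE; ring.
  by move=> j _; exact: fE.
by apply: filterS => x h Ox; apply/eqP; rewrite -subr_eq0 h.
Qed.

(** Shared by the kernel of [d] and the zero eigenspace of [D]. *)
Lemma has_dim_const (S : set (Q -> R[i])) : S (fun=> 1) ->
  (forall f, S f -> L2 mu (dom_set Om) f) ->
  (forall f, S f -> forall n i j,
     Cintegral mu (lball n i) f = Cintegral mu (lball n j) f) ->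
  has_dim mu (dom_set Om) S 1.
Proof.
move=> S1 SL2 Savg; exists (fun=> fun=> 1); split => // [a a0 i|f Sf].
  have : Cintegral mu (dom_set Om) (fun x => \sum_(i < 1) a i * 1) = 0.
    rewrite (Cint_ae (D := dom_set Om) _ _ _ _ _ a0)// ?Cint0//; exact: L2_cst.
  rewrite Cint_cst// big_ord1 mulr1 => /eqP; rewrite mulf_eq0 fmorph_eq0.
  by rewrite (gt_eqF mu_dom_gt0) orbF (ord1 i) => /eqP.
have [z fz] := const_of_lball (SL2 f Sf) (Savg f Sf).
exists (fun=> z); apply: filterS fz => x h Ox; rewrite h// big_ord1 mulr1.
by [].
Qed.

Lemma ker_d_dim : has_dim mu (dom_set Om) [set f | d_op mu holes alpha f (fun=> 0)] 1.
Proof.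
apply: has_dim_const => [|f [+ _ _]|f df n i j].
- apply: (d_op_lvl p_prime mu_haar OmE (n := 0)) => // z _.
  by rewrite /d_formula subrr mul0r.
- by rewrite OmE.
- have [->//|ij] := eqVneq i j.
  have := d_weak p_prime mu_haar OmE (LP n) df ij.
  rewrite Cint0 !mass_lball -mulrBr => /esym/eqP; rewrite !mulf_eq0 (negbTE (rad_neq0 n)).
  rewrite fmorph_eq0 mulf_eq0 invr_eq0 pnatr_eq0 orbF gt_eqF/=; last exact: ker_gt0.
  by rewrite subr_eq0 => /eqP.
Qed.

(** ** Weak eigenfunctions *)

(** The averages of an eigenfunction over the discs of a given radius form an
    eigenvector of the graph Laplacian with weights [lw]. *)
Definition lw n (i j : 'I_(M n)) : R := rad n * wt alpha (LP n) i j.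
Arguments lw : clear implicits.

Lemma lw_sym n i j : lw n i j = lw n j i.
Proof. by rewrite /lw wt_sym. Qed.

Lemma lw_ge0 n i j : 0 <= lw n i j.
Proof. by rewrite mulr_ge0 ?wt_ge0// ltW// rad_gt0. Qed.

Lemma lw_gt0 n i j : i != j -> 0 < lw n i j.
Proof. by move=> ij; rewrite mulr_gt0 ?rad_gt0//; exact: wt_gt0. Qed.

(** What the eigenvalue equation says on averages. All spectral information on
    [D_op] is extracted from this condition, which avoids its domain. *)
Definition weak_eigen (lam : R) (f : Q -> R[i]) := L2 mu (dom_set Om) f /\
  forall n i, lam%:C%C * Cintegral mu (lball n i) f = \sum_j (lw n i j)%:C%C *
    (Cintegral mu (lball n i) f - Cintegral mu (lball n j) f).

Lemma D_op_weak_eigen lam f :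
  D_op mu holes alpha f (fun x => lam%:C%C * f x) -> weak_eigen lam f.
Proof.
move=> Df; have [Lf _ _] := Df; rewrite OmE in Lf; split => // n i.
rewrite -CintZ; [|exact: measurable_lball|exact: L2_Cintble_lball].
rewrite (D_weak p_prime mu_haar OmE alpha_gt0 (LP n) i Df).
apply: eq_bigr => j _; rewrite !mass_lball -mulrBr mulrA -rmorphM/=.
by rewrite mulrC -/(lw n i j) mulrC /lw [rad n * _]mulrC.
Qed.

Lemma weak_eigen_part lam f b n i : weak_eigen lam f ->
  lam * part b (Cintegral mu (lball n i) f) = \sum_j lw n i j *
    (part b (Cintegral mu (lball n i) f) - part b (Cintegral mu (lball n j) f)).
Proof.
move=> [_ /(_ n i)/(congr1 (part b))]; rewrite partZ part_sum => ->.
by apply: eq_bigr => j _; rewrite partZ partB.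
Qed.

Lemma weak_eigenB lam f g : weak_eigen lam f -> weak_eigen lam g ->
  weak_eigen lam (fun x => f x - g x).
Proof.
move=> [Lf fE] [Lg gE]; split; first exact: L2B.
move=> n i.
have BE j : Cintegral mu (lball n j) (fun x => f x - g x) =
    Cintegral mu (lball n j) f - Cintegral mu (lball n j) g.
  by apply: CintB; [exact: measurable_lball|exact: L2_Cintble_lball|exact: L2_Cintble_lball].
rewrite BE mulrBr fE gE -sumrB; apply: eq_bigr => j _.
by rewrite BE -mulrBr; congr (_ * _); ring.
Qed.

(** The averages at each radius are harmonic on a complete graph. *)
Lemma weak_eigen0_const f : weak_eigen 0 f -> forall n i j,
  Cintegral mu (lball n i) f = Cintegral mu (lball n j) f.
Proof.
move=> fE n i j; have [->//|ij] := eqVneq i j; apply: part_eq => b.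
pose a k := part b (Cintegral mu (lball n k) f).
have h : forall k, \sum_j lw n k j * (a k - a j) = 0.
  by move=> k; rewrite -(@weak_eigen_part 0 f b n k fE) mul0r.
exact: (laplacian_harmonic (@lw_sym n) (@lw_ge0 n) h (lw_gt0 ij)).
Qed.

(** The rows of the Laplacian sum to zero, so the sum of the averages is killed
    by [lam]. *)
Lemma weak_eigen_mean lam f : weak_eigen lam f -> lam != 0 ->
  Cintegral mu (dom_set Om) f = 0.
Proof.
move=> [Lf fE] lam0; rewrite (Cint_dom 0 (L2_Cintble_dom Lf)).
apply/eqP; rewrite -(mulrI_eq0 _ (lregP (_ : lam%:C%C != 0 :> R[i]))); last by rewrite fmorph_eq0.
rewrite mulr_sumr (eq_bigr _ (fun i _ => fE 0%N i)); set S := (X in X == 0).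
have : S = - S.
  rewrite /S {1}exchange_big/= -sumrN; apply: eq_bigr => i _.
  rewrite -sumrN; apply: eq_bigr => j _.
  by rewrite lw_sym -mulrN opprB.
by move/eqP; rewrite -addr_eq0 -mulr2n mulrn_eq0.
Qed.

(** For negative [lam] the energy of the averages would be negative, so they
    vanish at every radius. *)
Lemma weak_eigen_ge0 lam f : weak_eigen lam f ->
  ~ eq_ae mu (dom_set Om) f (fun=> 0) -> 0 <= lam.
Proof.
move=> fE f0; rewrite leNgt; apply/negP => lam0; apply: f0.
apply: (lball_null p_prime mu_haar) => [|n i]; first by case: fE.
apply: part_eq => b; rewrite part0; move: i.
pose a i := part b (Cintegral mu (lball n i) f).
have h : \sum_i (- lam) * a i ^+ 2 <= 0.
  rewrite -oppr_ge0 -sumrN.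
  rewrite (le_trans (laplacian_ge0 (@lw_sym n) (@lw_ge0 n) a))//.
  apply: ler_sum => i _; rewrite -(@weak_eigen_part lam f b n i fE) -/(a i).
  by rewrite (_ : - (- lam * a i ^+ 2) = a i * (lam * a i)) //; ring.
have h0 : \sum_i (- lam) * a i ^+ 2 = 0.
  apply/eqP; rewrite eq_le h sumr_ge0// => i _.
  by rewrite mulr_ge0 ?sqr_ge0// oppr_ge0 ltW.
move=> i; move/eqP: h0; rewrite psumr_eq0 => [/allP/(_ i (mem_index_enum _))|k _]; last first.
  by rewrite mulr_ge0 ?sqr_ge0// oppr_ge0 ltW.
by rewrite mulf_eq0 oppr_eq0 lt_eqF//= sqrf_eq0 => /eqP.
Qed.

(** ** Existence of an eigenbasis *)

(** The vector [v] read in the orthonormal basis of normalised indicators of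
    the discs of radius [rad n]. *)
Definition fvec n (v : 'rV[R[i]]_(M n)) : Q -> R[i] :=
  up_step (LP n) (fun i => ((Num.sqrt (rad n))^-1)%:C%C * v 0 i).

Lemma fvecE n (v : 'rV[R[i]]_(M n)) i x : lball n i x ->
  fvec v x = ((Num.sqrt (rad n))^-1)%:C%C * v 0 i.
Proof. exact: (@up_stepE _ _ _ _ _ (LP n)). Qed.

Lemma fvec_lvl n (v : 'rV[R[i]]_(M n)) : lvl_const Om n (fvec v).
Proof. exact: (up_const_lvl (P := LP n) (@fvecE n v)). Qed.

Lemma fvec_L2 n (v : 'rV[R[i]]_(M n)) : L2 mu (dom_set Om) (fvec v).
Proof. exact: (lvl_const_L2 p_prime mu_haar (@fvec_lvl n v)). Qed.

Lemma ctr_lball n i : lball n i (c n i).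
Proof. exact: (up_in (LP n) i). Qed.

Lemma rad_sqrt n : rad n * (Num.sqrt (rad n))^-1 ^+ 2 = 1.
Proof.
have r0 := rad_gt0 p_prime Om n.
by rewrite exprVn sqr_sqrtr ?ltW// mulfV// gt_eqF.
Qed.

Lemma inner_fvec n (v w : 'rV[R[i]]_(M n)) :
  inner mu (dom_set Om) (fvec v) (fvec w) = \sum_i v 0 i * conjc (w 0 i).
Proof.
rewrite /inner (Cint_up_const p_prime mu_haar (P := LP n)
  (a := fun i => ((Num.sqrt (rad n))^-1 ^+ 2)%:C%C * (v 0 i * conjc (w 0 i)))).
  apply: eq_bigr => i _; rewrite mass_lball mulrA -rmorphM/= rad_sqrt.
  by rewrite rmorph1 mul1r.
move=> i x ix; rewrite !(fvecE _ ix) conjcZ mulrACA.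
by rewrite -rmorphM/= -expr2.
Qed.

Lemma inner_fvecr n h (v : 'rV[R[i]]_(M n)) : L2 mu (dom_set Om) h ->
  inner mu (dom_set Om) h (fvec v) = ((Num.sqrt (rad n))^-1)%:C%C *
    \sum_i Cintegral mu (lball n i) h * conjc (v 0 i).
Proof.
move=> Lh; rewrite /inner (Cint_dom n); last exact: inner_Cintble (fvec_L2 v).
rewrite mulr_sumr; apply: eq_bigr => i _.
transitivity (Cintegral mu (lball n i)
    (fun x => (((Num.sqrt (rad n))^-1)%:C%C * conjc (v 0 i)) * h x)).
  apply: eq_Cint => x /set_mem ix; rewrite (fvecE v ix) conjcZ.
  by rewrite mulrC.
rewrite CintZ; [|exact: measurable_lball|exact: L2_Cintble_lball].
by rewrite -mulrA [X in _ * X]mulrC.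
Qed.

Definition lapl n : 'M[R[i]]_(M n) :=
  \matrix_(i, j) ((i == j)%:R * (\sum_k lw n i k) - lw n i j)%:C%C.

Lemma lapl_herm n i j : lapl n i j = Num.conj (lapl n j i).
Proof.
rewrite !mxE -[RHS]/(conjc _) conjc_real lw_sym eq_sym.
by have [->|] := eqVneq i j; rewrite ?mul0r.
Qed.

Lemma laplE n (v : 'rV[R[i]]_(M n)) i :
  (v *m lapl n) 0 i = \sum_j (lw n i j)%:C%C * (v 0 i - v 0 j).
Proof.
rewrite mxE (eq_bigr (fun j => (i == j)%:R * (\sum_k lw n i k)%:C%C * v 0 i -
    (lw n i j)%:C%C * v 0 j)); last first.
  move=> j _; rewrite mxE rmorphB rmorphM/= rmorph_nat mulrBr lw_sym.
  rewrite [X in _ - X]mulrC eq_sym; congr (_ - _).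
  by have [->|] := eqVneq i j; rewrite ?mul0r ?mulr0// mulrC.
rewrite sumrB (bigD1 i)//= eqxx mul1r [X in _ + X - _]big1 ?addr0; last first.
  by move=> j ji; rewrite eq_sym (negbTE ji) !mul0r.
rewrite rmorph_sum/= mulr_suml -sumrB.
by apply: eq_bigr => j _; rewrite mulrBr.
Qed.

Lemma D_op_fvec n (v : 'rV[R[i]]_(M n)) :
  D_op mu holes alpha (fvec v) (fvec (v *m lapl n)).
Proof.
apply: (D_op_up p_prime mu_haar OmE (P := LP n)
  (a := fun i => ((Num.sqrt (rad n))^-1)%:C%C * v 0 i)) => i x ix; first exact: fvecE.
rewrite (fvecE _ ix) laplE mulr_sumr; apply: eq_bigr => j _.
rewrite mass_lball -mulrBr [RHS]mulrA -rmorphM/= [wt _ _ _ _ * _]mulrC -/(lw n i j).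
by rewrite mulrCA.
Qed.

(** Multiplication by this matrix adds up the coordinates over the discs of
    level [n.+1] inside each disc of level [n]. *)
Definition children n : 'M[R[i]]_(M n.+1, M n) :=
  \matrix_(i, b) (`[< lball n b (c n.+1 i) >])%:R.

Lemma Cint_fvec n b (v : 'rV[R[i]]_(M n.+1)) :
  Cintegral mu (lball n b) (fvec v) =
  (rad n.+1 * (Num.sqrt (rad n.+1))^-1)%:C%C * (v *m children n) 0 b.
Proof.
rewrite (Cint_up p_prime mu_haar (P := LP n) (n := n.+1) b (leqnSn n) (@fvec_lvl _ v)).
rewrite rmorphM/= -mulrA; congr (_ * _); rewrite mxE mulr_sumr big_mkcond/=.
apply: eq_bigr => i _; rewrite mxE (fvecE v (ctr_lball i)).
by case: ifP; rewrite ?mulr1 ?mulr0.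
Qed.

(** The averages of [D_op f] at level [n] depend only on those of [f]. *)
Lemma children_lapl n (v : 'rV[R[i]]_(M n.+1)) : v *m children n = 0 ->
  v *m lapl n.+1 *m children n = 0.
Proof.
move=> v0; apply/rowP => b; rewrite [RHS]mxE.
have r0 : (rad n.+1 * (Num.sqrt (rad n.+1))^-1)%:C%C != 0 :> R[i].
  by rewrite fmorph_eq0 gt_eqF// divr_gt0// ?sqrtr_gt0 ?rad_gt0.
have v0' d : Cintegral mu (lball n d) (fvec v) = 0 by rewrite Cint_fvec v0 mxE mulr0.
apply: (mulfI r0); rewrite mulr0 -Cint_fvec.
rewrite (D_weak p_prime mu_haar OmE alpha_gt0 (LP n) b (D_op_fvec v)).
by rewrite big1// => d _; rewrite /= !v0' !mulr0 subrr mulr0.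
Qed.

(** The vectors at level [n] that are new, i.e. orthogonal to level [n.-1]. *)
Definition newmx n : 'M[R[i]]_(M n) :=
  if n is m.+1 then kermx (children m) else 1%:M.

Lemma newmx_stable n : (newmx n *m lapl n <= newmx n)%MS.
Proof.
case: n => [|n]; first exact: submx1.
apply/sub_kermxP; rewrite /newmx; move: (kermx _) (mulmx_ker (children n)) => W WK.
apply/row_matrixP => i; rewrite !row_mul row0.
by apply: children_lapl; rewrite -row_mul WK row0.
Qed.

Lemma newmx_eigen n : exists (x : {r & 'M[R[i]]_(r, M n) * ('I_r -> R)}%type),
  [/\ (projT2 x).1 *m (map_mx Num.conj (projT2 x).1^T) = 1%:M,
      ((projT2 x).1 :=: newmx n)%MS &
      forall i, row i (projT2 x).1 *m lapl n =
        ((projT2 x).2 i)%:C%C *: row i (projT2 x).1].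
Proof.
have [r [E [lam [E1 E2 E3 lamr]]]] :=
  hermitian_stable_eigenbasis (@lapl_herm n) (newmx_stable n).
exists (existT _ r (E, fun i => complex.Re (lam i))); split => //= i.
by rewrite E3 RRe_real.
Qed.

Section eigenbasis.
Variable X : forall n, {r & 'M[R[i]]_(r, M n) * ('I_r -> R)}%type.
Local Notation r n := (projT1 (X n)).
Local Notation E n := (projT2 (X n)).1.
Local Notation lam n := (projT2 (X n)).2.
Hypotheses (XE1 : forall n, E n *m (map_mx Num.conj (E n)^T) = 1%:M)
  (XE2 : forall n, (E n :=: newmx n)%MS)
  (XE3 : forall n i, row i (E n) *m lapl n = (lam n i)%:C%C *: row i (E n)).

Let e n (k : 'I_(r n)) := fvec (row k (E n)).

Lemma eig_orth1 n (k l : 'I_(r n)) :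
  inner mu (dom_set Om) (e k) (e l) = (k == l)%:R.
Proof.
rewrite /e inner_fvec; have /matrixP/(_ k l) := XE1 n; rewrite !mxE => <-.
by apply: eq_bigr => i _; rewrite !mxE.
Qed.

Lemma eig_new m n (k : 'I_(r n.+1)) b : (m <= n)%N ->
  Cintegral mu (lball m b) (e k) = 0.
Proof.
move=> mn; rewrite (Cint_children b mn); last exact: L2_Cintble_dom (fvec_L2 _).
rewrite big1// => d _; rewrite /e Cint_fvec -row_mul.
have /sub_kermxP -> : (E n.+1 <= kermx (children n))%MS by rewrite XE2.
by rewrite row0 mxE mulr0.
Qed.

Lemma eig_orth m n (k : 'I_(r m)) (l : 'I_(r n)) : (m < n)%N ->
  inner mu (dom_set Om) (e l) (e k) = 0.
Proof.
case: n l => // n l mn; rewrite /e inner_fvecr; last exact: fvec_L2.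
by rewrite big1 ?mulr0// => b _; rewrite eig_new ?mul0r.
Qed.

(** By induction on the level: a vector of averages at level [m.+1] whose sums
    over the discs of level [m] vanish lies in [newmx m.+1], and it is
    orthogonal to a basis of it. *)
Lemma eig_total h : L2 mu (dom_set Om) h ->
  (forall n (k : 'I_(r n)), inner mu (dom_set Om) h (e k) = 0) ->
  eq_ae mu (dom_set Om) h (fun=> 0).
Proof.
move=> Lh h0; apply: (lball_null p_prime mu_haar Lh) => n.
pose a n := \row_i Cintegral mu (lball n i) h.
suff an m : a m = 0 by move=> i; have /rowP/(_ i) := an n; rewrite !mxE.
have aE l : a l *m (map_mx Num.conj (E l)^T) = 0.
  apply/rowP => k; have /eqP := h0 l k; rewrite /e inner_fvecr// mulf_eq0.
  rewrite fmorph_eq0 invr_eq0 sqrtr_eq0 leNgt rad_gt0//= => /eqP h1.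
  by rewrite mxE [RHS]mxE -[RHS]h1; apply: eq_bigr => i _; rewrite !mxE.
elim: m => [|m IH].
  have /submxP[y ay] : (a 0%N <= E 0%N)%MS by rewrite XE2 submx1.
  by have := aE 0%N; rewrite ay -mulmxA XE1 mulmx1 => ->; rewrite mul0mx.
have /submxP[y ay] : (a m.+1 <= E m.+1)%MS.
  rewrite XE2; apply/sub_kermxP/rowP => b.
  have /rowP/(_ b) := IH; rewrite mxE [RHS]mxE => hb.
  transitivity (Cintegral mu (lball m b) h); last by rewrite hb mxE.
  rewrite (Cint_children b (leqnSn m)); last exact: L2_Cintble_dom.
  rewrite mxE [RHS]big_mkcond/=; apply: eq_bigr => i _; rewrite !mxE.
  by case: ifP; rewrite ?mulr1 ?mulr0.
by have := aE m.+1; rewrite ay -mulmxA XE1 mulmx1 => ->; rewrite mul0mx.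
Qed.

Let ee (i : nat) : Q -> R[i] := if unpickle i is Some (n, k) then
  if insub k is Some k' then e (k' : 'I_(r n)) else fun=> 0 else fun=> 0.
Let ll (i : nat) : R := if unpickle i is Some (n, k) then
  if insub k is Some k' then lam n k' else 0 else 0.
Let II : set nat := [set i | exists n (k : 'I_(r n)), i = pickle (n, k : nat)].

Let eeE n (k : 'I_(r n)) : ee (pickle (n, k : nat)) = e k.
Proof. by rewrite /ee pickleK valK. Qed.

Let llE n (k : 'I_(r n)) : ll (pickle (n, k : nat)) = lam n k.
Proof. by rewrite /ll pickleK valK. Qed.

Lemma eig_eigenbasis : eigenbasis mu (dom_set Om) (L2V mu holes)
  (D_op mu holes alpha) II ee ll.
Proof.
rewrite /L2V OmE; split.
- move=> _ [n [k ->]]; rewrite eeE llE; split; first exact: fvec_L2.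
  apply: op_closure_eq (D_op_fvec (row k (E n))) _ _ => // x.
  rewrite OmE => /set_mem Ox; have [i ix] := lball_cover p_prime n Ox.
  by rewrite /e !(fvecE _ ix) XE3 mxE mulrCA.
- move=> _ _ [n [k ->]] [m [l ->]]; rewrite !eeE.
  have [nm|mn|nm] := ltngtP n m.
  + rewrite (inner_conj mO (fvec_L2 _) (fvec_L2 _)) eig_orth// conjc0.
    case: eqP => // /(pcan_inj pickleK)[nm'].
    by rewrite nm' ltnn in nm.
  + rewrite eig_orth//; case: eqP => // /(pcan_inj pickleK)[nm'].
    by rewrite nm' ltnn in mn.
  + case: m / nm l => l; rewrite eig_orth1; congr (_ %:R); congr nat_of_bool.
    apply/eqP/eqP => [->//|/(pcan_inj pickleK)[kl]].
    exact: val_inj.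
- move=> h Lh h0; apply: eig_total => // n k.
  by rewrite -eeE; apply: h0; exists n, k.
Qed.

End eigenbasis.

Lemma trace_D_exists : exists tr, is_trace_D mu holes alpha tr.
Proof.
pose X n := sval (cid (newmx_eigen n)).
have XP n := svalP (cid (newmx_eigen n)).
eexists; eexists; eexists; eexists; split; last by move=> t; reflexivity.
rewrite OmE; apply: (@eig_eigenbasis X) => n; by case: (XP n).
Qed.

(** ** Growth of the spectrum *)

Definition deg n (i : 'I_(M n)) : R := \sum_j lw n i j.

(** The disc of level [n] that contains the [i]-th disc of level [m]. *)
Definition par n m (i : 'I_(M m)) : 'I_(M n) :=
  sval (cid (lball_cover p_prime n (dom_ctr_in i))).
Arguments par n {m} i.

Lemma parP n m (i : 'I_(M m)) : lball n (par n i) (c m i).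
Proof. exact: (svalP (cid (lball_cover p_prime n (dom_ctr_in i)))). Qed.

Lemma parE n m b (i : 'I_(M m)) : `[< lball n b (c m i) >] = (par n i == b).
Proof.
apply/asboolP/eqP => [h|<-]; last exact: parP.
exact: lball_disj (parP n i) h.
Qed.

Lemma wt_par n m (i j : 'I_(M m)) : par n i != par n j ->
  wt alpha (LP m) i j = wt alpha (LP n) (par n i) (par n j).
Proof.
move=> ij; congr (_ ^+ 2 / 2); rewrite /ker /=; congr (_ `^ _).
exact: level_partition_dist ij (parP n i) (parP n j).
Qed.

Lemma sum_children n m b : (n <= m)%N -> \sum_(i | @par n m i == b) rad m = rad n.
Proof.
move=> nm; apply: complexI; rewrite -[in RHS](mass_lball b).
rewrite (mass_lvl p_prime mu_haar (P := LP n) b nm) rmorph_sum/= mulr_sumr.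
by rewrite (eq_bigl _ _ (fun i => @parE n m b i)); apply: eq_bigr => i _; rewrite mulr1.
Qed.

(** The weight leaving a disc of level [n] is the same for all its descendants:
    it is the degree of that disc. *)
Lemma deg_out n m (i : 'I_(M m)) : (n <= m)%N ->
  \sum_(j | par n j != par n i) lw m i j = deg (par n i).
Proof.
move=> nm; rewrite (partition_big (par n) (fun b => b != par n i))//=.
rewrite /deg [RHS](bigD1 (par n i))//= [lw n _ _ in RHS]/lw wt_diag// mulr0 add0r.
apply: eq_bigr => b bi; rewrite (eq_bigr (fun j => wt alpha (LP n) (par n i) b * rad m)).
  rewrite -mulr_sumr (eq_bigl (fun j => par n j == b)) ?sum_children//.
    by rewrite mulrC.
  by move=> j; have [->|] := eqVneq (par n j) b; rewrite ?bi ?andbF.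
by move=> j /andP[ji /eqP jb]; rewrite /lw (@wt_par n) ?jb 1?mulrC// eq_sym.
Qed.

Hypothesis alpha_ge : 1 / 2 <= alpha.

Lemma rad_le1 n : rad n <= 1.
Proof. exact: expp_le1. Qed.

(** This is where [1 / 2 <= alpha] is used: at distance [a <= rad n <= 1] the
    weight [a `^ (- 2 * alpha) / 2] is at least [a^-1 / 2]. *)
Lemma wt_near n m (i j : 'I_(M m)) : i != j -> par n i = par n j ->
  (rad n)^-1 / 2 <= wt alpha (LP m) i j.
Proof.
move=> ij pij; rewrite ler_pM2r ?invr_gt0//.
have rn := rad_gt0 p_prime Om n.
rewrite /ker /=; set a := absp _.
have a0 : 0 < a.
  rewrite lt_neqAle absp_ge0// andbT eq_sym absp_eq0 subr_eq0.
  apply: contra ij => /eqP h; apply/eqP; apply: (@dom_ctr_inj _ _ _ Om m).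
  by rewrite h subrr absp0 ltW// rad_gt0.
have ar : a <= rad n.
  by apply: absp_dist_le (_ : _ <= rad n) (parP n j); rewrite -pij absp_distC//; exact: parP.
have aalpha : a `^ alpha <= Num.sqrt (rad n).
  rewrite (_ : Num.sqrt (rad n) = rad n `^ 2^-1); last by rewrite powR12_sqrt// ltW.
  apply: (@le_trans _ _ (rad n `^ alpha)).
    by apply: ge0_ler_powR => //; rewrite ?nnegrE ltW.
  apply: ger_powR; first by rewrite rn rad_le1.
  by rewrite -[2^-1]mul1r.
rewrite powRN exprVn lef_pV2 ?posrE ?exprn_gt0 ?powR_gt0//.
apply: (@le_trans _ _ (Num.sqrt (rad n) ^+ 2)); last by rewrite sqr_sqrtr// ltW.
by rewrite lerXn2r ?nnegrE ?powR_ge0 ?sqrtr_ge0.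
Qed.

(** Refining from level [n] to [n.+1] adds the weights to the siblings: their
    total mass is [rad n - rad n.+1], at least half of [rad n], and each weight
    is at least [(rad n)^-1 / 2]. *)
Lemma deg_lb n (i : 'I_(M n)) : n%:R / 4 <= deg i.
Proof.
elim: n i => [|n IH] i.
  by rewrite mul0r sumr_ge0// => j _; exact: lw_ge0.
rewrite -natr1 mulrDl /deg (bigID (fun j => par n j != par n i))/=.
rewrite deg_out// lerD//.
rewrite (eq_bigl (fun j => par n j == par n i)); last by move=> j; rewrite negbK.
rewrite (bigD1 i)//= {1}/lw wt_diag// mulr0 add0r.
apply: (@le_trans _ _ (\sum_(j | (par n j == par n i) && (j != i))
    rad n.+1 * ((rad n)^-1 / 2))); last first.
  apply: ler_sum => j /andP[/eqP pj ji]; rewrite ler_pM2l ?rad_gt0//.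
  by apply: wt_near; rewrite 1?eq_sym.
rewrite -mulr_suml.
have := sum_children (par n i) (leqnSn n); rewrite (bigD1 i)//= => h.
have -> : \sum_(j | (par n j == par n i) && (j != i)) rad n.+1 = rad n - rad n.+1.
  by rewrite -h addrAC subrr add0r.
have r1 := rad_gt0 p_prime Om n.+1; have rS := radS p_prime Om n.
have p2 : 2 <= p%:R :> R by rewrite ler_nat prime_gt1.
have rn := rad_gt0 p_prime Om n.
have -> : (rad n - rad n.+1) * ((rad n)^-1 / 2) = (1 - p%:R^-1) / 2.
  by rewrite rS; field; rewrite !gt_eqF//; lra.
have : p%:R^-1 <= 2^-1 :> R by rewrite lef_pV2 ?posrE//; lra.
lra.
Qed.

(** Subtracting from [f] its projection onto the functions constant on the discs
    of level [n] leaves a weak eigenfunction with zero averages at that level.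
    There the Laplacian is at least [L], so the difference vanishes. *)
Lemma weak_eigen_low n (L lam : R) f : weak_eigen lam f ->
  (forall i : 'I_(M n), L <= deg i) -> lam < L ->
  exists v : 'rV_(M n), eq_ae mu (dom_set Om) f (fvec v).
Proof.
move=> fE degL lamL; have [Lf fE'] := fE.
pose v : 'rV[R[i]]_(M n) :=
  \row_i (((Num.sqrt (rad n))^-1)%:C%C * Cintegral mu (lball n i) f).
have vE : v *m lapl n = lam%:C%C *: v.
  apply/rowP => i; rewrite laplE !mxE mulrCA fE' mulr_sumr.
  by apply: eq_bigr => j _; rewrite !mxE -mulrBr mulrCA.
have gE : weak_eigen lam (fvec v).
  apply: D_op_weak_eigen; apply: op_closure_eq (D_op_fvec v) _ _ => // x.
  rewrite OmE => /set_mem Ox; have [i ix] := lball_cover p_prime n Ox.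
  by rewrite !(fvecE _ ix) vE mxE mulrCA.
have hE := weak_eigenB fE gE; set h := (fun x => _) in hE.
have [Lh hE'] := hE.
have hn i : Cintegral mu (lball n i) h = 0.
  rewrite CintB; [|exact: measurable_lball|exact: L2_Cintble_lball|].
    have -> : Cintegral mu (lball n i) (fvec v) =
        Cintegral mu (lball n i) (fun=> ((Num.sqrt (rad n))^-1)%:C%C * v 0 i).
      by apply: eq_Cint => x /set_mem ix; exact: fvecE.
    rewrite Cint_lball_cst mxE mulrA -rmorphM/= -expr2 mulrAC -rmorphM/=.
    by rewrite [_ * rad n]mulrC rad_sqrt mul1r subrr.
  by apply: L2_Cintble_lball; exact: fvec_L2.
exists v; have : eq_ae mu (dom_set Om) h (fun=> 0).
  apply: (lball_null p_prime mu_haar Lh) => m i.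
  have [mn|nm] := leqP m n.
    rewrite (Cint_children i mn (L2_Cintble_dom Lh)) big1//.
  apply: part_eq => b; rewrite part0; move: i.
  apply: (@laplacian_gap R _ _ (lw m) (par n)
    (fun i => part b (Cintegral mu (lball m i) h)) lam L) => //.
  - exact: lw_sym.
  - exact: lw_ge0.
  - move=> d; rewrite -part_sum -(eq_bigl _ _ (fun i => @parE n m d i)).
    by rewrite -(Cint_children d (ltnW nm) (L2_Cintble_dom Lh)) hn part0.
  - move=> i j k jk ij; have ik : par n i != par n k by rewrite -jk.
    by rewrite /lw (wt_par ij) (wt_par ik) jk.
  - by move=> i; rewrite deg_out ?(ltnW nm).
  - by move=> i; exact: weak_eigen_part.
by apply: filterS => x hx Ox; apply/eqP; rewrite -subr_eq0; apply/eqP; exact: hx.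
Qed.

(** Eigenfunctions with small eigenvalues live in the space of functions that
    are constant on the [M n] discs of level [n]. *)
Lemma low_count n m (f : 'I_m -> Q -> R[i]) (lam : 'I_m -> R) :
  (forall k, weak_eigen (lam k) (f k)) -> (forall k, lam k < n%:R / 4) ->
  (forall k l, inner mu (dom_set Om) (f k) (f l) = (k == l)%:R) -> (m <= M n)%N.
Proof.
move=> fE lamn fon.
have [v vP] := choice (fun k => weak_eigen_low (fE k) (@deg_lb n) (lamn k)).
pose V := \matrix_(k < m, i < M n) v k 0 i.
apply: (@mulmx1_min _ m (M n) V (map_mx Num.conj V^T)).
have Lfk k : L2 mu (dom_set Om) (f k) by case: (fE k).
apply/matrixP => k l; rewrite !mxE -fon.
rewrite (inner_ae _ (Lfk k) (fvec_L2 (v k)) (Lfk l) (vP k))//.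
rewrite (inner_conj mO (Lfk l) (fvec_L2 (v k))).
rewrite (inner_ae _ (Lfk l) (fvec_L2 (v l)) (fvec_L2 (v k)) (vP l))//.
rewrite -(inner_conj mO (fvec_L2 _) (fvec_L2 _)) inner_fvec.
by apply: eq_bigr => i _; rewrite !mxE.
Qed.

(** ** The trace as time goes to infinity *)

Section eigenbasis_D.
Variables (I : set nat) (f : nat -> Q -> R[i]) (lam : nat -> R).
Hypothesis If : eigenbasis mu (OmegaV holes) (L2V mu holes)
  (D_op mu holes alpha) I f lam.

Lemma eig_weak i : I i -> weak_eigen (lam i) (f i).
Proof. by case: If => h _ _ /h[_]; exact: D_op_weak_eigen. Qed.

Lemma eig_L2 i : I i -> L2 mu (dom_set Om) (f i).
Proof. by case/eig_weak. Qed.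

Lemma eig_on i j : I i -> I j -> inner mu (dom_set Om) (f i) (f j) = (i == j)%:R.
Proof. by rewrite -OmE; case: If => _ h _; exact: h. Qed.

Lemma eig_tot h : L2 mu (dom_set Om) h ->
  (forall i, I i -> inner mu (dom_set Om) h (f i) = 0) ->
  eq_ae mu (dom_set Om) h (fun=> 0).
Proof. by rewrite -OmE; case: If => _ _ tot; exact: tot. Qed.

Lemma eig_ge0 i : I i -> 0 <= lam i.
Proof.
move=> Ii; apply: weak_eigen_ge0 (eig_weak Ii) _ => f0.
have := eig_on Ii Ii; have Lf := eig_L2 Ii.
rewrite eqxx (inner_ae mO Lf (L2_cst mO fO 0) Lf f0) inner0l => /esym/eqP.
by rewrite oner_eq0.
Qed.

(** The eigenfunctions with eigenvalue zero are constant, and every constant is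
    orthogonal to the others, because these have mean zero. *)
Lemma eig_zero_card : (I `&` [set i | lam i = 0%R] #= `I_1)%card.
Proof.
pose S := [set h | L2 mu (dom_set Om) h /\ forall n i j,
  Cintegral mu (lball n i) h = Cintegral mu (lball n j) h].
have S1 : has_dim mu (dom_set Om) S 1.
  apply: has_dim_const => [|h []//|h []//]; split; first exact: L2_cst.
  by move=> n i j; rewrite !Cint_lball_cst.
apply: (@orthonormal_card _ _ _ _ _ mO S 1 S1 _ _ _ f).
- by move=> h [].
- move=> m a e Se; split; first by apply: L2_sum => // i; case: (Se i).
  move=> n i j; rewrite !Cint_sum.
  + by apply: eq_bigr => k _; congr (_ * _); case: (Se k).
  + exact: measurable_lball.
  + by move=> k; apply: L2_Cintble_lball; case: (Se k).
  + exact: measurable_lball.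
  + by move=> k; apply: L2_Cintble_lball; case: (Se k).
- move=> i [Ii /= li]; split; first exact: eig_L2.
  by apply: weak_eigen0_const; rewrite -li; exact: eig_weak.
- by move=> i j [Ii _] [Ij _]; exact: eig_on.
move=> h [Lh /(const_of_lball Lh)[z hz]] h0; apply: eig_tot => // i Ii.
have [li|li] := eqVneq (lam i) 0; first exact: h0.
have Lf := eig_L2 Ii; have Lz := L2_cst mO fO z.
rewrite (inner_ae mO Lh Lz Lf hz) (inner_conj mO Lf Lz).
have -> : inner mu (dom_set Om) (f i) (fun=> z) =
    Cintegral mu (dom_set Om) (fun x => conjc z * f i x).
  by apply: eq_Cint => x _; rewrite mulrC.
rewrite CintZ//; last exact: L2_Cintble_dom.
by rewrite (weak_eigen_mean (eig_weak Ii) li) mulr0 rmorph0.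
Qed.

Lemma eig_low_size n (s : seq nat) : uniq s ->
  (forall i, i \in s -> I i /\ lam i < n%:R / 4) -> (size s <= M n)%N.
Proof.
move=> us sI; pose x (k : 'I_(size s)) := nth 0%N s k.
have xs k : x k \in s by exact: mem_nth.
apply: (@low_count n _ (fun k => f (x k)) (fun k => lam (x k))) => [k|k|k l].
- by apply: eig_weak; case: (sI _ (xs k)).
- by case: (sI _ (xs k)).
rewrite eig_on; [|by case: (sI _ (xs k))|by case: (sI _ (xs l))].
by rewrite nth_uniq.
Qed.

(** Compare the two expressions of the measure of the domain. *)
Lemma num_pow n : M n = (M 0 * p ^ n)%N.
Proof.
have := mu_dom p_prime mu_haar Om n; rewrite (mu_dom p_prime mu_haar Om 0) => -[h].
apply/eqP; rewrite -(eqr_nat R) -(inj_eq (mulIf (_ : rad n != 0))); last first.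
  by rewrite gt_eqF// rad_gt0.
rewrite -h natrM natrX -mulrA; apply/eqP; congr (_ * _).
have p0 : p%:R != 0 :> R by rewrite pnatr_eq0 -lt0n prime_gt0.
by rewrite /rad addn0 exprD invfM mulrCA divff ?mulr1// expf_neq0.
Qed.

(** Only finitely many eigenvalues are below [1 / 4]. *)
Lemma eig_gap : exists2 lm : R, 0 < lm & forall i, I i -> lam i <> 0 -> lm <= lam i.
Proof.
pose J := I `&` [set i | lam i < 1 / 4].
have : finite_set J.
  apply: contrapT => /(infinite_set_fset (M 1).+1)[B BJ].
  rewrite ltnNge => /negP; apply; apply: eig_low_size; first exact: finmap.fset_uniq.
  by move=> i iB; case: (BJ i iB).
move=> /finite_seqP[s Js]; have [lm lm0 lms] := seq_pos_lower_bound s lam.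
exists (Num.min lm (1 / 4)); first by rewrite lt_min lm0; lra.
move=> i Ii li; rewrite ge_min; have [h|h] := ltP (lam i) (1 / 4).
  rewrite lms//; first by have : J i by []; rewrite Js.
  by rewrite lt_neqAle eig_ge0// andbT eq_sym; exact/eqP.
by rewrite orbT.
Qed.

(** An eigenvalue [lam] with integral part [k] of [4 * lam] contributes at most
    [(2 * p) ^- k] at the time [4 * ln (2 * p)], and at most [M k.+1] of them
    have the same [k]. *)
Lemma eig_sum_le (s : seq nat) : uniq s -> (forall i, i \in s -> I i) ->
  \sum_(i <- s) expR (- lam i * (4 * ln (2 * p%:R))) <= 2 * (M 1)%:R.
Proof.
move=> us sI; pose k i := Num.trunc (4 * lam i).
have kle i : i \in s -> (k i)%:R <= 4 * lam i < (k i).+1%:R.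
  by move=> /sI/eig_ge0 li; apply: Num.Theory.truncn_itv; rewrite mulr_ge0.
apply: (@le_trans _ _ (\sum_(i <- s) (2 * p%:R) ^- k i)).
  rewrite big_seq [leRHS]big_seq; apply: ler_sum => i /kle/andP[ki _].
  have q1 : 1 <= 2 * p%:R :> R by rewrite -natrM ler1n muln_gt0/= prime_gt0.
  rewrite -(@lnK _ ((2 * p%:R) ^- k i)); last first.
    by rewrite posrE invr_gt0 exprn_gt0// (lt_le_trans _ q1).
  rewrite ler_expR lnV ?posrE ?exprn_gt0 ?(lt_le_trans _ q1)//.
  rewrite lnXn ?(lt_le_trans _ q1)// -[ln _ *+ _]mulr_natl mulNr lerN2 mulrA.
  by rewrite ler_wpM2r ?ln_ge0// [_ * 4]mulrC.
apply: (sum_geometric_le R (prime_gt0 p_prime)) => n.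
rewrite -size_filter (leq_trans (eig_low_size (n := n.+1) _ _)) ?filter_uniq//.
  move=> i; rewrite mem_filter => /andP[/eqP <- si]; split; first exact: sI.
  by case/andP: (kle i si) => _; lra.
by rewrite (num_pow n.+1) (num_pow 1) expn1 expnS mulnA.
Qed.

End eigenbasis_D.

Lemma trace_D_cvg tr : is_trace_D mu holes alpha tr ->
  tr t @[t --> +oo] --> (1 : R)%:E.
Proof.
move=> [I [f [lam [If trE]]]].
have [lm lm0 lmI] := eig_gap If.
rewrite (_ : tr = fun t => \esum_(i in I) (expR (- lam i * t))%:E)%E; last first.
  by apply/funext => t; exact: trE.
apply: (heat_trace_cvg lm0 (eig_zero_card If) lmI (t0 := 4 * ln (2 * p%:R))).
by move=> s us sI; apply: (eig_sum_le If us) => i /sI[].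
Qed.

End vertex_operator.

(** * Antisymmetric matrices with zero row sums *)

Section cycles.
Context (C : numFieldType) (N : nat).
Implicit Types (z : 'M[C]_N.+1).
Local Notation up := (lift ord0).

(** The edges of the complete graph on the nonzero vertices. *)
Definition upair := {ij : 'I_N * 'I_N | (ij.1 < ij.2)%N}.

Lemma card_upair : #|{: upair}| = 'C(N, 2).
Proof.
rewrite card_sig -sum1_card -bin2_sum big_mkord.
rewrite (partition_big (fun ij : 'I_N * 'I_N => ij.2) xpredT)//=.
apply: eq_bigr => j _; rewrite sum1_card -[RHS]card_ord.
pose f (i : 'I_j) := (widen_ord (ltnW (ltn_ord j)) i, j).
rewrite -(card_imset (f := f)); last by move=> a b [] /val_inj.
apply: eq_card => -[a b]; rewrite [LHS]unfold_in/=; apply/andP/imsetP => [[+ /eqP]|[i _ [-> ->]]].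
  rewrite unfold_in/= => ab bj; subst b; exists (Ordinal ab) => //.
  by congr pair; apply: val_inj.
by rewrite unfold_in/= eqxx.
Qed.

Definition arc (i j : 'I_N.+1) : 'M[C]_N.+1 := delta_mx i j - delta_mx j i.

Definition triangle (s : upair) : 'M[C]_N.+1 :=
  arc (up (val s).1) (up (val s).2) + arc (up (val s).2) 0 + arc 0 (up (val s).1).

Lemma arc_anti i j : (arc i j)^T = - arc i j.
Proof. by rewrite /arc linearB/= !trmx_delta opprB. Qed.

Lemma arc_row i j a : \sum_b arc i j a b = (a == i)%:R - (a == j)%:R.
Proof.
have h x y : \sum_b (delta_mx x y : 'M[C]_N.+1) a b = (a == x)%:R.
  rewrite (bigD1 y)//= mxE eqxx andbT big1 ?addr0// => b bv.
  by rewrite mxE (negbTE bv) andbF.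
by under eq_bigr do rewrite !mxE; rewrite sumrB -(h i j) -(h j i);
  congr (_ - _); apply: eq_bigr => b _; rewrite !mxE.
Qed.

Lemma triangle_anti s : (triangle s)^T = - triangle s.
Proof. by rewrite /triangle 2!raddfD/= !arc_anti -!opprD. Qed.

Lemma triangle_row s a : \sum_b triangle s a b = 0.
Proof.
under eq_bigr do rewrite /triangle 2!mxE.
by rewrite !big_split/= !arc_row !subrKA subrr.
Qed.

Lemma triangle_coord s t :
  triangle s (up (val t).1) (up (val t).2) = (s == t)%:R.
Proof.
have h0 i : (up i == 0) = false by [].
rewrite /triangle/arc !mxE !h0 !andbF !andFb !subr0 !addr0.
rewrite !(inj_eq (@lift_inj _ ord0)) ![(val t).1 == _]eq_sym ![(val t).2 == _]eq_sym.
case: s t => -[a b] /= ab [[c d] /= cd].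
rewrite -[RHS]/(((a, b) == (c, d))%:R) xpair_eqE.
suff -> : (b == c) && (a == d) = false by rewrite subr0.
apply/andP => -[/eqP bc /eqP ad]; move: ab cd; rewrite bc ad => h1 h2.
by have := ltn_trans h1 h2; rewrite ltnn.
Qed.

(** The row and column of index zero of such a matrix are determined by the
    other ones. *)
Lemma cycle_eq0 z : z^T = - z -> (forall a, \sum_b z a b = 0) ->
  (forall s : upair, z (up (val s).1) (up (val s).2) = 0) -> z = 0.
Proof.
move=> za zr zs; have zE a b : z a b = - z b a.
  by move/matrixP: za => /(_ b a); rewrite !mxE.
have z0 a b : z (up a) (up b) = 0.
  have [ab|ba|/val_inj <-] := ltngtP a b.
  - exact: (zs (exist _ (a, b) ab)).
  - by rewrite zE (zs (exist _ (b, a) ba)) oppr0.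
  have /eqP := zE (up a) (up a).
  by rewrite -addr_eq0 -mulr2n mulrn_eq0/= => /eqP.
have zr0 a : z (up a) 0 = 0.
  have := zr (up a); rewrite big_ord_recl big1 ?addr0// => b _; exact: z0.
apply/matrixP => a b; rewrite [RHS]mxE.
case: (unliftP ord0 a) => [a'|] ->; case: (unliftP ord0 b) => [b'|] ->.
- exact: z0.
- exact: zr0.
- by rewrite zE zr0 oppr0.
have /eqP := zE 0 0.
by rewrite -addr_eq0 -mulr2n mulrn_eq0/= => /eqP.
Qed.

(** The triangles through the vertex zero are a basis. *)
Lemma triangle_decomp z : z^T = - z -> (forall a, \sum_b z a b = 0) ->
  z = \sum_s z (up (val s).1) (up (val s).2) *: triangle s.
Proof.
move=> za zr; apply/eqP; rewrite -subr_eq0; apply/eqP; apply: cycle_eq0.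
- rewrite linearB/= linear_sum/= za (eq_bigr _ (fun s _ => linearZ _ _))/=.
  under eq_bigr do rewrite triangle_anti scalerN.
  by rewrite sumrN opprK opprB addrC.
- move=> a; under eq_bigr do rewrite !mxE summxE.
  rewrite sumrB zr sub0r exchange_big/= big1 ?oppr0// => s _.
  by under eq_bigr do rewrite mxE; rewrite -mulr_sumr triangle_row mulr0.
move=> t; rewrite !mxE summxE (bigD1 t)//= mxE triangle_coord eqxx mulr1.
rewrite big1 ?addr0 ?subrr// => s st.
by rewrite mxE triangle_coord (negbTE st) mulr0.
Qed.

End cycles.

(** * Functions constant on products of holes *)

Section rho.
Context (p : nat) (p_prime : prime p) (R : realType) (K : padicField p R).
Variable mu : {sigma_finite_measure set (Qp K) -> \bar R}.
Hypothesis mu_haar : is_haar mu.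
Variable Om : clopen_domain K.
Variable holes : set (set (Qp K)).
Hypothesis OmE : OmegaV holes = dom_set Om.
Variable alpha : R.
Hypothesis alpha_gt0 : 0 < alpha.
Variables (N : nat) (P : ultra_partition Om 'I_N.+1).
Local Notation n := N.+1.
Hypothesis holesP : forall H, holes H <-> exists i, H = P i.
Local Notation Q := (Qp K).
Local Notation mu2 := ((mu \x mu)%E : {measure set (Q * Q) -> \bar R}).
Local Notation Om2 := (dom_set Om `*` dom_set Om).
Local Notation m := (mass mu P).
Local Notation k := (ker alpha P).
Implicit Types (b c : 'M[R[i]]_n) (a : 'I_n -> R[i]).

Let mO := measurable_dom p_prime Om.
Let fO := mu_dom_lty p_prime mu_haar Om.
Let mO2 : measurable Om2 := measurableX mO mO.
Let fO2 := mu2_dom_lty p_prime mu_haar Om.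
Let mP i : measurable (P i) := measurable_up p_prime P i.

Lemma antiE b i j : b^T = - b -> b i j = - b j i.
Proof. by move=> /matrixP/(_ j i); rewrite !mxE. Qed.

Definition step2 b (z : Q * Q) : R[i] :=
  up_step P (fun i => up_step P (b i) z.2) z.1.

Lemma step2E b i j x y : P i x -> P j y -> step2 b (x, y) = b i j.
Proof. by move=> ix jy; rewrite /step2 (up_stepE _ ix) (up_stepE _ jy). Qed.

Lemma step2_L2 b : L2 mu2 Om2 (step2 b).
Proof. exact: lvl_const2_L2 (up_const2_lvl (step2E b)). Qed.

Lemma mu2_up i j : mu2 (P i `*` P j) = (m i * m j)%:E.
Proof. by rewrite mu2_rect// EFinM -!(mu_up p_prime mu_haar). Qed.

Lemma up_subset2 i j : P i `*` P j `<=` Om2.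
Proof. by move=> [x y] [ix jy]; split; [exact: up_sub ix|exact: up_sub jy]. Qed.

Lemma Cint_const2 F b : (forall i j x y, P i x -> P j y -> F (x, y) = b i j) ->
  Cintegral mu2 Om2 F = \sum_i \sum_j (m i * m j)%:C%C * b i j.
Proof.
move=> FE; rewrite (@Cint_step _ _ _ mu2 _ _ (fun ij => P ij.1 `*` P ij.2)
  mO2 fO2 _ _ _ F (fun ij => b ij.1 ij.2)).
- rewrite -(pair_bigA _ (fun i j => (fine (mu2 (Om2 `&` P i `*` P j)))%:C%C * b i j)) /=.
  apply: eq_bigr => i _; apply: eq_bigr => j _.
  by rewrite (setIidr (@up_subset2 i j)) mu2_up.
- by move=> [i j]; exact: measurableX.
- move=> [x y] [/(up_cover P)[i ix] /(up_cover P)[j jy]].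
  by exists (i, j).
- move=> [i j] [i' j'] [x y] _ [/= ix jy] [/= ix' jy'].
  by rewrite (up_disj ix ix') (up_disj jy jy').
- by move=> [i j] [x y] _ [/= ix jy]; exact: FE.
Qed.

Lemma inner_step2 b c : inner mu2 Om2 (step2 b) (step2 c) =
  \sum_i \sum_j (m i * m j)%:C%C * (b i j * conjc (c i j)).
Proof.
rewrite /inner (@Cint_const2 _ (\matrix_(i, j) (b i j * conjc (c i j)))).
  by apply: eq_bigr => i _; apply: eq_bigr => j _; rewrite mxE.
by move=> i j x y ix jy; rewrite !(step2E _ ix jy) mxE.
Qed.

Lemma mass2_neq0 i j : (m i * m j)%:C%C != 0 :> R[i].
Proof. by rewrite fmorph_eq0 gt_eqF// mulr_gt0//; exact: mass_gt0. Qed.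

Lemma Cint_rect h b i j : L2 mu2 Om2 h -> eq_ae mu2 Om2 h (step2 b) ->
  Cintegral mu2 (P i `*` P j) h = (m i * m j)%:C%C * b i j.
Proof.
move=> Lh hb.
rewrite (Cint_ae mO2 (measurableX (mP i) (mP j)) (@up_subset2 i j) Lh (step2_L2 b) hb).
have -> : Cintegral mu2 (P i `*` P j) (step2 b) =
    Cintegral mu2 (P i `*` P j) (fun=> b i j).
  by apply: eq_Cint => -[x y] /set_mem[/= ix jy]; exact: step2E.
rewrite Cint_cst; last exact: measurableX.
by rewrite mulrC; congr (_%:C%C * _); rewrite mu2_up.
Qed.

Lemma step2_inj b c : eq_ae mu2 Om2 (step2 b) (step2 c) -> b = c.
Proof.
move=> bc; apply/matrixP => i j; apply: (mulfI (mass2_neq0 i j)).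
by rewrite -(Cint_rect i j (step2_L2 b) bc) -(Cint_rect i j (step2_L2 b) (eq_ae_refl _ _ _)).
Qed.

Let swapQ (z : Q * Q) : Q * Q := (z.2, z.1).

(** The product measure is invariant under exchange of the factors, by
    uniqueness of product measures. *)
Lemma swap_ae (A : Q * Q -> Prop) : {ae mu2, forall z, A z} ->
  {ae mu2, forall z, A (z.2, z.1)}.
Proof.
move=> [B [mB B0 AB]]; exists (swapQ @^-1` B).
have ms : measurable_fun [set: Q * Q] (swapQ) := @measurable_swap _ _ Q Q.
have mBs : measurable (swapQ @^-1` B : set (Q * Q)) by rewrite -[X in measurable X]setTI; exact: ms.
split => //; last by move=> [x y] nA; apply: AB => /= hA; apply: nA.
rewrite -B0 -[LHS]/(pushforward mu2 (swapQ) B).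
apply/esym/product_measure_unique => // A1 A2 mA1 mA2.
rewrite -[LHS]/(mu2 (swapQ @^-1` (A1 `*` A2))) (_ : _ @^-1` _ = A2 `*` A1); last first.
  by apply/seteqP; split => -[x y] [].
by rewrite mu2_rect// muleC.
Qed.

Lemma L2rho_step2 b : b^T = - b -> L2rho mu holes (step2 b).
Proof.
move=> ba; split; first split.
- by rewrite (OmegaE_E OmE); exact: step2_L2.
- rewrite (OmegaE_E OmE); apply: aeW => -[x y] [/(up_cover P)[i ix] /(up_cover P)[j jy]].
  by rewrite (step2E b ix jy) (step2E b jy ix) (antiE i j ba).
move=> H H' /holesP[i ->] /holesP[j ->]; exists (b i j).
by apply: aeW => -[x y] [/= ix jy]; exact: step2E.
Qed.

Lemma L2rho_L2 h : L2rho mu holes h -> L2 mu2 Om2 h.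
Proof. by rewrite -(OmegaE_E OmE) => -[[]]. Qed.

(** The constants on [P i `*` P j] and [P j `*` P i] are opposite because these
    products have positive measure. *)
Lemma L2rhoP h : L2rho mu holes h ->
  exists2 b, b^T = - b & eq_ae mu2 Om2 h (step2 b).
Proof.
move=> [[]]; rewrite (OmegaE_E OmE) => Lh ha hc.
have {}hc i j : exists z, eq_ae mu2 (P i `*` P j) h (fun=> z).
  by apply: hc; apply/holesP; [exists i|exists j].
pose b := \matrix_(i, j) sval (cid (hc i j)).
have bP i j : eq_ae mu2 (P i `*` P j) h (fun=> b i j).
  by rewrite mxE; exact: svalP (cid (hc i j)).
exists b.
  apply/matrixP => i j; rewrite mxE [RHS]mxE; apply/eqP; apply: contrapT => bij.
  have : mu2.-negligible (P i `*` P j).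
    have : {ae mu2, forall z, ~ (P i `*` P j) z}.
      have := swap_ae (bP j i); have := bP i j; move: ha.
      apply: filterS3 => -[x y] /= h1 h2 h3 [/= ix jy]; apply: bij.
      rewrite -(h3 (conj jy ix)) -(h2 (conj ix jy)) h1; last first.
        by split; [exact: up_sub ix|exact: up_sub jy].
      by rewrite opprK.
    by apply: negligibleS => z zP /=; exact.
  move=> /(negligibleP mu2 (measurableX (mP i) (mP j))) h0.
  have [/eqP] := etrans (esym (mu2_up i j)) h0.
  by rewrite gt_eqF// mulr_gt0//; exact: mass_gt0.
have {}bP : {ae mu2, forall z, forall ij : 'I_n * 'I_n, (P ij.1 `*` P ij.2) z -> h z = b ij.1 ij.2}.
  by apply: filter_forall => -[i j]; exact: bP.
apply: filterS bP => -[x y] hz [/(up_cover P)[i ix] /(up_cover P)[j jy]].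
by rewrite (step2E b ix jy) (hz (i, j)).
Qed.

(** The matrices of [delta] and [d] on functions constant on holes. *)
Definition bdry b i : R[i] := \sum_j (m j * k i j)%:C%C * b i j.

Definition diff a : 'M[R[i]]_n := \matrix_(i, j) ((k i j / 2)%:C%C * (a i - a j)).

Lemma diff_anti a : (diff a)^T = - diff a.
Proof. by apply/matrixP => i j; rewrite !mxE ker_sym// -mulrN opprB. Qed.

Lemma delta_op_step2 b : b^T = - b ->
  delta_op mu holes alpha (step2 b) (up_step P (bdry b)).
Proof.
move=> ba; have bE i j : b i j = - b j i by exact: antiE.
apply: (delta_op_lvl p_prime mu_haar OmE (up_const2_lvl (step2E b))).
  exact: up_const2_anti (step2E b) bE.
move=> x /(up_cover P)[i ix].
rewrite (delta_formula_up p_prime mu_haar OmE _ (step2E b) bE ix) (up_stepE _ ix).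
by apply: eq_bigr => j _; rewrite mulrA -rmorphM.
Qed.

Lemma d_op_up_step a : d_op mu holes alpha (up_step P a) (step2 (diff a)).
Proof.
apply: (d_op_lvl p_prime mu_haar OmE (up_const_lvl (up_stepE a))).
move=> [x y] /set_mem[/= /(up_cover P)[i ix] /(up_cover P)[j jy]].
by rewrite (d_formula_up _ (up_stepE a) ix jy)// (step2E _ ix jy) mxE.
Qed.

(** [delta] is the adjoint of [d]. *)
Lemma bdry_adj a b : b^T = - b ->
  \sum_i \sum_j (m i * m j)%:C%C * (diff a i j * conjc (b i j)) =
  \sum_i (m i)%:C%C * (a i * conjc (bdry b i)).
Proof.
move=> ba; pose t i j := (m i * m j * k i j)%:C%C * a i * conjc (b i j).
transitivity (\sum_i \sum_j (2^-1)%:C%C * (t i j + t j i)).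
  apply: eq_bigr => i _; apply: eq_bigr => j _; rewrite mxE /t (antiE j i ba) rmorphN.
  rewrite (ker_sym p_prime _ P j i) [m j * m i]mulrC !rmorphM/=; ring.
transitivity (\sum_i \sum_j t i j).
  under eq_bigr do rewrite -mulr_sumr big_split/=.
  rewrite -mulr_sumr big_split/= [X in _ + X]exchange_big/=.
  set X := \sum_i _; rewrite -mulr2n -[X *+ 2]mulr_natl mulrA.
  by rewrite -(rmorph_nat (real_complex R)) -rmorphM/= mulVf// mul1r.
apply: eq_bigr => i _; rewrite /bdry rmorph_sum/= !mulr_sumr; apply: eq_bigr => j _.
by rewrite conjcZ /t !rmorphM/=; ring.
Qed.

Lemma delta_weak_step2 h b f i : L2 mu2 Om2 h -> eq_ae mu2 Om2 h (step2 b) ->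
  delta_op mu holes alpha h f ->
  Cintegral mu (P i) f = (m i)%:C%C * bdry b i.
Proof.
move=> Lh hb hf; rewrite (delta_weak p_prime mu_haar OmE alpha_gt0 P i hf) mulr_sumr.
apply: eq_bigr => j _; rewrite (Cint_rect i j Lh hb) !rmorphM/=; ring.
Qed.

(** An eigenfunction is determined almost everywhere by a matrix, and the weak
    forms of [d] and [delta] turn the eigenvalue equation into a matrix
    equation. *)
Lemma Delta_rho_weak h b lam : b^T = - b -> eq_ae mu2 Om2 h (step2 b) ->
  Delta_rho mu holes alpha h (fun z => lam%:C%C * h z) ->
  lam%:C%C *: b = diff (bdry b).
Proof.
move=> ba hb [f [[hr hf] fh]]; have Lh := L2rho_L2 hr.
have lb : eq_ae mu2 Om2 (fun z => lam%:C%C * h z) (step2 (lam%:C%C *: b)).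
  apply: filterS hb => -[x y] hxy Oz; rewrite hxy//.
  have [/(up_cover P)[i ix] /(up_cover P)[j jy]] := Oz.
  by rewrite !(step2E _ ix jy) mxE.
apply/matrixP => i j; have [<-|ij] := eqVneq i j.
  rewrite !mxE subrr mulr0.
  have /eqP := antiE i i ba; rewrite -addr_eq0 -mulr2n mulrn_eq0/= => /eqP->.
  by rewrite mulr0.
apply: (mulfI (mass2_neq0 i j)).
rewrite -(Cint_rect i j (L2Z mO2 _ Lh) lb) (d_weak p_prime mu_haar OmE P fh ij).
by rewrite !(delta_weak_step2 _ Lh hb hf) mxE !rmorphM/=; ring.
Qed.

(** ** The kernel of delta *)

(** In the coordinates [m i * k i j * m j * b i j] the condition that [delta]
    kills the step function of [b] becomes the vanishing of the row sums. The
    diagonal weight is zero, but so are the diagonal entries of an antisymmetric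
    matrix. *)
Definition to_cycle b : 'M[R[i]]_n := \matrix_(i, j) ((m i * k i j * m j)%:C%C * b i j).
Definition of_cycle z : 'M[R[i]]_n := \matrix_(i, j) (((m i * k i j * m j)^-1)%:C%C * z i j).

Lemma anti_diag0 b i : b^T = - b -> b i i = 0.
Proof.
by move=> /(antiE i i)/eqP; rewrite -addr_eq0 -mulr2n mulrn_eq0/= => /eqP.
Qed.

Lemma weight_sym i j : m i * k i j * m j = m j * k j i * m i.
Proof. by rewrite ker_sym//; ring. Qed.

Lemma to_cycle_anti b : b^T = - b -> (to_cycle b)^T = - to_cycle b.
Proof.
by move=> ba; apply/matrixP => i j; rewrite !mxE (antiE j i ba) weight_sym mulrN.
Qed.

Lemma of_cycle_anti z : z^T = - z -> (of_cycle z)^T = - of_cycle z.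
Proof.
by move=> za; apply/matrixP => i j; rewrite !mxE (antiE j i za) weight_sym mulrN.
Qed.

Lemma to_cycle_row b i : \sum_j to_cycle b i j = (m i)%:C%C * bdry b i.
Proof.
rewrite mulr_sumr; apply: eq_bigr => j _; rewrite mxE mulrA -rmorphM/=.
by congr (_%:C%C * _); ring.
Qed.

Lemma weight_neq0 i j : i != j -> m i * k i j * m j != 0.
Proof.
by move=> ij; rewrite gt_eqF// !mulr_gt0//; do ?exact: mass_gt0; exact: ker_gt0.
Qed.

Lemma to_cycleK b : b^T = - b -> of_cycle (to_cycle b) = b.
Proof.
move=> ba; apply/matrixP => i j; have [<-|ij] := eqVneq i j.
  by rewrite !mxE (anti_diag0 i ba) !mulr0.
by rewrite !mxE mulrA -rmorphM/= mulVf ?mul1r// weight_neq0.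
Qed.

Lemma of_cycleK z : z^T = - z -> to_cycle (of_cycle z) = z.
Proof.
move=> za; apply/matrixP => i j; have [<-|ij] := eqVneq i j.
  by rewrite !mxE (anti_diag0 i za) !mulr0.
by rewrite !mxE mulrA -rmorphM/= mulfV ?mul1r// weight_neq0.
Qed.

Lemma mass_neq0 i : (m i)%:C%C != 0 :> R[i].
Proof. by rewrite fmorph_eq0 gt_eqF//; exact: mass_gt0. Qed.

Definition cycle_fun (s : upair N) : 'M[R[i]]_n := of_cycle (triangle _ s).

Lemma cycle_fun_bdry s i : bdry (cycle_fun s) i = 0.
Proof.
apply: (mulfI (mass_neq0 i)); rewrite mulr0 -to_cycle_row of_cycleK ?triangle_row//.
exact: triangle_anti.
Qed.

Lemma step2_sum (I : finType) (x : I -> R[i]) (b : I -> 'M[R[i]]_n) z : Om2 z ->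
  step2 (\sum_s x s *: b s) z = \sum_s x s * step2 (b s) z.
Proof.
move: z => [y y'] [/(up_cover P)[i iy] /(up_cover P)[j jy]].
rewrite (step2E _ iy jy) summxE; apply: eq_bigr => s _.
by rewrite (step2E _ iy jy) mxE.
Qed.

(** A space between the step functions killed by [delta] and those that are
    almost everywhere equal to one has the dimension of the cycle space of the
    complete graph on the holes. *)
Lemma has_dim_cycles (S : set (Q * Q -> R[i])) :
  (forall b, b^T = - b -> (forall i, bdry b i = 0) -> S (step2 b)) ->
  (forall h, S h -> exists b, [/\ b^T = - b, forall i, bdry b i = 0 &
     eq_ae mu2 Om2 h (step2 b)]) ->
  has_dim mu2 Om2 S 'C(N, 2).
Proof.
move=> S1 S2; rewrite -(@card_upair N).
pose e (s : 'I_#|{: upair N}|) := cycle_fun (enum_val s).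
have eS (x : 'I_#|{: upair N}| -> R[i]) z : Om2 z ->
    step2 (\sum_s x s *: e s) z = \sum_s x s * step2 (e s) z by exact: step2_sum.
exists (fun s => step2 (e s)); split.
- move=> s; apply: S1 => [|i]; last exact: cycle_fun_bdry.
  by apply: of_cycle_anti; exact: triangle_anti.
- move=> x x0 s.
  have /step2_inj xe : eq_ae mu2 Om2 (step2 (\sum_s x s *: e s)) (step2 0).
    apply: filterS x0 => z hz Oz; rewrite eS// hz//; move: Oz.
    move: z {hz} => [y y'] [/(up_cover P)[i iy] /(up_cover P)[j jy]].
    by rewrite (step2E _ iy jy) mxE.
  have : \sum_s x s *: triangle _ (enum_val s) = 0 :> 'M[R[i]]_n.
    transitivity (to_cycle (\sum_s x s *: e s)); last first.
      by apply/matrixP => i j; rewrite xe !mxE mulr0.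
    apply/matrixP => i j; rewrite mxE !summxE mulr_sumr; apply: eq_bigr => t _.
    rewrite mxE -{1}[triangle _ _](of_cycleK (triangle_anti _ _)) !mxE; ring.
  move=> /matrixP/(_ (lift ord0 (val (enum_val s)).1) (lift ord0 (val (enum_val s)).2)).
  rewrite [RHS]mxE summxE (bigD1 s)//= mxE triangle_coord eqxx mulr1 big1 ?addr0// => t ts.
  by rewrite mxE triangle_coord (inj_eq enum_val_inj) (negbTE ts) mulr0.
move=> h /S2[b [ba b0 hb]]; set z := to_cycle b.
have za : z^T = - z by exact: to_cycle_anti.
exists (fun s => z (lift ord0 (val (enum_val s)).1) (lift ord0 (val (enum_val s)).2)).
apply: filterS hb => y hy Oy; rewrite hy// -eS//; congr (step2 _ y).
rewrite -[LHS]to_cycleK// -/z [in LHS](triangle_decomp za); last first.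
  by move=> i; rewrite to_cycle_row b0 mulr0.
rewrite (reindex_onto enum_val enum_rank)/=; last by move=> s _; exact: enum_rankK.
under eq_bigl do rewrite enum_valK eqxx.
apply/matrixP => i j; rewrite mxE !summxE mulr_sumr; apply: eq_bigr => t _.
by rewrite /e /cycle_fun !mxE; ring.
Qed.

Lemma ker_delta_rho_dim :
  has_dim mu2 Om2 [set h | delta_rho mu holes alpha h (fun=> 0)] 'C(N, 2).
Proof.
apply: has_dim_cycles => [b ba b0|h hr].
  split; first exact: L2rho_step2.
  have := delta_op_step2 ba; rewrite /delta_op OmE (OmegaE_E OmE).
  move=> /op_closure_eq; apply => // x /set_mem/(up_cover P)[i ix].
  by rewrite (up_stepE _ ix).
have [/L2rhoP[b ba hb] _] := hr; exists b; split => // i; apply: (mulfI (mass_neq0 i)).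
by rewrite mulr0 -(delta_weak_step2 i (L2rho_L2 (proj1 hr)) hb (proj2 hr)) Cint0.
Qed.

(** ** Existence of an eigenbasis *)

Local Notation sm i := (Num.sqrt (m i)).

Lemma sm_gt0 i : 0 < sm i.
Proof. by rewrite sqrtr_gt0; exact: mass_gt0. Qed.

Lemma sm_sqr i : sm i * sm i = m i.
Proof. by rewrite -expr2 sqr_sqrtr//; exact: mass_ge0. Qed.

Lemma smV i : ((sm i)^-1)%:C%C * (sm i)%:C%C = 1 :> R[i].
Proof. by rewrite -rmorphM/= mulVf// gt_eqF// sm_gt0. Qed.

(** Passage from the coordinates in the orthonormal basis of normalised
    indicators of products of holes to the values on these products. *)
Definition coef (u : 'rV[R[i]]_(n * n)) : 'M[R[i]]_n :=
  \matrix_(i, j) (((sm i * sm j)^-1)%:C%C * vec_mx u i j).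

Lemma coefE u i j : coef u i j = ((sm i * sm j)^-1)%:C%C * vec_mx u i j.
Proof. by rewrite mxE. Qed.

Lemma vec_mxE (u : 'rV[R[i]]_(n * n)) i j : u 0 (mxvec_index i j) = vec_mx u i j.
Proof. by rewrite mxE. Qed.

(** The matrix of [d] on functions constant on holes, in orthonormal bases; its
    conjugate transpose is that of [delta] on antisymmetric functions, which
    makes the matrix of [Delta_rho] visibly hermitian. *)
Definition dmx : 'M[R[i]]_(n, n * n) := \matrix_(a < n) mxvec (\matrix_(i, j)
  (k i j / 2 * (sm j * (a == i)%:R - sm i * (a == j)%:R))%:C%C).

Lemma dmxE (a i j : 'I_n) : dmx a (mxvec_index i j) =
  (k i j / 2 * (sm j * (a == i)%:R - sm i * (a == j)%:R))%:C%C.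
Proof. by rewrite mxE mxvecE mxE. Qed.

Lemma sum_mxvec (F : 'I_(n * n) -> R[i]) :
  \sum_l F l = \sum_i \sum_j F (mxvec_index i j).
Proof.
by rewrite (reindex _ (curry_mxvec_bij _ _))/= pair_bigA; apply: eq_bigr => -[].
Qed.

Lemma inner_coef u w : inner mu2 Om2 (step2 (coef u)) (step2 (coef w)) =
  \sum_l u 0 l * conjc (w 0 l).
Proof.
rewrite inner_step2 sum_mxvec; apply: eq_bigr => i _; apply: eq_bigr => j _.
rewrite !coefE !vec_mxE conjcZ mulrACA -rmorphM/= [LHS]mulrA -rmorphM/=.
suff -> : m i * m j * ((sm i * sm j)^-1 * (sm i * sm j)^-1) = 1 by rewrite mul1r.
have := sm_sqr i; have := sm_sqr j; have := sm_gt0 j; have := sm_gt0 i.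
by move: (sm i) (sm j) => x y hx hy <- <-; field; rewrite !gt_eqF.
Qed.

Lemma sum_delta (F : 'I_n -> R[i]) (a : 'I_n) : \sum_i F i * (a == i)%:R = F a.
Proof.
rewrite (bigD1 a)//= eqxx mulr1 big1 ?addr0// => i ia.
by rewrite eq_sym (negbTE ia) mulr0.
Qed.

Lemma dmx_adj u (a : 'I_n) : (vec_mx u)^T = - vec_mx u ->
  (u *m map_mx Num.conj dmx^T) 0 a = (sm a)%:C%C * bdry (coef u) a.
Proof.
move=> ua; rewrite mxE sum_mxvec.
pose F i j := vec_mx u i j * (k i j / 2 * sm j)%:C%C.
transitivity (\sum_i (\sum_j F i j) * (a == i)%:R + \sum_j (\sum_i F j i) * (a == j)%:R).
  rewrite [X in _ = _ + X](eq_bigr (fun j => \sum_i F j i * (a == j)%:R)); last first.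
    by move=> j _; rewrite mulr_suml.
  rewrite [X in _ = _ + X]exchange_big/= -big_split/=; apply: eq_bigr => i _.
  rewrite mulr_suml -big_split/=; apply: eq_bigr => j _.
  rewrite mxE [dmx^T _ _]mxE dmxE -[Num.conj _]/(conjc _) conjc_real.
  rewrite vec_mxE.
  rewrite /F (antiE j i ua) (ker_sym p_prime _ P j i) mulrBr rmorphB !rmorphM/= !rmorph_nat.
  by ring.
rewrite !sum_delta -big_split/= mulr_sumr; apply: eq_bigr => j _.
rewrite mxE -mulr2n -mulr_natl -(rmorph_nat (real_complex R)) /F.
rewrite [LHS]mulrCA [RHS]mulrA [RHS]mulrA [RHS]mulrC; congr (_ * _).
rewrite -!rmorphM/=; congr (_%:C%C).
have := sm_sqr j; have := sm_gt0 j; have := sm_gt0 a.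
by move: (sm a) (sm j) => x y hx hy <-; field; rewrite !gt_eqF.
Qed.

Lemma dmx_diff (v : 'rV[R[i]]_n) i j : vec_mx (v *m dmx) i j =
  (sm i * sm j)%:C%C * diff (fun i => ((sm i)^-1)%:C%C * v 0 i) i j.
Proof.
rewrite mxE mxE [diff _ _ _]mxE.
transitivity ((k i j / 2)%:C%C * ((sm j)%:C%C * \sum_a v 0 a * (i == a)%:R -
    (sm i)%:C%C * \sum_a v 0 a * (j == a)%:R)).
  rewrite !mulr_sumr -sumrB mulr_sumr; apply: eq_bigr => a _.
  rewrite dmxE !rmorphM rmorphB !rmorphM/= !rmorph_nat ![a == _]eq_sym; ring.
rewrite !sum_delta [RHS]mulrCA; congr (_ * _).
have hi := smV i; have hj := smV j.
rewrite mulrBr rmorphM/=; congr (_ - _).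
  by rewrite -[LHS]mulr1 -hi; ring.
by rewrite -[LHS]mulr1 -hj; ring.
Qed.

Lemma coef_Delta u : (vec_mx u)^T = - vec_mx u ->
  coef (u *m (map_mx Num.conj dmx^T *m dmx)) = diff (bdry (coef u)).
Proof.
move=> ua; apply/matrixP => i j; rewrite mxE mulmxA dmx_diff mulrA -rmorphM/=.
rewrite mulVf ?mul1r; last by rewrite gt_eqF// mulr_gt0 ?sm_gt0.
rewrite mxE [RHS]mxE !dmx_adj//; congr (_ * (_ - _)); by rewrite mulrA smV mul1r.
Qed.

Definition antimx : 'M[R[i]]_(n * n) := kermx (lin_mx (idfun \+ @trmx R[i] n n)).

Lemma antimxP u : reflect ((vec_mx u)^T = - vec_mx u) (u <= antimx)%MS.
Proof.
apply: (iffP sub_kermxP); rewrite mul_rV_lin /=.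
  by move=> /(canRL mxvecK); rewrite linear0 => /eqP; rewrite addrC addr_eq0 => /eqP.
by move=> ->; rewrite subrr linear0.
Qed.

Lemma antimx_stable : (antimx *m (map_mx Num.conj dmx^T *m dmx) <= antimx)%MS.
Proof.
rewrite mulmxA; apply/row_subP => l; rewrite row_mul; apply/antimxP.
set a := fun i => ((sm i)^-1)%:C%C * row l (antimx *m map_mx Num.conj dmx^T) 0 i.
apply/matrixP => i j; rewrite mxE [RHS]mxE !dmx_diff -/a.
by rewrite (antiE j i (diff_anti a)) mulrN [sm j * _]mulrC.
Qed.

Lemma trace_Delta_exists : exists tr, is_trace_Delta_rho mu holes alpha tr.
Proof.
have Ah i j : (map_mx Num.conj dmx^T *m dmx) i j =
    Num.conj ((map_mx Num.conj dmx^T *m dmx) j i).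
  rewrite !mxE rmorph_sum/=; apply: eq_bigr => a _.
  by rewrite !mxE rmorphM/= conjCK mulrC.
have [r [E [lam [E1 E2 E3 lamr]]]] := hermitian_stable_eigenbasis Ah antimx_stable.
have Ea l : (vec_mx (row l E))^T = - vec_mx (row l E).
  by apply/antimxP; rewrite -E2 row_sub.
pose e (l : 'I_r) := step2 (coef (row l E)).
have ca u : (vec_mx u)^T = - vec_mx u -> (coef u)^T = - coef u.
  move=> ua; apply/matrixP => i j.
  by rewrite mxE [RHS]mxE !coefE (antiE j i ua) mulrN [sm j * _]mulrC.
pose ee (i : nat) : Q * Q -> R[i] := if insub i is Some l then e l else fun=> 0.
pose ll (i : nat) : R := if insub i is Some l then complex.Re (lam l) else 0.
have eeE (l : 'I_r) : ee l = e l by rewrite /ee valK.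
have llE (l : 'I_r) : ll l = complex.Re (lam l) by rewrite /ll valK.
eexists; exists `I_r, ee, ll; split; last by move=> t; reflexivity.
rewrite (OmegaE_E OmE); split.
- move=> l /= lr; rewrite -[l]/(val (Ordinal lr)) eeE llE.
  split; first by apply: L2rho_step2; exact: ca.
  exists (up_step P (bdry (coef (row (Ordinal lr) E)))); split.
    by split; [apply: L2rho_step2; exact: ca|apply: delta_op_step2; exact: ca].
  have := d_op_up_step (bdry (coef (row (Ordinal lr) E))).
  rewrite /d_op => /op_closure_eq; apply => //.
  move=> [x y]; rewrite (OmegaE_E OmE) => /set_mem[/= /(up_cover P)[i' ix] /(up_cover P)[j jy]].
  rewrite /e !(step2E _ ix jy) -coef_Delta// E3 RRe_real//.
  rewrite !mxE; ring.
- move=> x y /= xr yr; rewrite -[x]/(val (Ordinal xr)) -[y]/(val (Ordinal yr)) !eeE.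
  rewrite /e inner_coef; have /matrixP/(_ (Ordinal xr) (Ordinal yr)) := E1.
  by rewrite !mxE => <-; apply: eq_bigr => l _; rewrite !mxE.
move=> h hr h0; have [b ba hb] := L2rhoP hr.
pose B : 'M[R[i]]_n := \matrix_(i, j) ((sm i * sm j)%:C%C * b i j).
have cB : coef (mxvec B) = b.
  apply/matrixP => i j; rewrite mxE mxvecK mxE mulrA -rmorphM/=.
  by rewrite mulVf ?mul1r// gt_eqF// mulr_gt0 ?sm_gt0.
suff B0 : mxvec B = 0.
  apply: eq_ae_trans hb _; apply: aeW => -[x y] [/(up_cover P)[i ix] /(up_cover P)[j jy]].
  by rewrite -cB B0 (step2E _ ix jy) !mxE mulr0.
have : (mxvec B <= antimx)%MS.
  apply/antimxP; rewrite mxvecK; apply/matrixP => i j.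
  by rewrite !mxE (antiE j i ba) mulrN [sm j * _]mulrC.
rewrite -E2 => /submxP[y yE].
suff : mxvec B *m map_mx Num.conj E^T = 0.
  by rewrite {1}yE -mulmxA E1 mulmx1 => y0; rewrite yE y0 mul0mx.
apply/rowP => l; rewrite [RHS]mxE -(h0 l)//= eeE.
rewrite (inner_ae mO2 (L2rho_L2 hr) (step2_L2 b) (step2_L2 _) hb).
have -> : inner mu2 Om2 (step2 b) (e l) = inner mu2 Om2 (step2 (coef (mxvec B))) (e l).
  by rewrite cB.
by rewrite inner_coef mxE; apply: eq_bigr => i _; rewrite !mxE.
Qed.

(** ** The trace as time goes to infinity *)

(** Used to see that an eigenbasis of [Delta_rho] is finite. *)
Lemma has_dim_step2 :
  has_dim mu2 Om2 [set h | L2 mu2 Om2 h /\ exists b, eq_ae mu2 Om2 h (step2 b)]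
    #|{: 'I_n * 'I_n}|.
Proof.
pose e (s : 'I_#|{: 'I_n * 'I_n}|) : 'M[R[i]]_n :=
  delta_mx (enum_val s).1 (enum_val s).2.
have eS (x : 'I_#|{: 'I_n * 'I_n}| -> R[i]) z : Om2 z ->
    step2 (\sum_s x s *: e s) z = \sum_s x s * step2 (e s) z by exact: step2_sum.
exists (fun s => step2 (e s)); split.
- by move=> s; split; [exact: step2_L2|exists (e s); exact: eq_ae_refl].
- move=> x x0 s.
  have /step2_inj/matrixP/(_ (enum_val s).1 (enum_val s).2) :
      eq_ae mu2 Om2 (step2 (\sum_s x s *: e s)) (step2 0).
    apply: filterS x0 => z hz Oz; rewrite eS// hz//; move: Oz.
    move: z {hz} => [y y'] [/(up_cover P)[i iy] /(up_cover P)[j jy]].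
    by rewrite (step2E _ iy jy) mxE.
  rewrite [RHS]mxE summxE (bigD1 s)//= !mxE !eqxx mulr1 big1 ?addr0// => t ts.
  rewrite !mxE -xpair_eqE -!surjective_pairing (inj_eq enum_val_inj).
  by rewrite eq_sym (negbTE ts) mulr0.
move=> h [Lh [b hb]]; exists (fun s => b (enum_val s).1 (enum_val s).2).
apply: filterS hb => y hy Oy; rewrite hy// -eS//; congr (step2 _ y).
rewrite [LHS]matrix_sum_delta pair_bigA/=.
rewrite (reindex_onto enum_val enum_rank)/=; last by move=> s _; exact: enum_rankK.
by apply: eq_bigl => s; rewrite enum_valK eqxx.
Qed.

Lemma step2_ae_sum (I : finType) (x : I -> R[i]) (b : I -> 'M[R[i]]_n) e :
  (forall s, eq_ae mu2 Om2 (e s) (step2 (b s))) ->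
  eq_ae mu2 Om2 (fun z => \sum_s x s * e s z) (step2 (\sum_s x s *: b s)).
Proof.
move=> eb; have : {ae mu2, forall z, forall s, Om2 z -> e s z = step2 (b s) z}.
  by apply: filter_forall => s; exact: eb.
apply: filterS => z hz Oz; rewrite step2_sum//.
by apply: eq_bigr => s _; rewrite hz.
Qed.

(** [<Delta h, h> = |delta h|^2]. *)
Lemma bdry_energy b lam : b^T = - b -> lam%:C%C *: b = diff (bdry b) ->
  lam%:C%C * inner mu2 Om2 (step2 b) (step2 b) =
  \sum_i (m i)%:C%C * (bdry b i * conjc (bdry b i)).
Proof.
move=> ba bE; rewrite inner_step2 mulr_sumr -bdry_adj// -bE.
apply: eq_bigr => i _; rewrite mulr_sumr; apply: eq_bigr => j _.
by rewrite [(_ *: b) i j]mxE; ring.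
Qed.

Section eigenbasis_rho.
Variables (I : set nat) (f : nat -> Q * Q -> R[i]) (lam : nat -> R).
Hypothesis If : eigenbasis mu2 (OmegaE holes) (L2rho mu holes)
  (Delta_rho mu holes alpha) I f lam.

Lemma eig_rho_step2 i : I i -> exists b, [/\ b^T = - b,
  eq_ae mu2 Om2 (f i) (step2 b) & (lam i)%:C%C *: b = diff (bdry b)].
Proof.
case: If => h _ _ /h[fr fD]; have [b ba hb] := L2rhoP fr.
by exists b; split => //; exact: Delta_rho_weak hb fD.
Qed.

Lemma eig_rho_L2 i : I i -> L2 mu2 Om2 (f i).
Proof. by case: If => h _ _ /h[/L2rho_L2]. Qed.

Lemma eig_rho_on i j : I i -> I j -> inner mu2 Om2 (f i) (f j) = (i == j)%:R.
Proof. by rewrite -(OmegaE_E OmE); case: If => _ h _; exact: h. Qed.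

Lemma inner_step2_eig b c h g : L2 mu2 Om2 h -> L2 mu2 Om2 g ->
  eq_ae mu2 Om2 h (step2 b) -> eq_ae mu2 Om2 g (step2 c) ->
  inner mu2 Om2 h g = inner mu2 Om2 (step2 b) (step2 c).
Proof.
move=> Lh Lg hb gc; have Lb := step2_L2 b; have Lc := step2_L2 c.
rewrite (inner_ae mO2 Lh Lb Lg hb) (inner_conj mO2 Lg Lb).
by rewrite (inner_ae mO2 Lg Lc Lb gc) -(inner_conj mO2 Lc Lb).
Qed.

Lemma eig_rho_energy i : I i -> exists b, [/\ b^T = - b,
  eq_ae mu2 Om2 (f i) (step2 b), (lam i)%:C%C *: b = diff (bdry b) &
  (lam i)%:C%C = \sum_i (m i)%:C%C * (bdry b i * conjc (bdry b i))].
Proof.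
move=> Ii; have [b [ba hb bE]] := eig_rho_step2 Ii; exists b; split => //.
have Lf := eig_rho_L2 Ii.
rewrite -(bdry_energy ba bE) -(inner_step2_eig Lf Lf hb hb) eig_rho_on// eqxx.
by rewrite mulr1.
Qed.

Lemma energy_ge0 i b : 0 <= (m i)%:C%C * (bdry b i * conjc (bdry b i)).
Proof. by rewrite mulr_ge0// ?ler0c ?mass_ge0// mul_conjC_ge0. Qed.

Lemma eig_rho_ge0 i : I i -> 0 <= lam i.
Proof.
move=> /eig_rho_energy[b [_ _ _ lE]]; rewrite -ler0c lE.
by apply: sumr_ge0 => j _; exact: energy_ge0.
Qed.

(** By the energy identity the eigenfunctions with eigenvalue zero are cycles;
    the others are orthogonal to all cycles since they lie in the image of [d],
    the adjoint of [delta]. *)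
Lemma eig_rho_zero_card : (I `&` [set i | lam i = 0%R] #= `I_('C(N, 2)))%card.
Proof.
pose S := [set h | L2 mu2 Om2 h /\ exists b, [/\ b^T = - b,
  forall i, bdry b i = 0 & eq_ae mu2 Om2 h (step2 b)]].
have S1 : has_dim mu2 Om2 S 'C(N, 2).
  apply: has_dim_cycles => [b ba b0|h []//].
  by split; [exact: step2_L2|exists b; split => //; exact: eq_ae_refl].
apply: (@orthonormal_card _ _ _ _ _ mO2 S _ S1 _ _ _ f).
- by move=> h [].
- move=> r x e Se; split; first by apply: L2_sum => // i; case: (Se i).
  have [b bP] := choice (fun i => proj2 (Se i)).
  exists (\sum_i x i *: b i); split.
  + rewrite linear_sum/= -sumrN; apply: eq_bigr => i _.
    by case: (bP i) => ba _ _; rewrite linearZ/= ba scalerN.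
  + move=> i; rewrite /bdry.
    under eq_bigr do rewrite summxE mulr_sumr; rewrite exchange_big/= big1// => s _.
    case: (bP s) => _ /(_ i) b0 _; under eq_bigr do rewrite mxE mulrCA.
    by rewrite -mulr_sumr -/(bdry (b s) i) b0 mulr0.
  + by apply: step2_ae_sum => i; case: (bP i).
- move=> i [Ii /= li]; split; first exact: eig_rho_L2.
  have [b [ba hb _ lE]] := eig_rho_energy Ii; exists b; split => // j.
  move/eqP: lE; rewrite li rmorph0 eq_sym psumr_eq0; last by move=> s _; exact: energy_ge0.
  move=> /allP/(_ j)/(_ (mem_index_enum _)).
  by rewrite !mulf_eq0 (negbTE (mass_neq0 j)) conjC_eq0 orbb/= => /eqP.
- by move=> i j [Ii _] [Ij _]; exact: eig_rho_on.
move=> h [Lh [b [ba b0 hb]]] h0; apply: (eq_ae_trans hb).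
have Lb := step2_L2 b.
rewrite -(OmegaE_E OmE); case: If => _ _ tot; apply: tot; first exact: L2rho_step2.
rewrite (OmegaE_E OmE) => i Ii; rewrite -(inner_ae mO2 Lh Lb (eig_rho_L2 Ii) hb).
have [li|li] := eqVneq (lam i) 0; first exact: h0.
have [b' [ba' hb' bE']] := eig_rho_step2 Ii; have Lf := eig_rho_L2 Ii.
rewrite (inner_conj mO2 Lf Lh) (inner_step2_eig Lf Lh hb' hb).
have -> : inner mu2 Om2 (step2 b') (step2 b) = 0; last exact: conjc0.
have lc : (lam i)%:C%C != 0 :> R[i] by rewrite fmorph_eq0.
apply: (mulfI lc); rewrite mulr0 inner_step2 mulr_sumr.
transitivity (\sum_i (m i)%:C%C * (bdry b' i * conjc (bdry b i))).
  rewrite -bdry_adj// -bE'; apply: eq_bigr => s _; rewrite mulr_sumr.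
  by apply: eq_bigr => t _; rewrite [(_ *: b') s t]mxE; ring.
by rewrite big1// => s _; rewrite b0 conjc0 !mulr0.
Qed.

Lemma eig_rho_finite : finite_set I.
Proof.
apply: (@orthonormal_finite _ _ _ _ _ mO2 _ _ has_dim_step2 _ _ _ f).
- by move=> h [].
- move=> r x e Se; split; first by apply: L2_sum => // i; case: (Se i).
  have [b bP] := choice (fun i => proj2 (Se i)).
  by exists (\sum_i x i *: b i); exact: step2_ae_sum.
- move=> i Ii; split; first exact: eig_rho_L2.
  by have [b [_ hb _]] := eig_rho_step2 Ii; exists b.
- exact: eig_rho_on.
Qed.

End eigenbasis_rho.

Lemma trace_Delta_cvg tr : is_trace_Delta_rho mu holes alpha tr ->
  tr t @[t --> +oo] --> (('C(N, 2))%:R : R)%:E.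
Proof.
move=> [I [f [lam [If trE]]]].
have /finite_seqP[s Is] := eig_rho_finite If.
have [lm lm0 lmI] := seq_pos_lower_bound s lam.
rewrite (_ : tr = fun t => \esum_(i in I) (expR (- lam i * t))%:E)%E; last first.
  by apply/funext => t; exact: trE.
apply: (heat_trace_cvg lm0 (eig_rho_zero_card If) _ (C := (size s)%:R) (t0 := 0)).
  move=> i Ii li; apply: lmI; first by move: Ii; rewrite Is.
  by rewrite lt_neqAle (eig_rho_ge0 If Ii) andbT eq_sym; exact/eqP.
move=> u uu uI; rewrite (eq_bigr (fun=> 1)); last by move=> i _; rewrite mulr0 expR0.
rewrite big_const_seq count_predT iter_addr addr0 ler_nat.
by apply: uniq_leq_size => // i /uI[]; rewrite Is.
Qed.

End rho.

(** * The holes of a good fundamental domain *)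

Section disjoint_balls.
Context (p : nat) (p_prime : prime p) (R : realType) (K : padicField p R).
Variables (n : nat) (a : 'I_n -> Qp K) (r : 'I_n -> R).
Local Notation ball i := ([set x | absp (x - a i) < r i] : set (Qp K)).
Hypothesis r_gt0 : forall i, 0 < r i.
Hypothesis ball_disj : forall i j x, ball i x -> ball j x -> i = j.

Let Om : set (Qp K) := \bigcup_(i in [set: 'I_n]) ball i.

Lemma ball_ctr i : ball i (a i).
Proof. by rewrite /= subrr absp0. Qed.

Lemma ball_small : exists l, forall i, p%:R ^- l < r i.
Proof.
have [l lr] := choice (fun i => expp_small p_prime (r_gt0 i)).
exists (\max_i l i)%N => i; apply: le_lt_trans (lr i).
by rewrite lepX//; exact: leq_bigmax.
Qed.

Lemma ball_bounded : exists m, forall x, Om x -> absp x <= p%:R ^+ m.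
Proof.
have B0 i : 0 < (Num.max (absp (a i)) (r i))^-1.
  by rewrite invr_gt0 lt_max r_gt0 orbT.
have [l lB] := choice (fun i => expp_small p_prime (B0 i)).
exists (\max_i l i)%N => x [i _ ix].
apply: (@le_trans _ _ (Num.max (absp (a i)) (r i))).
  have -> : x = a i + (x - a i) by rewrite addrC subrK.
  apply: le_trans (absp_max _ _) _; rewrite ge_max !le_max lexx/=.
  by rewrite [absp (x - _) <= r i]ltW// orbT.
rewrite -[leLHS]invrK -[leRHS]invrK lef_pV2 ?posrE ?expp_gt0//.
  by apply: le_trans (ltW (lB i)); rewrite lepX//; exact: leq_bigmax.
Qed.

Lemma ball_stable l i x y : (forall i, p%:R ^- l < r i) -> ball i x ->
  absp (x - y) <= p%:R ^- l -> ball i y.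
Proof.
move=> lr ix xy; apply: absp_dist_lt ix => //.
by rewrite absp_distC// (le_lt_trans xy).
Qed.

(** The centre of one ball is outside of the other, so their distance exceeds
    both distances to the centres. *)
Lemma ball_dist i j x y : i != j -> ball i x -> ball j y ->
  absp (x - y) = absp (a i - a j).
Proof.
move=> ij ix jy; have far : r i <= absp (a i - a j) /\ r j <= absp (a i - a j).
  split; rewrite leNgt; apply/negP => h; move/eqP: ij; apply.
    by apply: (ball_disj (x := a j)); [rewrite /= absp_distC|exact: ball_ctr].
  by apply: (ball_disj (x := a i)); [exact: ball_ctr|].
have xj : absp (x - a j) = absp (a i - a j).
  by apply: absp_isosceles => //; rewrite absp_distC//; apply: lt_le_trans ix far.1.
rewrite absp_distC// -xj [RHS]absp_distC//; apply: absp_isosceles => //.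
by rewrite [ltRHS]absp_distC// xj absp_distC//; apply: lt_le_trans jy far.2.
Qed.

Lemma ball_partition : exists D : clopen_domain K, dom_set D = Om /\
  exists P : ultra_partition D 'I_n, forall i, P i = ball i.
Proof.
have [l lr] := ball_small; have [m Om_m] := ball_bounded.
have [|D DE] := clopen_domain_exists p_prime (n0 := l) _ Om_m.
  by move=> x y [i _ ix] xy; exists i => //; exact: ball_stable ix xy.
exists D; split => //.
have rl : rad D l <= p%:R ^- l by rewrite /rad lepX// leq_addl.
unshelve eexists.
  apply: (@UltraPartition _ _ _ D _ (fun i => ball i) a l).
  - by move=> x; rewrite DE => -[i _ ix]; exists i.
  - by move=> i x ix; rewrite DE; exists i.
  - exact: ball_disj.
  - exact: ball_ctr.
  - by move=> i x y ix xy; apply: ball_stable ix _ => //; exact: le_trans rl.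
  - exact: ball_dist.
by [].
Qed.

End disjoint_balls.

Section inner_holes.
Context (p : nat) (R : realType) (K : padicField p R).
Context (g : nat) (X : mumford_curve K g) (F : good_fundamental_domain X).
Local Notation D j := (two_sides (fd_B F) (fd_C F) j).

(** At most one of the discs contains infinity, and there are at least two. *)
Lemma inner_holes_neq0 : (0 < g)%N -> exists H, inner_holes F H.
Proof.
move=> g0; pose i := Ordinal g0.
have [iB|iB] := boolP (disc_at_infty (D (inl i))).
  exists [set x | open_disc (D (inr i)) (Some x)], (inr i); split => //= iC.
  have : (closed_disc (D (inl i)) `&` closed_disc (D (inr i))) None by [].
  by rewrite fd_disjoint.
exists [set x | open_disc (D (inl i)) (Some x)], (inl i); split => //=.
exact/negP.
Qed.

Lemma open_sub_closed (B : disc K) : open_disc B `<=` closed_disc B.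
Proof. by move=> [x|]//=; case: ifP => _ /ltW. Qed.

Lemma inner_holes_balls N : (inner_holes F #= `I_N)%card ->
  exists (a : 'I_N -> Qp K) (r : 'I_N -> R), [/\ forall i, 0 < r i,
    forall i j x, absp (x - a i) < r i -> absp (x - a j) < r j -> i = j &
    forall H, inner_holes F H <-> exists i, H = [set x | absp (x - a i) < r i]].
Proof.
rewrite card_eq_sym => /card_set_bijP[f [fH finj fsurj]].
have /choice[j jP] (i : 'I_N) : exists j, ~ open_disc (D j) None /\
    f i = [set x | open_disc (D j) (Some x)].
  exact: (fH (i : nat) (ltn_ord i)).
have jE i : [set x | open_disc (D (j i)) (Some x)] =
    [set x | absp (x - disc_centre (D (j i))) < disc_radius (D (j i))].
  by case: (jP i) => /= /negP/negbTE-> _.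
exists (fun i => disc_centre (D (j i))), (fun i => disc_radius (D (j i))); split.
- by move=> i; exact: disc_radius_gt0.
- move=> i k x ix kx; have ijk : j i = j k.
    apply/eqP; apply: contrapT => /negP jik.
    have oi : open_disc (D (j i)) (Some x).
      by rewrite -[open_disc _ _]/([set x | open_disc (D (j i)) (Some x)] x) jE.
    have ok : open_disc (D (j k)) (Some x).
      by rewrite -[open_disc _ _]/([set x | open_disc (D (j k)) (Some x)] x) jE.
    have : (closed_disc (D (j i)) `&` closed_disc (D (j k))) (Some x).
      by split; exact: open_sub_closed.
    by rewrite fd_disjoint.
  have fik : f i = f k by rewrite (jP i).2 (jP k).2 ijk.
  by apply: val_inj; apply: finj fik; rewrite inE; exact: ltn_ord.
move=> H; split => [/fsurj[i iN <-]|[i ->]].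
  by exists (Ordinal iN); rewrite -jE -(jP _).2.
by rewrite -jE -(jP i).2; exact: (fH (i : nat) (ltn_ord i)).
Qed.

End inner_holes.

Lemma bin2_real (R : realType) n :
  ('C(n, 2))%:R = (n%:R ^+ 2 - n%:R) / 2 :> R.
Proof.
elim: n => [|n IH]; first by rewrite bin0n expr0n/= subrr mul0r.
by rewrite binS bin1 natrD IH -natr1; field.
Qed.
Theorem corollary5p2 (p : nat) (p_prime : prime p) (R : realType)
    (K : padicField p R)
    (mu : {sigma_finite_measure set (Qp K) -> \bar R}) (mu_haar : is_haar mu)
    (g : nat) (g_gt0 : (0 < g)%N)
    (X : mumford_curve K g) (F : good_fundamental_domain X)
    (F_affine : fd_set F `<=` range Some)
    (N : nat) (card_holes : (inner_holes F #= `I_N)%card)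
    (alpha : R) (alpha_gt0 : 0 < alpha) :
  exists ind : int,
    [/\ is_index mu (inner_holes F) alpha ind,
        ind%:~R = - (1 / 2) * N%:R ^+ 2 + 3 / 2 * N%:R :> R,
        exists trD, is_trace_D mu (inner_holes F) alpha trD,
        exists trDelta, is_trace_Delta_rho mu (inner_holes F) alpha trDelta &
        1 / 2 <= alpha ->
        forall trD trDelta : R -> \bar R,
          is_trace_D mu (inner_holes F) alpha trD ->
          is_trace_Delta_rho mu (inner_holes F) alpha trDelta ->
          (trD t - trDelta t)%E @[t --> +oo%R] --> (ind%:~R)%:E].

Proof.
have [a [r [r0 disj holesE]]] := inner_holes_balls card_holes.
have [Om [OmU [P PE]]] := ball_partition p_prime r0 disj.
have OmE : OmegaV (inner_holes F) = dom_set Om.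
  rewrite OmU; apply/seteqP; split => [x [H /holesE[i ->] ix]|x [i _ ix]].
    by exists i.
  by exists [set x | absp (x - a i) < r i] => //; apply/holesE; exists i.
have {}holesE H : inner_holes F H <-> exists i, H = P i.
  rewrite holesE; split => -[i ->]; exists i; by rewrite PE.
have [H0 /holesE[i0 _]] := inner_holes_neq0 F g_gt0.
case: N => [|N] in card_holes a r r0 disj OmU P PE holesE i0 *; first by case: i0.
have Om_neq0 : exists x, Om x by exists (up_ctr P i0); exact: (up_sub (up_in P i0)).
exists (1 - ('C(N, 2))%:Z); split.
- exists 1%N, 'C(N, 2); split => //.
    rewrite OmE; exact: (ker_d_dim p_prime mu_haar OmE).
  rewrite (OmegaE_E OmE); exact: (ker_delta_rho_dim p_prime mu_haar OmE alpha_gt0 holesE).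
- rewrite intrB -[1%:~R]/(1 : R) -[X in _ - X]/(('C(N, 2))%:R) bin2_real -natr1; by field.
- exact: (trace_D_exists p_prime mu_haar OmE alpha_gt0).
- exact: (trace_Delta_exists p_prime mu_haar OmE alpha holesE).
move=> alpha_ge trD trDelta DE DeltaE.
rewrite intrB EFinB; apply: cvgeB => //.
  exact: (trace_D_cvg p_prime mu_haar OmE alpha_gt0 Om_neq0 alpha_ge DE).
exact: (trace_Delta_cvg p_prime mu_haar OmE alpha_gt0 holesE DeltaE).
Qed.
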